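(* Let $n\ge 1$ and $m\ge 0$ be integers and let $L:Y^m_n\to\mathbb{R}$ be a smooth function such that $$D_uD_vD_wL=0\quad\text{for all directions } u,v,w\in \{0\}\times(\mathbb{R}^n)^{\otimes 3}\times(\mathbb{R}^n)^{\otimes 4}\times(\mathbb{R}^n)^{\otimes m}\times(\mathbb{R}^n)^{\otimes (m+1)}.$$ Suppose that, for every triple $(M^n,g,D)$, where $M$ is a smooth $n$-manifold, $g$ is a Lorentz metric on $M$ and $D$ is a smooth tensor field of type $(0,m)$ on $M$, there exists a function $f_{g,D}\in C^\infty(M)$ such that $$L(g_{ij},g_{ij,k},g_{ij,kl},D_{i_1\cdots i_m},D_{i_1\cdots i_m,k})=f_{g,D}$$ in all coordinate systems on $M$. Then there are constants $a,b,c\in\mathbb{R}$, a quadratic invariant $Q_g(D)=\mu^{IJ}(g_{ab})D_ID_J$, an invariant trace term $T_g(D)=\lambda^I(g_{ab})D_I$, and an invariant divergence term $Bd_g(D)=\beta^{Ij}(g_{ab})D_{I;j}$ such that $$f_{g,D}=a+bR_g+c|d\gamma|_g^2+Q_g(D)+T_g(D)+Bd_g(D)$$ for all triples $(M,g,D)$, where $d\gamma$ is the exterior derivative of the $m$-form $\gamma$ with components $$\gamma_{i_1\cdots i_m}=\frac{1}{m!}\sum_{\sigma\in S_m}\mathrm{sgn}(\sigma)D_{i_{\sigma(1)}\cdots i_{\sigma(m)}}.$$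
   Context: All indices run from $0$ to $n-1$, and repeated indices (including multi-indices) are summed. Capital letters $I,J$ denote multi-indices of length $m$, e.g. $D_I=D_{i_1\cdots i_m}$. A comma denotes partial differentiation in the given coordinate chart ($g_{ij,k}=\partial_k g_{ij}$, $g_{ij,kl}=\partial_l\partial_k g_{ij}$, $D_{I,j}=\partial_jD_I$). A semicolon denotes covariant differentiation with respect to the Levi-Civita connection of $g$. Domain: let $$W_n=\{(w_{ij},w_{ijk},w_{ijkl})\in(\mathbb{R}^n)^{\otimes 2}\times(\mathbb{R}^n)^{\otimes 3}\times(\mathbb{R}^n)^{\otimes 4} : \det(w_{ij})\ne 0\}$$ and $Y_n^m=W_n\times(\mathbb{R}^n)^{\otimes m}\times(\mathbb{R}^n)^{\otimes(m+1)}$. At each point of a coordinate chart, $(g_{ij},g_{ij,k},g_{ij,kl},D_I,D_{I,j})$ is regarded as an element of $Y_n^m$. $D_u$ applied to a function on $Y^m_n$ denotes the directional derivative in the direction $u$ (not to be confused with the tensor field $D$). The third-derivative condition says that $L$ is a polynomial of degree at most $2$ in all variables other than $(w_{ij})$, with coefficients smooth functions of $(w_{ij})$. A Lorentz metric is a semi-Riemannian metric of signature $(-1,1,\dots,1)$. $R_g$ is the scalar curvature of $g$, the contraction with $g$ of the Ricci curvature $Ric_{ij}=dx^k(\nabla_{\partial_k}\nabla_{\partial_j}\partial_i-\nabla_{\partial_j}\nabla_{\partial_k}\partial_i)$. $|\cdot|_g^2$ is the usual (possibly indefinite) squared norm on covariant $(m+1)$-tensors induced by $g$. A quadratic invariant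 $Q_g(D)=\mu^{IJ}(g_{ab})D_ID_J$, an invariant trace term $T_g(D)=\lambda^I(g_{ab})D_I$, and an invariant divergence term $Bd_g(D)=\beta^{Ij}(g_{ab})D_{I;j}$ are expressions whose coefficients $\mu^{IJ},\lambda^I,\beta^{Ij}$ are fixed smooth functions of the matrix of metric components $(g_{ab})$ (the same functions for every chart and every $(M,g,D)$), and which are coordinate-invariant, i.e. for every triple $(M,g,D)$ they give the same function on $M$ in all coordinate charts; for the divergence term, the coefficients $\beta^{Ij}(g_{ab})$ form the components of an $(m+1,0)$-tensor field for every Lorentz manifold $(M^n,g)$. *)

(* Defs.v *)
From mathcomp Require Import all_boot all_order all_algebra all_fingroup.
From mathcomp Require Import all_classical all_reals all_analysis.
Import Order.TTheory GRing.Theory Num.Theory.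
Import numFieldNormedType.Exports.

Set Implicit Arguments.
Unset Strict Implicit.
Unset Printing Implicit Defensive.

Local Open Scope classical_set_scope.
Local Open Scope ring_scope.

(* C^k and C^oo maps on an open subset U of a finite-dimensional normed space.
   The values of f outside U are irrelevant, here and everywhere below where a
   function that lives on an open set is represented by a total one. *)
Fixpoint Ck_on (R : realType) (V W : normedModType R) (k : nat)
    (U : set V) (f : V -> W) : Prop :=
  if k is k'.+1 then
    (forall x, U x -> differentiable f x) /\
    (forall v : V, Ck_on k' U (fun x => 'D_v f x))
  else forall x, U x -> {for x, continuous f}.

Definition smooth_on (R : realType) (V W : normedModType R)
    (U : set V) (f : V -> W) : Prop := forall k, Ck_on k U f.

(* (R^n)^{\otimes k}, as a normed space: vectors of components indexed by the
   multi-indices of length k. *)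
Notation tens R n k := ('rV[R]_(#|{: k.-tuple 'I_n}|)).

Definition tco (R : realType) (n k : nat) (T : tens R n k)
    (I : k.-tuple 'I_n) : R := T 0 (enum_rank I).

Definition mktens (R : realType) (n k : nat) (F : k.-tuple 'I_n -> R) :
  tens R n k := \row_r F (enum_val r).

Definition tens2_mx (R : realType) (n : nat) (T : tens R n 2) : 'M[R]_n :=
  \matrix_(i, j) tco T [tuple i; j].

(* \sum_J F_J A_{j_1 i_1} ... A_{j_k i_k} *)
Definition tens_change (R : realType) (n k : nat) (A : 'M[R]_n)
    (F : k.-tuple 'I_n -> R) (I : k.-tuple 'I_n) : R :=
  \sum_(J : k.-tuple 'I_n) F J * \prod_(s < k) A (tnth J s) (tnth I s).

(* A chart phi : dom -> R^n, with inverse psi : phi(dom) -> dom. *)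
Record chart (R : realType) (n : nat) (M : topologicalType) := Chart {
  dom : set M;
  phi : M -> 'rV[R]_n;
  psi : 'rV[R]_n -> M;
  dom_open : open dom;
  img_open : open (phi @` dom);
  phiK : forall p, dom p -> psi (phi p) = p;
  phi_cont : {within dom, continuous phi};
  psi_cont : {within phi @` dom, continuous psi} }.

Definition transition_smooth (R : realType) (n : nat) (M : topologicalType)
    (c c' : chart R n M) : Prop :=
  smooth_on (phi c @` (dom c `&` dom c')) (phi c' \o psi c).

Definition compatible (R : realType) (n : nat) (M : topologicalType)
    (c c' : chart R n M) : Prop :=
  transition_smooth c c' /\ transition_smooth c' c.

(* The atlas is maximal, so its elements are all the coordinate systems. *)
Record manifold (R : realType) (n : nat) := Manifold {
  mtop :> topologicalType;
  atlas : set (chart R n mtop);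
  mfd_hausdorff : hausdorff_space mtop;
  mfd_second_countable : @second_countable mtop;
  atlas_cover : forall p : mtop, exists2 c, atlas c & dom c p;
  atlas_compat : forall c c', atlas c -> atlas c' -> compatible c c';
  atlas_max : forall c,
    (forall c', atlas c' -> compatible c c') -> atlas c }.

Definition mfd_smooth (R : realType) (n : nat) (M : manifold R n)
    (f : M -> R) : Prop :=
  forall c, atlas c -> smooth_on (phi c @` dom c) (f \o psi c).

(* Entry (i, j) is the i-th partial derivative, with respect to the coordinates
   of c, of the j-th coordinate of c'; it is taken at the point p. *)
Definition jac (R : realType) (n : nat) (M : manifold R n)
    (c c' : chart R n M) (p : M) : 'M[R]_n :=
  'J (phi c' \o psi c) (phi c p).

(* A smooth tensor field of type (0,k): its components in every chart, as
   functions of the coordinates, transforming covariantly. *)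
Record tensor_field (R : realType) (n : nat) (M : manifold R n) (k : nat) :=
  TensorField {
  comp :> chart R n M -> 'rV[R]_n -> tens R n k;
  comp_smooth : forall c, atlas c -> smooth_on (phi c @` dom c) (comp c);
  comp_change : forall c c' p, atlas c -> atlas c' -> dom c p -> dom c' p ->
    forall I, tco (comp c' (phi c' p)) I =
      tens_change (jac c' c p)^T (tco (comp c (phi c p))) I }.

Definition minkowski (R : realType) (n : nat) : 'M[R]_n :=
  diag_mx (\row_(i < n) (if i == 0%N :> nat then - 1 else 1)).

(* symmetric bilinear forms of signature (-1,1,...,1): the rows of P form an
   orthonormal basis *)
Definition lorentzian (R : realType) (n : nat) (G : 'M[R]_n) : Prop :=
  G^T = G /\ exists2 P, P \in unitmx & P *m G *m P^T = minkowski R n.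

Record lorentz_metric (R : realType) (n : nat) (M : manifold R n) :=
  LorentzMetric {
  metric :> tensor_field M 2;
  metric_lorentz : forall c p, atlas c -> dom c p ->
    lorentzian (tens2_mx (metric c (phi c p))) }.

(* g_{ij} as a function of the coordinates of c *)
Definition gmx (R : realType) (n : nat) (M : manifold R n)
    (g : lorentz_metric M) (c : chart R n M) (x : 'rV[R]_n) : 'M[R]_n :=
  tens2_mx (g c x).

Definition pd (R : realType) (n : nat) (k : 'I_n) (f : 'rV[R]_n -> R)
    (x : 'rV[R]_n) : R := 'D_(delta_mx 0 k) f x.

Section ChartGeometry.
Variables (R : realType) (n : nat) (G : 'rV[R]_n -> 'M[R]_n).
Implicit Types (x : 'rV[R]_n) (i j k l p : 'I_n).

Definition ginv x : 'M[R]_n := invmx (G x).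

(* \Gamma^l_{ij} *)
Definition christoffel l i j x : R :=
  2%:R^-1 * \sum_p ginv x l p *
    (pd j (fun y => G y p i) x + pd i (fun y => G y p j) x
     - pd p (fun y => G y i j) x).

(* \nabla_{\partial_k} X, for the vector field X^l \partial_l *)
Definition nabla k (X : 'rV[R]_n -> 'rV[R]_n) x : 'rV[R]_n :=
  \row_l (pd k (fun y => X y 0 l) x + \sum_p christoffel l k p x * X x 0 p).

Definition coord_vf i : 'rV[R]_n -> 'rV[R]_n := fun=> delta_mx 0 i.

Definition ricci i j x : R :=
  \sum_k (nabla k (nabla j (coord_vf i)) x
          - nabla j (nabla k (coord_vf i)) x) 0 k.

Definition scalar_curv x : R := \sum_i \sum_j ginv x i j * ricci i j x.

(* D_{I;j} *)
Definition covder m (D : 'rV[R]_n -> tens R n m) (I : m.-tuple 'I_n) j x : R :=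
  pd j (fun y => tco (D y) I) x
  - \sum_(s < m) \sum_p christoffel p j (tnth I s) x *
      tco (D x) [tuple (if t == s then p else tnth I t) | t < m].

Definition sqnorm (q : nat) (F : q.-tuple 'I_n -> R) x : R :=
  \sum_(I : q.-tuple 'I_n) \sum_(J : q.-tuple 'I_n)
    (\prod_(s < q) ginv x (tnth I s) (tnth J s)) * F I * F J.

End ChartGeometry.

Definition alternate (R : realType) (n m : nat) (T : tens R n m)
    (I : m.-tuple 'I_n) : R :=
  (m`!)%:R^-1 *
  \sum_(s : 'S_m) (-1) ^+ s * tco T [tuple tnth I (s t) | t < m].

(* (d\gamma)_{i_0...i_m} =
     \sum_s (-1)^s \partial_{i_s} \gamma_{i_0...\hat{i_s}...i_m} *)
Definition extder (R : realType) (n m : nat)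
    (F : 'rV[R]_n -> m.-tuple 'I_n -> R) (x : 'rV[R]_n)
    (I : m.+1.-tuple 'I_n) : R :=
  \sum_(s < m.+1) (-1) ^+ (s : nat) *
    pd (tnth I s) (fun y => F y [tuple tnth I (lift s t) | t < m]) x.

(* |d\gamma|_g^2 in a chart *)
Definition dgamma_sq (R : realType) (n m : nat) (G : 'rV[R]_n -> 'M[R]_n)
    (D : 'rV[R]_n -> tens R n m) (x : 'rV[R]_n) : R :=
  sqnorm G (extder (fun y => alternate (D y)) x) x.

(* The ambient space of Y_n^m, with coordinates
   (((((w_{ij}), w_{ijk}), w_{ijkl}), D_I), D_{Ij}). *)
Notation Yspace R n m :=
  ('M[R]_n * tens R n 3 * tens R n 4 * tens R n m * tens R n m.+1)%type.

Definition wmx (R : realType) (n m : nat) (y : Yspace R n m) : 'M[R]_n :=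
  y.1.1.1.1.

Definition Ydom (R : realType) (n m : nat) : set (Yspace R n m) :=
  [set y | \det (wmx y) != 0].

(* (g_{ij}, g_{ij,k}, g_{ij,kl}, D_I, D_{I,j}) *)
Definition jet (R : realType) (n m : nat) (G : 'rV[R]_n -> 'M[R]_n)
    (D : 'rV[R]_n -> tens R n m) (x : 'rV[R]_n) : Yspace R n m :=
  (G x,
   mktens (fun I : 3.-tuple 'I_n =>
     let i := tnth I 0 in let j := tnth I 1 in let k := tnth I 2%:R in
     pd k (fun y => G y i j) x),
   mktens (fun I : 4.-tuple 'I_n =>
     let i := tnth I 0 in let j := tnth I 1 in
     let k := tnth I 2%:R in let l := tnth I 3%:R in
     pd l (pd k (fun y => G y i j)) x),
   D x,
   mktens (fun I : m.+1.-tuple 'I_n =>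
     pd (tnth I ord_max)
       (fun y => tco (D y) [tuple tnth I (widen_ord (leqnSn m) t) | t < m]) x)).

(* f is the function f_{g,D} *)
Definition represents (R : realType) (n m : nat) (L : Yspace R n m -> R)
    (M : manifold R n) (g : lorentz_metric M) (D : tensor_field M m)
    (f : M -> R) : Prop :=
  mfd_smooth f /\
  forall c p, atlas c -> dom c p -> L (jet (gmx g c) (D c) (phi c p)) = f p.

(* The coefficients are smooth on the same domain of matrices as L. *)
Definition smooth_coef (R : realType) (n : nat) (h : 'M[R]_n -> R) : Prop :=
  smooth_on [set w : 'M[R]_n | \det w != 0] h.

Definition quad_expr (R : realType) (n m : nat)
    (mu : m.-tuple 'I_n -> m.-tuple 'I_n -> 'M[R]_n -> R)
    (G : 'rV[R]_n -> 'M[R]_n) (D : 'rV[R]_n -> tens R n m)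
    (x : 'rV[R]_n) : R :=
  \sum_(I : m.-tuple 'I_n) \sum_(J : m.-tuple 'I_n)
    mu I J (G x) * tco (D x) I * tco (D x) J.

Definition trace_expr (R : realType) (n m : nat)
    (la : m.-tuple 'I_n -> 'M[R]_n -> R)
    (G : 'rV[R]_n -> 'M[R]_n) (D : 'rV[R]_n -> tens R n m)
    (x : 'rV[R]_n) : R :=
  \sum_(I : m.-tuple 'I_n) la I (G x) * tco (D x) I.

(* be is indexed by the multi-indices I j of length m+1. *)
Definition div_expr (R : realType) (n m : nat)
    (be : m.+1.-tuple 'I_n -> 'M[R]_n -> R)
    (G : 'rV[R]_n -> 'M[R]_n) (D : 'rV[R]_n -> tens R n m)
    (x : 'rV[R]_n) : R :=
  \sum_(I : m.-tuple 'I_n) \sum_(j < n)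
    be [tuple of rcons I j] (G x) * covder G D I j x.

(* E gives the same function on M in all charts, for every (M, g, D). *)
Definition coord_invariant (R : realType) (n m : nat)
    (E : ('rV[R]_n -> 'M[R]_n) -> ('rV[R]_n -> tens R n m) -> 'rV[R]_n -> R) :
    Prop :=
  forall (M : manifold R n) (g : lorentz_metric M) (D : tensor_field M m) c c' p,
    atlas c -> atlas c' -> dom c p -> dom c' p ->
    E (gmx g c) (D c) (phi c p) = E (gmx g c') (D c') (phi c' p).

Definition quadratic_invariant (R : realType) (n m : nat)
    (mu : m.-tuple 'I_n -> m.-tuple 'I_n -> 'M[R]_n -> R) : Prop :=
  (forall I J, smooth_coef (mu I J)) /\ coord_invariant (quad_expr mu).

Definition invariant_trace_term (R : realType) (n m : nat)
    (la : m.-tuple 'I_n -> 'M[R]_n -> R) : Prop :=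
  (forall I, smooth_coef (la I)) /\ coord_invariant (trace_expr la).

(* The last clause: the functions be(g_{ab}) are the components of an
   (m+1,0)-tensor field. *)
Definition invariant_divergence_term (R : realType) (n m : nat)
    (be : m.+1.-tuple 'I_n -> 'M[R]_n -> R) : Prop :=
  [/\ forall K, smooth_coef (be K),
      coord_invariant (div_expr be) &
      forall (M : manifold R n) (g : lorentz_metric M) c c' p,
        atlas c -> atlas c' -> dom c p -> dom c' p -> forall K,
        be K (gmx g c' (phi c' p)) =
        tens_change (jac c c' p) (be ^~ (gmx g c (phi c p))) K].

(* Main.v *)
From HB Require Import structures.
Require Import Defs.
From mathcomp Require Import all_boot all_order all_algebra fingroup perm ring lra.
From mathcomp Require Import all_classical all_reals all_analysis.
Import Order.TTheory GRing.Theory Num.Theory.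
Import numFieldNormedType.Exports.

Set Implicit Arguments.
Unset Strict Implicit.
Unset Printing Implicit Defensive.

Local Open Scope classical_set_scope.
Local Open Scope ring_scope.

(* At a fixed metric w, L is a polynomial of degree at most 2 in the remaining jet
   variables (a, b, d, e) = (dg, ddg, D, dD).  Every jet at the origin is realized by
   global fields on R^n, and a local change of coordinates with prescribed 3-jet
   extends to a diffeomorphism of R^n, so invariance of L becomes invariance under
   the group of 3-jets.  Its quadratic and cubic parts shift a to 0 and show that the
   bilinear part couples no b with anything, no d with e, and sees e only through its
   alternation; what remains is
     L = L(w) + lin(b) - lin(SS Gamma) + lin(d) + lin(e - Gamma d) + bil(d,d) + bil(e,e).
   Its linear part acts by GL_n.  Reflections of the Minkowski metric then show that
   lin on the b's is proportional to the linearized scalar curvature, and bil(e,e) to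
   |d gamma|^2, with coefficients independent of w because every Lorentz metric has an
   orthonormal frame.  The terms lin(d) and lin(e - Gamma d) are separated from the
   others by D |-> - D, and their coefficients are values of L, hence smooth in w. *)

(** * Calculus of C^k maps *)

(** The hypothesis concerns global fields on manifolds, so germs are not enough. All tests are made
    on R^n with its maximal atlas, by comparing the identity chart with the chart given by a
    diffeomorphism. Hence test metrics must be Lorentzian at every point, and a prescribed jet of a
    coordinate change must come from a bijection. Both are built from polynomials in the bounded
    functions r sin(x_i / r), which agree with x_i to second order at 0; for small r they perturb a
    constant frame, respectively the identity map, only slightly. Invariance is available only at
    realizable jets: w Lorentzian, a symmetric in its first two indices, b symmetric in both pairs.
    The forms [lin] and [bil] live on the whole jet space but are controlled only there, so
    functionals of b are tested on products of symmetric squares that span the admissible b. The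
    coefficient functions, by contrast, must be smooth on all invertible matrices; they are finite
    differences of values of L, not built from Lorentz frames. *)

Section Calculus.
Context {R : realType}.

Lemma near_eq_differentiable (V W : normedModType R) (f g : V -> W) (x : V) :
  (\near x, f x = g x) -> differentiable f x -> differentiable g x.
Proof.
move=> fg df; have [dfc /eqaddoP dfo] := (diff_locallyP _ _).1 df.
have gE : g \o shift x = cst (g x) + 'd f x +o_ 0 id.
  have fgx : f x = g x by exact: nbhs_singleton fg.
  have cvx : (fun h : V => h + x) @ 0 --> x.
    by rewrite -[in X in _ --> X](add0r x); apply: cvgD; [exact: cvg_id|exact: cvg_cst].
  apply/eqaddoP => e e0; near=> h.
  have fgh : (f \o shift x) h = (g \o shift x) h by near: h; exact: cvx fg.
  rewrite /= in fgh; rewrite !fctE /= -fgh -fgx; near: h; exact: dfo.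
apply/diff_locallyP; rewrite (diff_unique dfc gE); split => //.
Unshelve. all: by end_near. Qed.

Lemma differentiable_linear_comp (V W Z : normedModType R) (l : {linear W -> Z})
  (f : V -> W) (x v : V) : continuous l -> differentiable f x ->
  differentiable (l \o f) x /\ 'D_v (l \o f) x = l ('D_v f x).
Proof.
move=> lc df; have dl := linear_differentiable (f x) lc.
split; first exact: differentiable_comp.
rewrite deriveE ?deriveE //; last exact: differentiable_comp.
by rewrite diff_comp //= diff_lin.
Qed.

Lemma differentiable_mx (V : normedModType R) p q (f : V -> 'M[R]_(p, q)) x :
  (forall i j, differentiable (fun y => f y i j : R) x) -> differentiable f x.
Proof.
move=> df.
have -> : f = \sum_(i < p) \sum_(j < q) (fun y => f y i j *: delta_mx i j).
  apply/funext => y; rewrite [LHS]matrix_sum_delta fct_sumE.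
  by apply: eq_bigr => i _; rewrite fct_sumE.
apply: differentiable_sum => i; apply: differentiable_sum => j.
exact: differentiableZl.
Qed.

Lemma derive_mx_entry (V : normedModType R) p q (f : V -> 'M[R]_(p, q)) x v i j :
  differentiable f x -> ('D_v f x) i j = 'D_v (fun y => f y i j) x.
Proof. by move=> df; rewrite derive_mx ?mxE //; exact: diff_derivable. Qed.

Lemma differentiable_entry (V : normedModType R) p q (f : V -> 'M[R]_(p, q)) x i j :
  differentiable f x -> differentiable (fun y => f y i j : R) x.
Proof.
move=> df; apply: (@differentiable_comp _ _ _ _ f (fun N : 'M[R]_(p, q) => N i j : R)) => //.
exact: differentiable_coord.
Qed.

(** Through entries, the derivative of a composite becomes a sum of scalar derivatives of [g] times
    partial derivatives of [f] composed with [g]; on this form [Ck_comp] can induct. *)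
Lemma derive_comp_mx (V W : normedModType R) p q (g : V -> 'M[R]_(p, q))
    (f : 'M[R]_(p, q) -> W) x v :
  differentiable g x -> differentiable f (g x) ->
  'D_v (f \o g) x = \sum_i \sum_j 'D_v (fun y => g y i j) x *: 'D_(delta_mx i j) f (g x).
Proof.
move=> dg df; rewrite deriveE; last exact: differentiable_comp.
rewrite diff_comp //= -(deriveE _ dg) {1}(matrix_sum_delta ('D_v g x)) linear_sum.
apply: eq_bigr => i _; rewrite linear_sum; apply: eq_bigr => j _.
by rewrite linearZ /= derive_mx_entry // (deriveE _ df).
Qed.

(** A derivative at a point of the open set only sees a neighbourhood inside it. Most inductions
    below rely on this, since their formulas for derivatives hold on [U] only. *)
Lemma Ck_ext (V W : normedModType R) k (U : set V) (f g : V -> W) :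
  open U -> Ck_on k U f -> (forall x, U x -> f x = g x) -> Ck_on k U g.
Proof.
move=> oU + fg; elim: k f g fg => [|k IH] f g fg.
- move=> cf x Ux; have := cf x Ux; rewrite /prop_for /continuous_at -(fg x Ux).
  apply: cvg_trans; apply: near_eq_cvg.
  by apply: filterS (open_nbhs_nbhs (conj oU Ux)) => y Uy; rewrite fg.
- move=> [df Df].
  have nfg x : U x -> \near x, f x = g x.
    by move=> Ux; apply: filterS (open_nbhs_nbhs (conj oU Ux)).
  split=> [x Ux|v]; first exact: near_eq_differentiable (nfg x Ux) (df x Ux).
  by apply: IH (Df v) => x Ux; exact: near_eq_derive (nfg x Ux).
Qed.

Lemma Ck_sub (V W : normedModType R) k (U U' : set V) (f : V -> W) :
  U' `<=` U -> Ck_on k U f -> Ck_on k U' f.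
Proof.
move=> UU; elim: k f => [|k IH] f; first by move=> cf x /UU /cf.
by move=> [df Df]; split=> [x /UU /df//|v]; exact: IH (Df v).
Qed.

Lemma CkW (V W : normedModType R) k (U : set V) (f : V -> W) :
  Ck_on k.+1 U f -> Ck_on k U f.
Proof.
elim: k f => [|k IH] f [df Df]; last by split=> // v; exact: IH (Df v).
by move=> x Ux; exact: differentiable_continuous (df x Ux).
Qed.

Lemma Ck_cst (V W : normedModType R) k (U : set V) (a : W) :
  Ck_on k U (fun=> a : W).
Proof.
elim: k a => [|k IH] a; first by move=> x _; exact: cst_continuous.
split=> [x _|v]; first exact: differentiable_cst.
have -> : (fun x : V => 'D_v (fun=> a) x) = (fun=> 0) by apply/funext => x; exact: derive_cst.
exact: IH.
Qed.

Lemma CkD (V W : normedModType R) k (U : set V) (f g : V -> W) : open U ->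
  Ck_on k U f -> Ck_on k U g -> Ck_on k U (fun x => f x + g x).
Proof.
move=> oU; elim: k f g => [|k IH] f g.
  by move=> cf cg x Ux; apply: continuousD; [exact: cf|exact: cg].
move=> [df Df] [dg Dg]; split=> [x Ux|v].
  by apply: differentiableD; [exact: df|exact: dg].
have H := IH _ _ (Df v) (Dg v); apply: (Ck_ext oU H) => x Ux.
by rewrite -deriveD //; apply: diff_derivable; [exact: df|exact: dg].
Qed.

Lemma Ck_sum (V W : normedModType R) k (U : set V) (I : Type) (r : seq I)
    (P : pred I) (f : I -> V -> W) : open U ->
  (forall i, Ck_on k U (f i)) -> Ck_on k U (fun x => \sum_(i <- r | P i) f i x).
Proof.
move=> oU Cf; elim: r => [|i r IH].
  by apply: (Ck_ext oU (Ck_cst _ _ 0)) => x _; rewrite big_nil.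
have [Pi|nPi] := boolP (P i).
  by apply: (Ck_ext oU (CkD oU (Cf i) IH)) => x _; rewrite big_cons Pi.
by apply: (Ck_ext oU IH) => x _; rewrite big_cons (negbTE nPi).
Qed.

Lemma Ck_linear_comp (V W Z : normedModType R) (l : {linear W -> Z}) k (U : set V)
  (f : V -> W) : open U -> continuous l -> Ck_on k U f -> Ck_on k U (l \o f).
Proof.
move=> oU lc; elim: k f => [|k IH] f.
  move=> cf x Ux; apply: continuous_comp; [exact: cf|exact: lc].
move=> [df Df]; split=> [x Ux|v].
  by case: (differentiable_linear_comp 0 lc (df x Ux)).
apply: (Ck_ext oU (IH _ (Df v))) => x Ux /=.
by case: (differentiable_linear_comp v lc (df x Ux)).
Qed.

(** This serves affine maps into the jet space, which is a product and not a matrix space, so that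
    [Ck_comp] does not cover them. *)
Lemma Ck_affine (V W Z : normedModType R) (l : {linear Z -> V}) (b : V) k (U : set V)
  (f : V -> W) : open U -> continuous l -> Ck_on k U f ->
  Ck_on k [set x | U (l x + b)] (fun x => f (l x + b)).
Proof.
move=> oU lc; have dl x : differentiable (fun x => l x + b) x.
  by apply: differentiableD; [exact: linear_differentiable|exact: differentiable_cst].
have oU' : open [set x | U (l x + b)].
  by apply: open_comp oU => x _; exact: differentiable_continuous.
elim: k f => [|k IH] f.
  move=> cf x Ux; apply: (@continuous_comp _ _ _ (fun x => l x + b) f); last exact: cf.
  exact: differentiable_continuous.
move=> [df Df]; split=> [x Ux|v].
  apply: (@differentiable_comp _ _ _ _ (fun x => l x + b) f) => //; exact: df.
apply: (Ck_ext oU' (IH _ (Df (l v)))) => x Ux.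
rewrite -[RHS]/('D_v (f \o (fun x => l x + b)) x) deriveE; last exact: df.
rewrite [RHS]deriveE; last by apply: differentiable_comp => //; exact: df.
rewrite (@diff_comp _ _ _ _ (fun x => l x + b) f) //=; last exact: df.
have -> : 'd (fun x => l x + b) x = l :> (Z -> V); last by [].
rewrite (@diffD _ _ _ l (cst b)).
- rewrite diff_cst (_ : 'd l x = l :> (Z -> V)); first by apply/funext => y /=; rewrite addr0.
  exact: (diff_lin x lc).
- exact: linear_differentiable.
- exact: differentiable_cst.
Qed.

Lemma CkM (V : normedModType R) k (U : set V) (f g : V -> R) :
  open U -> Ck_on k U f -> Ck_on k U g -> Ck_on k U (fun x => f x * g x).
Proof.
move=> oU; elim: k f g => [|k IH] f g.
  by move=> ca cf x Ux; apply: continuousM; [exact: ca|exact: cf].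
move=> Cf Cg; have [[df Df] [dg Dg]] := (Cf, Cg); split=> [x Ux|v].
  by apply: differentiableM; [exact: df|exact: dg].
apply: (Ck_ext oU (CkD oU (IH _ _ (CkW Cf) (Dg v)) (IH _ _ (CkW Cg) (Df v)))) => x Ux.
by rewrite [RHS]deriveM //; apply: diff_derivable; [exact: df|exact: dg].
Qed.

Lemma Ck_prod (V : normedModType R) k (U : set V) (I : Type) (r : seq I)
    (P : pred I) (f : I -> V -> R) : open U ->
  (forall i, Ck_on k U (f i)) -> Ck_on k U (fun x => \prod_(i <- r | P i) f i x).
Proof.
move=> oU Cf; elim: r => [|i r IH].
  by apply: (Ck_ext oU (Ck_cst _ _ (1 : R))) => x _; rewrite big_nil.
have [Pi|nPi] := boolP (P i).
  by apply: (Ck_ext oU (CkM oU (Cf i) IH)) => x _; rewrite big_cons Pi.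
by apply: (Ck_ext oU IH) => x _; rewrite big_cons (negbTE nPi).
Qed.

Lemma CkN (V : normedModType R) k (U : set V) (f : V -> R) :
  open U -> Ck_on k U f -> Ck_on k U (fun x => - f x).
Proof.
move=> oU Cf; apply: (Ck_ext oU (CkM oU (Ck_cst _ _ (-1 : R)) Cf)) => x _.
by rewrite mulN1r.
Qed.

Lemma CkB (V : normedModType R) k (U : set V) (f g : V -> R) : open U ->
  Ck_on k U f -> Ck_on k U g -> Ck_on k U (fun x => f x - g x).
Proof. by move=> oU Cf Cg; apply: CkD => //; exact: CkN. Qed.

(** The derivative of 1/f is -(1/f)^2 f', in which 1/f occurs undifferentiated, so the induction on
    the order closes. *)
Lemma Ck_inv (V : normedModType R) k (U : set V) (f : V -> R) :
  open U -> (forall x, U x -> f x != 0) -> Ck_on k U f ->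
  Ck_on k U (fun x => (f x)^-1).
Proof.
move=> oU f0; elim: k => [|k IH].
  by move=> cf x Ux; apply: continuousV; [exact: f0|exact: cf].
move=> Cf; have [df Df] := Cf; split=> [x Ux|v].
  by apply: differentiableV; [exact: df|exact: f0].
have Ci := IH (CkW Cf).
apply: (Ck_ext oU (CkN oU (CkM oU (CkM oU Ci Ci) (Df v)))) => x Ux.
rewrite [RHS]deriveV; [|exact: f0|by apply: diff_derivable; exact: df].
by rewrite scaleNr /GRing.scale /= -invfM -expr2.
Qed.

Lemma Ck_mx (V : normedModType R) p q k (U : set V) (f : V -> 'M[R]_(p, q)) : open U ->
  (forall i j, Ck_on k U (fun x => f x i j : R)) -> Ck_on k U f.
Proof.
move=> oU; elim: k f => [|k IH] f.
  move=> cf; apply: (@Ck_ext _ _ 0 _ (fun y => \sum_i \sum_j f y i j *: delta_mx i j)) => //.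
    apply: Ck_sum => // i; apply: Ck_sum => // j x Ux.
    by apply: continuousZr_tmp; exact: cf.
  by move=> x _; rewrite -matrix_sum_delta.
move=> Cf; have df x : U x -> differentiable f x.
  by move=> Ux; apply: differentiable_mx => i j; case: (Cf i j) => + _; exact.
split=> // v; apply: IH => i j; have [_ /(_ v) H] := Cf i j.
apply: (Ck_ext oU H) => x Ux; rewrite derive_mx_entry //; exact: df.
Qed.

Lemma Ck_entry (V : normedModType R) p q k (U : set V) (f : V -> 'M[R]_(p, q)) i j :
  open U -> Ck_on k U f -> Ck_on k U (fun x => f x i j : R).
Proof.
move=> oU; elim: k f => [|k IH] f.
  move=> cf x Ux; apply: (@continuous_comp _ _ _ f (fun M : 'M[R]_(p, q) => M i j)).
    exact: cf.
  exact: coord_continuous.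
move=> [df Df]; split=> [x Ux|v].
  by apply: differentiable_entry; exact: df.
apply: (Ck_ext oU (IH _ (Df v))) => x Ux; apply: derive_mx_entry; exact: df.
Qed.

Lemma Ck_comp (V : normedModType R) p q k (U : set V) (U' : set 'M[R]_(p, q))
    (g : V -> 'M[R]_(p, q)) (f : 'M[R]_(p, q) -> R) :
  open U -> (forall x, U x -> U' (g x)) -> Ck_on k U g -> Ck_on k U' f ->
  Ck_on k U (f \o g).
Proof.
move=> oU gU; elim: k f g gU => [|k IH] f g gU.
  move=> cg cf x Ux; apply: continuous_comp; first exact: cg.
  by apply: cf; exact: gU.
move=> Cg [df Df]; have [dg Dg] := Cg; split=> [x Ux|v].
  by apply: differentiable_comp; [exact: dg|apply: df; exact: gU].
apply: (@Ck_ext _ _ _ _ (fun x => \sum_i \sum_j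
    ('D_v g x) i j * ('D_(delta_mx i j) f \o g) x)) => //; last first.
  move=> x Ux; rewrite [RHS]derive_comp_mx; [|exact: dg|by apply: df; exact: gU].
  apply: eq_bigr => i _; apply: eq_bigr => j _.
  by rewrite derive_mx_entry //; exact: dg.
apply: Ck_sum => // i; apply: Ck_sum => // j; apply: CkM => //.
  exact: Ck_entry (Dg v).
exact: IH (CkW Cg) (Df _).
Qed.

Lemma Ck_comp_mx (V : normedModType R) p q p' q' k (U : set V) (U' : set 'M[R]_(p, q))
    (g : V -> 'M[R]_(p, q)) (f : 'M[R]_(p, q) -> 'M[R]_(p', q')) :
  open U -> open U' -> (forall x, U x -> U' (g x)) -> Ck_on k U g -> Ck_on k U' f ->
  Ck_on k U (f \o g).
Proof.
move=> oU oU' gU Cg Cf; apply: Ck_mx => // i j.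
exact: (Ck_comp oU gU Cg (Ck_entry i j oU' Cf)).
Qed.

Lemma Ck_det (V : normedModType R) p k (U : set V) (f : V -> 'M[R]_p) :
  open U -> Ck_on k U f -> Ck_on k U (fun x => \det (f x)).
Proof.
move=> oU Cf; apply: Ck_sum => // s; apply: CkM => //; first exact: Ck_cst.
by apply: Ck_prod => // i; exact: Ck_entry.
Qed.

Lemma Ck_invmx (V : normedModType R) p k (U : set V) (f : V -> 'M[R]_p) :
  open U -> (forall x, U x -> f x \in unitmx) -> Ck_on k U f ->
  Ck_on k U (fun x => invmx (f x)).
Proof.
move=> oU fu Cf.
(* Cramer's rule: the inverse is the adjugate over the determinant, hence rational in the
   entries. *)
apply: (@Ck_ext _ _ _ _ (fun x => (\det (f x))^-1 *: \adj (f x))) => //; last first.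
  by move=> x Ux; rewrite /invmx fu.
apply: Ck_mx => // i j.
apply: (@Ck_ext _ _ _ _ (fun x => (\det (f x))^-1 * ((-1) ^+ (j + i) *
    \det (row' j (col' i (f x)))))) => //; last by move=> x Ux; rewrite !mxE.
apply: CkM => //.
  apply: Ck_inv => //; first by move=> x /fu; rewrite unitmxE unitfE.
  exact: Ck_det.
apply: CkM => //; first exact: Ck_cst.
apply: Ck_det => //; apply: Ck_mx => // a b.
apply: (@Ck_ext _ _ _ _ (fun x => f x (lift j a) (lift i b))) => //; last first.
  by move=> x _; rewrite !mxE.
exact: Ck_entry.
Qed.

Lemma Ck_mulmx (V : normedModType R) p q r k (U : set V) (f : V -> 'M[R]_(p, q))
    (g : V -> 'M[R]_(q, r)) : open U -> Ck_on k U f -> Ck_on k U g ->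
  Ck_on k U (fun x => f x *m g x).
Proof.
move=> oU Cf Cg; apply: Ck_mx => // i j.
apply: (@Ck_ext _ _ _ _ (fun x => \sum_l f x i l * g x l j)) => //; last first.
  by move=> x _; rewrite mxE.
by apply: Ck_sum => // l; apply: CkM => //; exact: Ck_entry.
Qed.

End Calculus.

(** * Rules for directional derivatives and symmetry of second derivatives *)

Section Calculus2.
Context {R : realType}.

Lemma mx_linear_continuous p q (W : normedModType R) (l : {linear 'M[R]_(p, q) -> W}) :
  continuous l.
Proof.
move=> x; have H : Ck_on 0 setT (fun y : 'M[R]_(p, q) => \sum_i \sum_j y i j *: l (delta_mx i j)).
  apply: Ck_sum => [|i]; first exact: openT.
  apply: Ck_sum => [|j y _]; first exact: openT.
  by apply: continuousZr_tmp; exact: coord_continuous.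
have /= := Ck_ext openT H (g := l); apply => // y _.
rewrite [in RHS](matrix_sum_delta y) linear_sum; apply: eq_bigr => i _.
by rewrite linear_sum; apply: eq_bigr => j _; rewrite linearZ.
Qed.

Section Rules.
Variables (V : normedModType R).
Implicit Types (f g : V -> R) (x v : V).

Lemma deriveD_fun f g x v : differentiable f x -> differentiable g x ->
  'D_v (fun y => f y + g y) x = 'D_v f x + 'D_v g x.
Proof. by move=> df dg; rewrite -deriveD //; apply: diff_derivable. Qed.

Lemma deriveB_fun f g x v : differentiable f x -> differentiable g x ->
  'D_v (fun y => f y - g y) x = 'D_v f x - 'D_v g x.
Proof. by move=> df dg; rewrite -deriveB //; apply: diff_derivable. Qed.

Lemma deriveM_fun f g x v : differentiable f x -> differentiable g x ->
  'D_v (fun y => f y * g y) x = 'D_v f x * g x + f x * 'D_v g x.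
Proof.
move=> df dg; rewrite [LHS]deriveM; [|exact: diff_derivable|exact: diff_derivable].
by rewrite addrC; congr (_ + _); rewrite mulrC.
Qed.

Lemma deriveZ_fun (a : R) f x v : differentiable f x ->
  'D_v (fun y => a * f y) x = a * 'D_v f x.
Proof. by move=> df; rewrite [LHS](@deriveZ _ _ _ f a) //; apply: diff_derivable. Qed.

Lemma differentiable_sum_fun (I : Type) (r : seq I) (P : pred I) (f : I -> V -> R) x :
  (forall i, differentiable (f i) x) ->
  differentiable (fun y => \sum_(i <- r | P i) f i y) x.
Proof.
move=> df; elim: r => [|i r IH].
  by rewrite (_ : (fun _ => _) = cst 0) //; apply/funext => y; rewrite big_nil.
rewrite (_ : (fun _ => _) = (fun y => (if P i then f i y else 0) +
    \sum_(j <- r | P j) f j y)); last first.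
  by apply/funext => y; rewrite big_cons; case: ifP => //; rewrite add0r.
by apply: differentiableD => //; case: (P i) => //; exact: differentiable_cst.
Qed.

Lemma derive_sum_fun (I : Type) (r : seq I) (P : pred I) (f : I -> V -> R) x v :
  (forall i, differentiable (f i) x) ->
  'D_v (fun y => \sum_(i <- r | P i) f i y) x = \sum_(i <- r | P i) 'D_v (f i) x.
Proof.
move=> df; elim: r => [|i r IH].
  rewrite big_nil (_ : (fun _ => _) = cst 0); first exact: derive_cst.
  by apply/funext => y; rewrite big_nil.
rewrite big_cons (_ : (fun _ => _) = (fun y => (if P i then f i y else 0) +
    \sum_(j <- r | P j) f j y)); last first.
  by apply/funext => y; rewrite big_cons; case: ifP => //; rewrite add0r.
case: (P i).
  by rewrite -IH -deriveD_fun //; exact: differentiable_sum_fun.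
by rewrite (_ : (fun _ => _) = (fun y => \sum_(j <- r | P j) f j y)) //;
  apply/funext => y; rewrite add0r.
Qed.

Lemma differentiable_prod_fun (I : Type) (r : seq I) (f : I -> V -> R) x :
  (forall i, differentiable (f i) x) ->
  differentiable (fun y => \prod_(i <- r) f i y) x.
Proof.
move=> df; elim: r => [|i r IH].
  by rewrite (_ : (fun _ => _) = cst 1) //; apply/funext => y; rewrite big_nil.
rewrite (_ : (fun _ => _) = (fun y => f i y * \prod_(j <- r) f j y)); last first.
  by apply/funext => y; rewrite big_cons.
exact: differentiableM.
Qed.

Lemma derive_prod_fun m (f : 'I_m -> V -> R) x v :
  (forall i, differentiable (f i) x) ->
  'D_v (fun y => \prod_(i < m) f i y) x =
  \sum_(s < m) 'D_v (f s) x * \prod_(t < m | t != s) f t x.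
Proof.
elim: m f => [|m IH] f df.
  rewrite big_ord0 (_ : (fun _ => _) = cst 1); first exact: derive_cst.
  by apply/funext => y; rewrite big_ord0.
rewrite (_ : (fun _ => _) = (fun y => f ord0 y * \prod_(j < m) f (lift ord0 j) y)); last first.
  by apply/funext => y; rewrite big_ord_recl.
rewrite deriveM_fun //; last exact: differentiable_prod_fun.
rewrite IH // big_ord_recl; congr (_ + _).
  congr (_ * _); rewrite [in RHS]big_mkcond big_ord_recl eqxx /= mul1r.
  by apply: eq_bigr => j _.
rewrite mulr_sumr; apply: eq_bigr => s _; rewrite mulrCA; congr (_ * _).
rewrite [in RHS]big_mkcond big_ord_recl /=; congr (_ * _).
by rewrite big_mkcond; apply: eq_bigr => j _; rewrite (inj_eq lift_inj).
Qed.

(** Restriction to a line reduces the mean value theorem and Taylor's formula to one variable. *)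
Lemma line_derive f x v t : differentiable f (x + t *: v) ->
  is_derive t (1 : R) (fun s : R => f (x + s *: v)) ('D_v f (x + t *: v)).
Proof.
move=> df.
have ds : is_diff t (fun s : R => s *: v) (fun s => s *: v) := is_diff_scalel _ _.
have dl : differentiable (fun s : R => x + s *: v) t.
  by apply: differentiableD; [exact: differentiable_cst|exact: ex_diff].
have dlE : 'd (fun s : R => x + s *: v) t 1 = v.
  rewrite (@diffD _ _ _ (cst x) (fun s : R => s *: v)); last exact: ex_diff.
    by rewrite diff_cst diff_val /= add0r scale1r.
  exact: differentiable_cst.
have dc : differentiable (f \o (fun s : R => x + s *: v)) t by exact: differentiable_comp.
apply: DeriveDef; first by apply/derivable1_diffP.
rewrite -[LHS]/('D_1 (f \o (fun s : R => x + s *: v)) t) deriveE //.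
rewrite (@diff_comp _ _ _ _ (fun s : R => x + s *: v) f) //=.
by rewrite dlE deriveE.
Qed.

Let close2 (a b c e : R) : `|b - c| < e / 2 -> `|a - c| < e / 2 -> `|a - b| <= e.
Proof.
move=> bc ac; rewrite (splitr e) -(subrKA c) (le_trans (ler_normD _ _)) //.
by rewrite lerD ?(ltW ac) // distrC ltW.
Qed.

(* Both mixed derivatives are limits of the same second difference quotient. *)
Lemma schwarz (U : set V) f x (u v : V) : open U -> U x -> Ck_on 2 U f ->
  'D_u (fun y => 'D_v f y) x = 'D_v (fun y => 'D_u f y) x.
Proof.
move=> oU Ux Cf.
(* By the mean value theorem, once in each direction, the second difference over h^2 is a mixed
   derivative at some point of a small parallelogram, hence close to the value at [x]. *)
have key (u' v' : V) (e : R) : 0 < e -> \forall h \near 0^'+,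
    exists2 A, `|'D_v' (fun y => 'D_u' f y) x - A| < e &
      f (x + h *: u' + h *: v') - f (x + h *: u') - (f (x + h *: v') - f x) =
      h ^+ 2 * A.
  move=> e0; have [df Df] := Cf; have [dDf DDf] := Df u'; have := DDf v' x Ux.
  move=> /cvgrPdist_lt/(_ _ e0) H.
  have oN : nbhs x [set y | U y /\ `|'D_v' (fun z => 'D_u' f z) x -
      'D_v' (fun z => 'D_u' f z) y| < e].
    apply: filterI; first exact: open_nbhs_nbhs.
    exact: H.
  have [r /= r0 rN] := (nbhs_ballP _ _).1 oN.
  near=> h.
  have h0 : 0 < h by near: h; exact: nbhs_right_gt.
  have hr : h * (`|u'| + `|v'|) < r.
    (* The summand 1 keeps the divisor positive when both directions are 0. *)
    have : h < r / (1 + (`|u'| + `|v'|)).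
      by near: h; apply: nbhs_right_lt; rewrite divr_gt0 // ltr_pwDl // addr_ge0.
    rewrite ltr_pdivlMr; last by rewrite ltr_pwDl // addr_ge0.
    by apply: le_lt_trans; rewrite ler_wpM2l ?lerDr // ltW.
  have inN s t : 0 <= s <= h -> 0 <= t <= h ->
      [set y | U y /\ `|'D_v' (fun z => 'D_u' f z) x -
      'D_v' (fun z => 'D_u' f z) y| < e] (x + s *: u' + t *: v').
    move=> /andP[s0 sh] /andP[t0 th]; apply: rN; rewrite -ball_normE /ball_ /=.
    rewrite -addrA opprD addNKr normrN; apply: le_lt_trans hr.
    rewrite mulrDr (le_trans (ler_normD _ _)) // !normrZ !ger0_norm //.
    by rewrite lerD // ler_wpM2r.
  have h00 : 0 <= (0:R) <= h by rewrite lexx ltW.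
  have hh : 0 <= h <= h by rewrite lexx ltW.
  pose phi (s : R) := f (x + h *: v' + s *: u') - f (x + s *: u').
  have dphi (s : R) : 0 <= s <= h -> is_derive s (1:R) phi
      ('D_u' f (x + h *: v' + s *: u') - 'D_u' f (x + s *: u')).
    move=> sh; apply: is_deriveB; apply: line_derive; apply: df.
      by rewrite addrAC; case: (inN s h).
    by have [] := inN s 0; rewrite ?scale0r ?addr0.
  have [| |s sh E] := @MVT_segment _ phi (fun s : R => 'D_u' f (x + h *: v' + s *: u') - 'D_u' f (x + s *: u')) 0 h (ltW h0).
  - by move=> s; rewrite in_itv /= => /andP[s0 sh]; apply: dphi; rewrite !ltW.
  - apply: derivable_within_continuous => s; rewrite in_itv /= => sh.
    by have [] := dphi s sh.
  move: sh; rewrite in_itv /= => sh.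
  pose psi (t : R) := 'D_u' f (x + s *: u' + t *: v').
  have dpsi (t : R) : 0 <= t <= h -> is_derive t (1:R) psi
      ('D_v' (fun y => 'D_u' f y) (x + s *: u' + t *: v')).
    by move=> th; apply: line_derive; apply: dDf; case: (inN s t).
  have [| |t th E'] := @MVT_segment _ psi (fun t : R => 'D_v' (fun y => 'D_u' f y) (x + s *: u' + t *: v')) 0 h (ltW h0).
  - by move=> t; rewrite in_itv /= => /andP[t0 th]; apply: dpsi; rewrite !ltW.
  - apply: derivable_within_continuous => t; rewrite in_itv /= => th.
    by have [] := dpsi t th.
  move: th; rewrite in_itv /= => th.
  exists ('D_v' (fun y => 'D_u' f y) (x + s *: u' + t *: v')); first by case: (inN s t).
  move: E E'; rewrite /phi /psi !subr0 !scale0r !addr0 => E E'.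
  move: E; rewrite (addrAC x (h *: v') (s *: u')) E' (addrAC x (h *: v')) => E.
  transitivity (f (x + h *: u' + h *: v') - f (x + h *: u') -
     (f (x + h *: v') - f x)); first by ring.
  by rewrite E; ring.
apply/eqP; rewrite -subr_eq0 -normr_le0 leNgt; apply/negP => d0.
set d := `|_| in d0; pose e := d / 2.
have e0 : 0 < e by rewrite divr_gt0.
have e2 : 0 < e / 2 by rewrite divr_gt0.
have : \forall h \near (0:R)^'+, `|'D_u (fun y => 'D_v f y) x - 'D_v (fun y => 'D_u f y) x| <= e.
  near=> h.
  have h0 : 0 < h by near: h; exact: nbhs_right_gt.
  have [A Ae EA] : exists2 A, `|'D_v (fun y => 'D_u f y) x - A| < e / 2 &
      f (x + h *: u + h *: v) - f (x + h *: u) - (f (x + h *: v) - f x) = h ^+ 2 * A.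
    by near: h; exact: key.
  have [B Be EB] : exists2 B, `|'D_u (fun y => 'D_v f y) x - B| < e / 2 &
      f (x + h *: v + h *: u) - f (x + h *: v) - (f (x + h *: u) - f x) = h ^+ 2 * B.
    by near: h; exact: key.
  have AB : A = B.
    apply: (mulfI (x := h ^+ 2)); first by rewrite expf_neq0 // gt_eqF.
    by rewrite -EA -EB (addrAC x (h *: v)); ring.
  by rewrite -AB in Be; exact: close2 Ae Be.
move=> /filter_ex[_]; rewrite -/d /e leNgt => /negP; apply.
by rewrite ltr_pdivrMr // ltr_pMr // ltr1n.
Unshelve. all: by end_near. Qed.

End Rules.
End Calculus2.

(** * Perturbations of the identity *)

(* The library declares matrices as normed modules and as complete spaces, but
   does not join the two structures. *)
HB.instance Definition _ (R : realType) (n : nat) := NormedModule.on 'rV[R]_n.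

Section Diffeo.
Context {R : realType} {n : nat}.
Implicit Types (s t : 'rV[R]_n -> 'rV[R]_n) (x y v : 'rV[R]_n).

Lemma differentiable_expansion (V W : normedModType R) (f : V -> W) (x : V) (e : R) :
  differentiable f x -> 0 < e ->
  \forall h \near (0 : V), `|f (h + x) - (f x + 'd f x h)| <= e * `|h|.
Proof. by move=> /diff_locallyP[_ /eqaddoP]; apply. Qed.

Lemma expansion_differentiable (V W : normedModType R) (f : V -> W)
    (l : {linear V -> W}) (x : V) : continuous l ->
  (forall e : R, 0 < e ->
     \forall h \near (0 : V), `|f (h + x) - (f x + l h)| <= e * `|h|) ->
  differentiable f x /\ 'd f x = l :> (V -> W).
Proof.
move=> lc H; have fE : f \o shift x = cst (f x) + l +o_ 0 id by apply/eqaddoP.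
have dE := diff_unique lc fE; split=> //.
by apply/diff_locallyP; rewrite dE.
Qed.

Lemma dominated_cvg0 (V W : normedModType R) (f : V -> W) :
  (forall k, `|f k| <= 2 * `|k|) -> f k @[k --> 0] --> 0.
Proof.
move=> fL; apply/cvgrPdist_le => d d0; have d2 : 0 < d / 2 by rewrite divr_gt0.
apply: filterS (nbhs0_le d2) => k kd; rewrite sub0r normrN.
by apply: (le_trans (fL _)); rewrite -ler_pdivlMl // mulrC.
Qed.

(** Along a vector killed by the Jacobian, [s] would move by o(r), against the lower bound |s y - s
    x| >= |y - x| / 2. *)
Lemma expansive_jacobian_unit s x : differentiable s x ->
  (forall y, `|y - x| <= 2 * `|s y - s x|) -> 'J s x \in unitmx.
Proof.
move=> ds sx; rewrite -row_free_unit -kermx_eq0; apply/rowV0P => v.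
rewrite sub_kermx => /eqP vJ; have dv0 : 'd s x v = 0.
  by rewrite -deriveE // deriveEjacobian.
(* Any constant below 1/2 beats the factor 2 of the hypothesis. *)
have e0 : 0 < 4^-1 :> R by rewrite invr_gt0.
have cz : (fun r : R => r *: v) @ (0:R)^' --> (0 : 'rV[R]_n).
  suff : (fun r : R => r *: v) @ (0:R)^' --> (0 : R) *: v by rewrite scale0r.
  by apply: cvg_within_filter; exact: scalel_continuous.
have := cz _ (differentiable_expansion ds e0).
have n0 : \forall r \near (0:R)^', r != 0 by exact: nbhs_dnbhs_neq.
move=> N; have [r [/= r0 rv]] := filter_ex (@filterI _ _ _ _ _ n0 N).
move: rv; rewrite linearZ /= dv0 scaler0 addr0 => rv.
have := sx (r *: v + x); rewrite addrK => H.
have : `|r *: v| <= 0.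
  have {}H := le_trans H (ler_wpM2l (ler0n _ 2) rv); lra.
by rewrite normr_le0 scaler_eq0 (negbTE r0) => /eqP.
Qed.

(** The increment of [t] is put into the expansion of [s]; the Lipschitz bound turns the resulting
    error into one that is small against the increment of [y]. *)
Lemma lipschitz_inverse_differentiable s t y : cancel t s ->
  (forall y y', `|t y - t y'| <= 2 * `|y - y'|) ->
  differentiable s (t y) -> 'J s (t y) \in unitmx ->
  differentiable t y /\ forall v, 'D_v t y = v *m invmx ('J s (t y)).
Proof.
move=> tK tL ds Ju; set A := invmx _; pose l : {linear 'rV[R]_n -> 'rV[R]_n} := mulmxr A.
have lc : continuous l := @mx_linear_continuous _ _ _ _ l.
have [C C0 lC] := linear_lipschitz lc.
have [|dt dE] := @expansion_differentiable _ _ t l y lc; last first.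
  by split=> // v; rewrite deriveE // dE.
move=> e e0.
(* The error of [s] is amplified by [C], the bound of the candidate derivative [l], and by 2, the
   Lipschitz constant of [t]. *)
have e'0 : 0 < e / (2 * C) by rewrite divr_gt0 // mulr_gt0.
have tL0 (k : 'rV[R]_n) : `|t (k + y) - t y| <= 2 * `|k|.
  by apply: (le_trans (tL _ _)); rewrite addrK.
have tc := dominated_cvg0 tL0.
apply: (@filterS _ _ (@nbhs_filter 'rV[R]_n 0) _ _ _ (tc _ (differentiable_expansion ds e'0))) => k /=.
rewrite subrK !tK; set h := t (k + y) - t y => H.
rewrite opprD addrA -/h.
have -> : h - l k = - l (k + y - (y + 'd s (t y) h)).
  rewrite opprD addrA addrK linearB opprB /=; congr (_ - _).
  by rewrite -(deriveE _ ds) deriveEjacobian // mulmxK.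
rewrite normrN (le_trans (lC _)) // -ler_pdivlMl // (le_trans H) //.
rewrite (le_trans (ler_wpM2l (ltW e'0) (tL _ _))) // addrK !mulrA.
by rewrite ler_wpM2r // le_eqVlt; apply/orP; left; apply/eqP; field; rewrite gt_eqF.
Qed.

Lemma Ck_jacobian k (U : set 'rV[R]_n) s : open U ->
  Ck_on k.+1 U s -> Ck_on k U (fun x => 'J s x).
Proof.
move=> oU [ds Ds]; apply: Ck_mx => // i j.
apply: (Ck_ext oU (Ck_entry 0 j oU (Ds (delta_mx 0 i)))) => x Ux.
by rewrite deriveEjacobian -?rowE ?mxE //; exact: ds.
Qed.

(** Bootstrapping: the derivative of [t] is the inverse Jacobian of [s] evaluated along [t], so it
    is as regular as [t] itself. *)
Lemma inverse_smooth s t : cancel t s -> smooth_on setT s ->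
  (forall y y', `|t y - t y'| <= 2 * `|y - y'|) ->
  (forall x, 'J s x \in unitmx) -> smooth_on setT t.
Proof.
move=> tK ss tL Ju.
have dt y := lipschitz_inverse_differentiable tK tL ((ss 1%N).1 _ I) (Ju (t y)).
elim=> [|k IH].
  by move=> y _; apply: differentiable_continuous; case: (dt y).
split=> [y _|v]; first by case: (dt y).
have C1 : Ck_on k setT (fun x => v *m invmx ('J s x)).
  apply: Ck_mulmx; [exact: openT|exact: Ck_cst|].
  by apply: Ck_invmx; [exact: openT|by []|apply: Ck_jacobian; [exact: openT|exact: ss]].
have := Ck_comp_mx openT openT (fun _ _ => I) IH C1.
by move=> /(Ck_ext openT); apply=> y _ /=; case: (dt y) => _ ->.
Qed.

Lemma Ck_id (V : normedModType R) k (U : set V) : open U -> Ck_on k U (id : V -> V).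
Proof.
move=> oU; case: k => [|k]; first by move=> x _; exact: cvg_id.
split=> // v; apply: (Ck_ext oU (Ck_cst _ _ v)) => x _.
by rewrite derive_id.
Qed.

(** A perturbation with Lipschitz constant 1/2 shrinks distances at most by half. This one estimate
    yields injectivity, invertible Jacobians and the Lipschitz bound of the inverse. *)
Lemma perturbation_diffeo (h : 'rV[R]_n -> 'rV[R]_n) : smooth_on setT h ->
  (forall x y, `|h x - h y| <= 2^-1 * `|x - y|) ->
  exists t, [/\ cancel (fun x => x + h x) t, cancel t (fun x => x + h x),
    smooth_on setT t & forall x, 'J (fun x => x + h x) x \in unitmx].
Proof.
move=> sh hL; set s := fun x => _.
have ss : smooth_on setT s.
  by move=> k; apply: CkD; [exact: openT|apply: Ck_id; exact: openT|exact: sh].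
have sE x y : `|x - y| <= 2 * `|s x - s y|.
  have : `|x - y| <= `|s x - s y| + `|h x - h y|.
    by rewrite (le_trans _ (ler_normB _ _)) // /s opprD addrACA addrK.
  have := hL x y; lra.
have surj y : exists x, s x = y.
  (* Solutions of x + h x = y are the fixed points of this contraction. *)
  pose f x := y - h x.
  have fm : set_fun setT setT f by [].
  pose F : {fun [set: 'rV[R]_n] >-> [set: 'rV[R]_n]} := HB.pack f (isFun.Build _ _ _ _ f fm).
  have ctr : is_contraction F.
    exists (2^-1)%:nng; split; first by rewrite /= invf_lt1 // ltr1n.
    move=> [a b] _ /=; rewrite /F /= /f opprB addrC addrA subrK -normrN opprB.
    exact: hL.
  have [] := banach_fixed_point ctr closedT; first by exists 0.
  by move=> x _ xE; exists x; rewrite /s {1}xE /= /f subrK.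
pose t y := sval (cid (surj y)).
have tK : cancel t s by move=> y; exact: (svalP (cid (surj y))).
have sI : injective s.
  move=> x y xy; apply/eqP; rewrite -subr_eq0 -normr_le0.
  by have := sE x y; rewrite xy subrr normr0 mulr0.
have tL y y' : `|t y - t y'| <= 2 * `|y - y'|.
  by rewrite -{2}(tK y) -{2}(tK y').
have Ju x : 'J s x \in unitmx.
  by apply: expansive_jacobian_unit => [|y]; [exact: ((ss 1%N).1 _ I)|exact: sE].
exists t; split=> //; first exact: (inj_can_sym tK sI).
exact: inverse_smooth tK ss tL Ju.
Qed.

End Diffeo.

(** * Tensors and their changes of coordinates *)

Section TensorAlgebra.
Context {R : realType}.

Lemma sum_tuple_finfun n k (F : k.-tuple 'I_n -> R) :
  \sum_(J : k.-tuple 'I_n) F J = \sum_(f : {ffun 'I_k -> 'I_n}) F [tuple f s | s < k].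
Proof.
rewrite (reindex (fun f : {ffun 'I_k -> 'I_n} => [tuple f s | s < k])) //.
exists (fun J : k.-tuple 'I_n => [ffun s => tnth J s]) => [f|J] _.
  by apply/ffunP => s; rewrite ffunE tnth_mktuple.
by apply: eq_from_tnth => s; rewrite tnth_mktuple ffunE.
Qed.

Lemma prod_sum_tuple n k (a : 'I_k -> 'I_n -> R) :
  \prod_(s < k) \sum_(j < n) a s j =
  \sum_(J : k.-tuple 'I_n) \prod_(s < k) a s (tnth J s).
Proof.
rewrite bigA_distr_bigA sum_tuple_finfun; apply: eq_bigr => f _.
by apply: eq_bigr => s _; rewrite tnth_mktuple.
Qed.

Lemma tcoK n k (F : k.-tuple 'I_n -> R) : tco (mktens F) = F.
Proof. by apply/funext => I; rewrite /tco mxE enum_rankK. Qed.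

Lemma mktensK n k (T : tens R n k) : mktens (tco T) = T.
Proof. by apply/rowP => r; rewrite mxE /tco enum_valK. Qed.

(** [tens_change] contracts the row index of its matrix, like v |-> v *m A, so composition
    multiplies in reverse order. *)
Lemma tens_change_comp n k (A B : 'M[R]_n) (F : k.-tuple 'I_n -> R) :
  tens_change A (tens_change B F) = tens_change (B *m A) F.
Proof.
apply/funext => I; rewrite /tens_change.
under eq_bigr do rewrite mulr_suml.
rewrite exchange_big; apply: eq_bigr => K _.
under eq_bigr do rewrite -mulrA -big_split /=.
rewrite -mulr_sumr; congr (_ * _).
rewrite -(prod_sum_tuple (fun s j => B (tnth K s) j * A j (tnth I s))).
by apply: eq_bigr => s _; rewrite mxE.
Qed.

Lemma tens_change1 n k (F : k.-tuple 'I_n -> R) : tens_change 1%:M F = F.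
Proof.
apply/funext => I; rewrite /tens_change (bigD1 I) //= [X in _ + X]big1 => [|J JI].
  rewrite addr0 -[RHS]mulr1; congr (_ * _); apply: big1 => s _.
  by rewrite mxE eqxx.
apply/eqP; rewrite mulf_eq0; apply/orP; right; apply/prodf_eq0.
have : ~~ [forall s, tnth J s == tnth I s].
  by apply: contra JI => /forallP H; apply/eqP/eq_from_tnth => s; apply/eqP.
by rewrite negb_forall => /existsP[s H]; exists s => //; rewrite mxE (negbTE H).
Qed.

Lemma sum_tuple1 n (F : 1.-tuple 'I_n -> R) :
  \sum_I F I = \sum_(i < n) F [tuple i].
Proof.
rewrite (reindex (fun i : 'I_n => [tuple i])) //.
exists (fun I : 1.-tuple 'I_n => tnth I 0) => [//|I _].
by apply: eq_from_tnth => s; rewrite [s]ord1.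
Qed.

Lemma sum_tupleS n k (F : k.+1.-tuple 'I_n -> R) :
  \sum_I F I = \sum_(i < n) \sum_(I : k.-tuple 'I_n) F [tuple of i :: I].
Proof.
rewrite pair_big /= (reindex (fun p : 'I_n * k.-tuple 'I_n => [tuple of p.1 :: p.2])) //=.
exists (fun I : k.+1.-tuple 'I_n => (thead I, [tuple of behead I])).
  by move=> [i I] _ /=; rewrite theadE; congr (_, _); apply: val_inj.
by move=> I _ /=; rewrite -tuple_eta.
Qed.

Lemma sum_tuple_rcons n k (F : k.+1.-tuple 'I_n -> R) :
  \sum_I F I = \sum_(I : k.-tuple 'I_n) \sum_(i < n) F [tuple of rcons I i].
Proof.
rewrite pair_big /= (reindex (fun p : k.-tuple 'I_n * 'I_n => [tuple of rcons p.1 p.2])) //=.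
exists (fun I : k.+1.-tuple 'I_n => ([tuple tnth I (widen_ord (leqnSn k) t) | t < k], tnth I ord_max)).
  move=> [I i] _ /=; congr (_, _).
    apply: eq_from_tnth => s; rewrite tnth_mktuple (tnth_nth i) /= nth_rcons size_tuple ltn_ord.
    by rewrite -tnth_nth.
  by rewrite (tnth_nth i) /= nth_rcons size_tuple ltnn eqxx.
move=> I _; apply: eq_from_tnth => s.
pose T := [tuple tnth I (widen_ord (leqnSn k) t) | t < k].
rewrite -[LHS]/(tnth [tuple of rcons T (tnth I ord_max)] s).
have TE t : tnth T t = tnth I (widen_ord (leqnSn k) t) by exact: tnth_mktuple.
clearbody T; rewrite (tnth_nth (tnth I ord_max)) /= nth_rcons size_tuple.
case: ltnP => sk.
  by rewrite -[s : nat]/(Ordinal sk : nat) -tnth_nth TE; congr (tnth I _); exact: val_inj.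
have -> : s = ord_max by apply: val_inj; apply/eqP; rewrite eqn_leq -ltnS ltn_ord.
by rewrite /= eqxx.
Qed.

Lemma tens2_change n (A G : 'M[R]_n) :
  tens2_mx (mktens (tens_change A (fun I : 2.-tuple 'I_n => G (tnth I 0) (tnth I 1)))) =
  A^T *m G *m A.
Proof.
apply/matrixP => i j; rewrite !mxE tcoK /tens_change sum_tupleS exchange_big /=.
rewrite sum_tuple1; apply: eq_bigr => b _; rewrite mxE mulr_suml.
apply: eq_bigr => a _; rewrite big_ord_recl big_ord1 !mxE.
rewrite !(tnth_nth a) /= mulrA; congr (_ * _).
by rewrite mulrC.
Qed.

End TensorAlgebra.

Lemma second_countable_rV (R : realType) n : @second_countable 'rV[R]_n.
Proof.
pose f (p : 'rV[rat]_n * nat) : set 'rV[R]_n := ball (map_mx (@ratr R) p.1 : 'rV[R]_n) (p.2.+1%:R^-1).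
exists (f @` setT); first exact: sub_countable (card_image_le f setT) (countableP _).
split; first by move=> _ [p _ <-]; apply: ball_open.
move=> x A /nbhs_ballP[e /= e0 eA].
(* The ball to be chosen contains [x] without being centred there, so its points lie within two
   radii of [x]. *)
have [k kE] : exists k : nat, (2 : R) / k.+1%:R < e.
  exists (Num.bound (2 / e)); rewrite ltr_pdivrMr // mulrC -ltr_pdivrMr //.
  have /archi_boundP H : 0 <= 2 / e by rewrite divr_ge0 // ltW.
  by apply: lt_trans H _; rewrite ltr_nat.
have k0 : 0 < k.+1%:R^-1 :> R by rewrite invr_gt0.
have qP i : exists q : rat, `|x 0 i - ratr q| < k.+1%:R^-1.
  have [|z [/= H [q _ qz]]] := @dense_rat R (ball (x 0 i) k.+1%:R^-1) _ (ball_open _ _).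
    by exists (x 0 i); exact: ballxx.
  by exists q; rewrite qz.
pose q : 'rV[rat]_n := \row_i sval (cid (qP i)).
have xq : ball (map_mx (@ratr R) q : 'rV[R]_n) (k.+1%:R^-1) x.
  rewrite -ball_normE /ball_ /= distrC [ltLHS]/Num.Def.normr /= mx_normrE; apply: (bigmax_lt _ k0) => -[a i] _.
  by rewrite !mxE ord1; exact: (svalP (cid (qP i))).
exists (ball (map_mx (@ratr R) q : 'rV[R]_n) k.+1%:R^-1); first by split => //; exists (q, k).
move=> y qy; apply: eA; apply: le_ball (ltW kE) _ _.
have -> : 2 / k.+1%:R = k.+1%:R^-1 + k.+1%:R^-1 :> R by rewrite -[2]/(1 + 1) mulrDl mul1r.
by apply: ball_triangle (ball_sym xq) qy.
Qed.

(** * Charts of R^n *)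

Lemma mulmx_ext (R : realType) n p (A B : 'M[R]_(n, p)) :
  (forall v : 'rV_n, v *m A = v *m B) -> A = B.
Proof. by move=> AB; apply/row_matrixP => i; rewrite (rowE i A) AB -rowE. Qed.

Lemma mul_jacobian (R : realType) n p (f : 'rV[R]_n -> 'rV[R]_p) x v :
  v *m 'J f x = 'd f x v.
Proof. by rewrite /jacobian mul_rV_lin1. Qed.

Lemma jacobian_comp (R : realType) n (f g : 'rV[R]_n -> 'rV[R]_n) x :
  differentiable g x -> differentiable f (g x) ->
  'J (f \o g) x = 'J g x *m 'J f (g x).
Proof.
move=> dg df; apply: mulmx_ext => v.
have E := mul_jacobian g x v; rewrite mulmxA.
apply: etrans (mul_jacobian _ _ _) _; apply/esym.
apply: etrans (mul_jacobian f (g x) (v *m 'J g x)) _.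
by rewrite E; exact: esym (congr1 (fun h => h v) (diff_comp dg df)).
Qed.

Lemma jacobian_near (R : realType) n (f g : 'rV[R]_n -> 'rV[R]_n) x :
  differentiable f x -> (\near x, f x = g x) -> 'J f x = 'J g x.
Proof.
move=> df fg; have dg := near_eq_differentiable fg df.
apply: mulmx_ext => v; apply: etrans (mul_jacobian _ _ _) _.
apply/esym; apply: etrans (mul_jacobian _ _ _) _; apply/esym.
exact: etrans (esym (deriveE v df)) (etrans (near_eq_derive v fg) (deriveE v dg)).
Qed.

Lemma jacobian_id (R : realType) n (x : 'rV[R]_n) : 'J id x = 1%:M.
Proof.
apply: mulmx_ext => v; rewrite mulmx1; apply: etrans (mul_jacobian _ _ _) _.
exact: etrans (esym (deriveE v (@ex_diff _ _ _ _ _ _ _ (is_diff_id x)))) (derive_id x v).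
Qed.

Section Overlap.
Variables (R : realType) (n : nat) (M : topologicalType).
Implicit Types c : chart R n M.

(** Written as a preimage under [psi], which is continuous on the open image, an overlap is visibly
    open. *)
Lemma overlap_imageE c (A : set M) :
  phi c @` (dom c `&` A) = [set x | (phi c @` dom c) x /\ A (psi c x)].
Proof.
apply/seteqP; split=> [_ [p [cp Ap] <-]|_ [[p cp <-]]].
  by split; [exists p|rewrite phiK].
by rewrite phiK // => Ap; exists p.
Qed.

Lemma overlap_open c (A : set M) : open A -> open (phi c @` (dom c `&` A)).
Proof.
move=> oA; rewrite overlap_imageE openE => x [Ux Ax].
have := @psi_cont _ _ _ c; rewrite (continuous_open_subspace _ (@img_open _ _ _ c)) => cp.
have cx := cp x (mem_set Ux).
apply: filterI; first exact: open_nbhs_nbhs (conj (@img_open _ _ _ c) Ux).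
by apply: cx; exact: open_nbhs_nbhs.
Qed.

End Overlap.

Section Euclid.
Variables (R : realType) (n : nat).
Local Notation V := 'rV[R]_n.
Local Notation echart := (chart R n V).

Definition std_chart : echart.
Proof.
refine (@Chart R n V setT id id openT _ _ _ _).
- by rewrite image_id; exact: openT.
- by [].
- by apply: continuous_subspaceT => x; exact: cvg_id.
- by apply: continuous_subspaceT => x; exact: cvg_id.
Defined.

(** The coordinate map is [t] and the parametrization [s], so that components in this chart are
    pullbacks along [s]. *)
Definition diffeo_chart (s t : V -> V) (st : cancel s t) (ts : cancel t s)
  (sc : continuous s) (tc : continuous t) : echart.
Proof.
refine (@Chart R n V setT t s openT _ _ _ _).
- rewrite (_ : t @` setT = setT); first exact: openT.
  by apply/seteqP; split=> // x _; exists (s x).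
- by move=> p _; rewrite ts.
- exact: continuous_subspaceT.
- exact: continuous_subspaceT.
Defined.

Definition smooth_chart (c : echart) :=
  smooth_on (dom c) (phi c) /\ smooth_on (phi c @` dom c) (psi c).

Lemma compatible_stdP c : compatible c std_chart <-> smooth_chart c.
Proof.
rewrite /compatible /transition_smooth /= setIT setTI image_id /smooth_chart.
by split=> -[H1 H2].
Qed.

Lemma smooth_on_comp (U U' : set V) (f g : V -> V) : open U -> open U' ->
  (forall x, U x -> U' (g x)) -> smooth_on U g -> smooth_on U' f ->
  smooth_on U (f \o g).
Proof. by move=> oU oU' gU sg sf k; apply: Ck_comp_mx (gU) (sg k) (sf k). Qed.

Lemma smooth_chart_compatible c c' :
  smooth_chart c -> smooth_chart c' -> compatible c c'.
Proof.
have tr (a b : echart) : smooth_chart a -> smooth_chart b -> transition_smooth a b.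
  move=> [_ pa] [pb _]; apply: smooth_on_comp (pb).
  - exact: overlap_open (@dom_open _ _ _ b).
  - exact: dom_open.
  - by rewrite overlap_imageE => x [].
  - by move=> k; apply: Ck_sub (pa k); rewrite overlap_imageE => x [].
by move=> sc sc'; split; apply: tr.
Qed.

Lemma smooth_on_id (U : set V) : open U -> smooth_on U (id : V -> V).
Proof. by move=> oU k; exact: Ck_id. Qed.

Lemma std_smooth_chart : smooth_chart std_chart.
Proof.
by split; apply: smooth_on_id => /=; rewrite ?image_id; exact: openT.
Qed.

(** Maximality is immediate: a chart compatible with the whole atlas is compatible with the identity
    chart, which is what [smooth_chart] means by [compatible_stdP]. *)
Definition euclid : manifold R n.
Proof.
refine (@Manifold R n V [set c | smooth_chart c] _ _ _ _ _).
- exact: norm_hausdorff.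
- exact: second_countable_rV.
- by move=> p; exists std_chart => //; exact: std_smooth_chart.
- exact: smooth_chart_compatible.
- by move=> c /(_ _ std_smooth_chart)/compatible_stdP.
Defined.

Lemma smooth_chart_jacobian c x : smooth_chart c -> (phi c @` dom c) x ->
  'J (psi c) x \in unitmx.
Proof.
move=> [sp sq] [p cp <-]; have Ux : (phi c @` dom c) (phi c p) by exists p.
have dpsi : differentiable (psi c) (phi c p) by exact: (sq 1%N).1.
have dphi : differentiable (phi c) (psi c (phi c p)).
  by rewrite phiK //; exact: (sp 1%N).1.
have E : 'J (psi c) (phi c p) *m 'J (phi c) (psi c (phi c p)) = 1%:M.
  apply: etrans (esym (jacobian_comp dpsi dphi)) (etrans _ (jacobian_id (phi c p))).
  apply: jacobian_near; first exact: differentiable_comp.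
  by apply: filterS (open_nbhs_nbhs (conj (@img_open _ _ _ c) Ux)) => _ [q cq <-] /=;
    rewrite phiK.
exact: (mulmx1_unit E).1.
Qed.

(** Pullback of a globally given tensor along the parametrization. The rows of a Jacobian are
    indexed by the chart coordinates, whereas [tens_change] sums over rows; hence the transpose. *)
Definition euclid_comp k (F : V -> tens R n k) (c : echart) (x : V) : tens R n k :=
  mktens (tens_change ('J (psi c) x)^T (tco (F (psi c x)))).

Lemma euclid_comp_smooth k (F : V -> tens R n k) c : smooth_on setT F ->
  smooth_chart c -> smooth_on (phi c @` dom c) (euclid_comp F c).
Proof.
move=> sF [sp sq] j; have oU := @img_open _ _ _ c.
apply: Ck_mx => // i r.
set I := (enum_val r : k.-tuple 'I_n).
have H : Ck_on j (phi c @` dom c) (fun x => \sum_(J : k.-tuple 'I_n)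
    (F \o psi c) x 0 (enum_rank J) * \prod_(s < k) 'J (psi c) x (tnth I s) (tnth J s)).
  apply: Ck_sum => // J; apply: CkM => //.
    by apply: Ck_entry => //; apply: Ck_comp_mx (sq j) (sF j) => //; exact: openT.
  by apply: Ck_prod => // s; apply: Ck_entry => //; apply: Ck_jacobian => //; exact: sq.
apply: (Ck_ext oU H) => x Ux; rewrite !mxE /tens_change; apply: eq_bigr => J _.
by congr (_ * _); apply: eq_bigr => s _; rewrite [RHS]mxE.
Qed.

(** Near the point, psi c' is psi c after the transition map; the chain rule then gives the cocycle
    identity behind [euclid_comp_change]. *)
Lemma jacobian_transition c c' (p : V) :
  smooth_chart c -> smooth_chart c' -> dom c p -> dom c' p ->
  'J (psi c') (phi c' p) = @jac R n euclid c' c p *m 'J (psi c) (phi c p).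
Proof.
move=> [sp sq] [sp' sq'] cp cp'.
have oU : open (phi c' @` (dom c' `&` dom c)) by apply: overlap_open; exact: dom_open.
have Ux : (phi c' @` (dom c' `&` dom c)) (phi c' p) by exists p.
have dpsi' : differentiable (psi c') (phi c' p).
  by apply: (sq' 1%N).1; exists p.
have dphi : differentiable (phi c) (psi c' (phi c' p)).
  by rewrite phiK //; exact: (sp 1%N).1.
have E : (phi c \o psi c') (phi c' p) = phi c p by rewrite /= phiK.
have dpsi : differentiable (psi c) ((phi c \o psi c') (phi c' p)).
  by rewrite E; apply: (sq 1%N).1; exists p.
have dpp : differentiable (phi c \o psi c') (phi c' p) by exact: differentiable_comp.
have := jacobian_comp dpp dpsi; rewrite E => <-.
apply: jacobian_near => //.
by apply: filterS (open_nbhs_nbhs (conj oU Ux)) => _ [q [cq' cq] <-] /=; rewrite !phiK.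
Qed.

Lemma euclid_comp_change k (F : V -> tens R n k) c c' (p : V) :
  smooth_chart c -> smooth_chart c' -> dom c p -> dom c' p ->
  forall I, tco (euclid_comp F c' (phi c' p)) I =
    tens_change (@jac R n euclid c' c p)^T (tco (euclid_comp F c (phi c p))) I.
Proof.
move=> sc sc' cp cp' I; rewrite /euclid_comp (jacobian_transition sc sc' cp cp').
rewrite (phiK cp) (phiK cp'); move: (jac _ _ _) ('J _ _) => A B.
by rewrite !tcoK tens_change_comp trmx_mul.
Qed.

Definition euclid_field k (F : V -> tens R n k) (sF : smooth_on setT F) :
  tensor_field euclid k :=
  @TensorField R n euclid k (euclid_comp F)
    (fun c sc => euclid_comp_smooth sF sc)
    (fun c c' p sc sc' cp cp' => euclid_comp_change F sc sc' cp cp').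

Lemma lorentzian_congr (A G : 'M[R]_n) : A \in unitmx -> lorentzian G ->
  lorentzian (A *m G *m A^T).
Proof.
move=> uA [Gs [P uP PG]]; split; first by rewrite !trmx_mul trmxK Gs mulmxA.
exists (P *m invmx A); first by rewrite unitmx_mul uP unitmx_inv.
rewrite -PG trmx_mul !mulmxA mulmxKV //.
by rewrite -(mulmxA (P *m G)) -trmx_mul mulVmx // trmx1 mulmx1.
Qed.

Definition mx_tens2 (G : 'M[R]_n) : tens R n 2 :=
  mktens (fun I : 2.-tuple 'I_n => G (tnth I 0) (tnth I 1)).

Lemma euclid_comp_metric (G : V -> 'M[R]_n) c x :
  tens2_mx (euclid_comp (fun y => mx_tens2 (G y)) c x) =
  'J (psi c) x *m G (psi c x) *m ('J (psi c) x)^T.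
Proof. by rewrite /euclid_comp tcoK tens2_change trmxK. Qed.

Definition euclid_metric (G : V -> 'M[R]_n)
    (sG : smooth_on setT (fun x => mx_tens2 (G x)))
    (lG : forall x, lorentzian (G x)) : lorentz_metric euclid.
Proof.
refine (@LorentzMetric R n euclid (euclid_field sG) _) => c p sc cp.
rewrite euclid_comp_metric; apply: lorentzian_congr => //.
by apply: smooth_chart_jacobian => //; exists p.
Defined.

(** Both sides compute the same function at the point s x: on the left in the identity chart, on the
    right in the chart parametrized by [s], where that point has coordinates [x]. This is the
    passage from manifolds to jets. *)
Lemma jet_diffeo_invariant m (L : Yspace R n m -> R)
    (L_inv : forall (M : manifold R n) (g : lorentz_metric M)
      (D : tensor_field M m), exists f : M -> R, represents L g D f)
    (G : V -> 'M[R]_n) (F : V -> tens R n m) (s t : V -> V) (x : V) :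
  smooth_on setT G -> smooth_on setT F -> (forall x, lorentzian (G x)) ->
  cancel s t -> cancel t s -> smooth_on setT s -> smooth_on setT t ->
  L (jet G F (s x)) =
  L (jet (fun y => 'J s y *m G (s y) *m ('J s y)^T)
       (fun y => mktens (tens_change ('J s y)^T (tco (F (s y))))) x).
Proof.
move=> sG sF lG st ts ss st'.
have sG2 : smooth_on setT (fun x => mx_tens2 (G x)).
  move=> k; apply: Ck_mx => [|i r]; first exact: openT.
  have := Ck_entry (tnth (enum_val r) 0) (tnth (enum_val r) 1) openT (sG k).
  by move/(Ck_ext openT); apply=> y _; rewrite mxE.
pose g := euclid_metric sG2 lG; pose D := euclid_field sF.
have [f [_ fE]] := L_inv euclid g D.
have sc y : {for y, continuous s} by exact: (ss 0%N).
have tc y : {for y, continuous t} by exact: (st' 0%N).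
pose c := diffeo_chart st ts sc tc.
have scc : smooth_chart c.
  split=> //= k; apply: Ck_sub (ss k) => //.
have E1 := fE std_chart (s x) std_smooth_chart I.
have E2 := fE c (s x) scc I.
transitivity (f (s x)).
  rewrite -E1 /=; congr (L (jet _ _ _)); apply/funext => y.
    by rewrite /gmx euclid_comp_metric /= jacobian_id mul1mx trmx1 mulmx1.
  by rewrite /= /euclid_comp /= jacobian_id trmx1 tens_change1 mktensK.
rewrite -E2 /= st; congr (L (jet _ _ _)); apply/funext => y.
by rewrite /gmx euclid_comp_metric.
Qed.

End Euclid.

(** * Second-order jets *)

Section Jet2.
Variables (R : realType) (n : nat).
Local Notation V := 'rV[R]_n.
Implicit Types (f : V -> R) (x : V).

Definition smoothR f := smooth_on setT f.

Lemma smoothR_differentiable f x : smoothR f -> differentiable f x.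
Proof. by move=> /(_ 1%N)[+ _]; apply. Qed.

Lemma smoothR_pd k f : smoothR f -> smoothR (pd k f).
Proof. by move=> sf j; exact: (sf j.+1).2. Qed.

Lemma smoothR_cst (c : R) : smoothR (fun=> c).
Proof. by move=> k; exact: Ck_cst. Qed.

Lemma smoothRD (f g : V -> R) : smoothR f -> smoothR g -> smoothR (fun x => f x + g x).
Proof. by move=> sf sg k; apply: CkD => //; exact: openT. Qed.

Lemma smoothRM (f g : V -> R) : smoothR f -> smoothR g -> smoothR (fun x => f x * g x).
Proof. by move=> sf sg k; apply: CkM => //; exact: openT. Qed.

Lemma smoothR_sum (I : Type) (r : seq I) (P : pred I) (f : I -> V -> R) :
  (forall i, smoothR (f i)) -> smoothR (fun x => \sum_(i <- r | P i) f i x).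
Proof. by move=> sf k; apply: Ck_sum => //; [exact: openT|move=> i; exact: sf]. Qed.

Lemma smoothR_prod (I : Type) (r : seq I) (P : pred I) (f : I -> V -> R) :
  (forall i, smoothR (f i)) -> smoothR (fun x => \prod_(i <- r | P i) f i x).
Proof. by move=> sf k; apply: Ck_prod => //; [exact: openT|move=> i; exact: sf]. Qed.

Lemma smoothR_coord i : smoothR (fun x : V => x 0 i).
Proof. by move=> k; apply: Ck_entry; [exact: openT|apply: Ck_id; exact: openT]. Qed.

Lemma pd_cst k (c : R) : pd k (fun=> c : R) = (fun _ : V => 0).
Proof. by apply/funext => x; exact: derive_cst. Qed.

Lemma pd_add k (f g : V -> R) : smoothR f -> smoothR g ->
  pd k (fun x => f x + g x) = (fun x => pd k f x + pd k g x).
Proof. by move=> sf sg; apply/funext => x; apply: deriveD_fun; exact: smoothR_differentiable. Qed.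

Lemma pd_mul k (f g : V -> R) : smoothR f -> smoothR g ->
  pd k (fun x => f x * g x) = (fun x => pd k f x * g x + f x * pd k g x).
Proof. by move=> sf sg; apply/funext => x; apply: deriveM_fun; exact: smoothR_differentiable. Qed.

Lemma pd_sum k (I : Type) (r : seq I) (P : pred I) (f : I -> V -> R) :
  (forall i, smoothR (f i)) ->
  pd k (fun x => \sum_(i <- r | P i) f i x) = (fun x => \sum_(i <- r | P i) pd k (f i) x).
Proof. by move=> sf; apply/funext => x; apply: derive_sum_fun => i; exact: smoothR_differentiable. Qed.

Lemma pd_coord k i : pd k (fun x : V => x 0 i) = (fun=> (k == i)%:R).
Proof.
apply/funext => x; rewrite /pd -(derive_mx_entry _ 0 i (@ex_diff _ _ _ _ _ _ _ (is_diff_id x))).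
by rewrite derive_id mxE eqxx eq_sym.
Qed.

(* The 2-jet of f at the origin: value, gradient, Hessian. *)
Definition jet2 f (c : R) (g : 'I_n -> R) (h : 'I_n -> 'I_n -> R) :=
  [/\ smoothR f, f 0 = c, forall k, pd k f 0 = g k &
      forall k l, pd l (pd k f) 0 = h k l].

Lemma jet2_eq f c c' g g' h h' : jet2 f c g h -> c = c' -> g =1 g' -> h =2 h' ->
  jet2 f c' g' h'.
Proof.
by move=> [sf f0 f1 f2] <- gg hh; split=> // [k|k l]; rewrite ?f1 ?f2.
Qed.

Lemma jet2_cst (c : R) : jet2 (fun=> c) c (fun=> 0) (fun _ _ => 0).
Proof.
split=> // [|k|k l]; first exact: smoothR_cst.
  by rewrite pd_cst.
by rewrite !pd_cst.
Qed.

Lemma jet2D f c g h f' c' g' h' : jet2 f c g h -> jet2 f' c' g' h' ->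
  jet2 (fun x => f x + f' x) (c + c') (fun k => g k + g' k) (fun k l => h k l + h' k l).
Proof.
move=> [sf f0 f1 f2] [sf' f0' f1' f2']; split=> [||k|k l]; first exact: smoothRD.
- by rewrite f0 f0'.
- by rewrite pd_add // f1 f1'.
- by rewrite pd_add // pd_add ?f2 ?f2' //; exact: smoothR_pd.
Qed.

Lemma jet2M f c g h f' c' g' h' : jet2 f c g h -> jet2 f' c' g' h' ->
  jet2 (fun x => f x * f' x) (c * c') (fun k => g k * c' + c * g' k)
    (fun k l => h k l * c' + g k * g' l + g l * g' k + c * h' k l).
Proof.
move=> [sf f0 f1 f2] [sf' f0' f1' f2']; split=> [||k|k l]; first exact: smoothRM.
- by rewrite f0 f0'.
- by rewrite pd_mul // f1 f1' f0 f0'.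
- rewrite pd_mul // pd_add; [|by apply: smoothRM => //; exact: smoothR_pd..].
  rewrite !pd_mul ?f0 ?f0' ?f1 ?f1' ?f2 ?f2' //; try exact: smoothR_pd.
  by rewrite addrA.
Qed.

Lemma jet2Z (a : R) f c g h : jet2 f c g h ->
  jet2 (fun x => a * f x) (a * c) (fun k => a * g k) (fun k l => a * h k l).
Proof.
move=> H; apply: (jet2_eq (jet2M (jet2_cst a) H)) => // [k|k l].
  by rewrite mul0r add0r.
by rewrite !mul0r !add0r.
Qed.

Lemma jet2_sum (I : Type) (r : seq I) (P : pred I) (f : I -> V -> R) c g h :
  (forall i, jet2 (f i) (c i) (g i) (h i)) ->
  jet2 (fun x => \sum_(i <- r | P i) f i x) (\sum_(i <- r | P i) c i)
    (fun k => \sum_(i <- r | P i) g i k) (fun k l => \sum_(i <- r | P i) h i k l).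
Proof.
move=> H; have sf i : smoothR (f i) by case: (H i).
split=> [||k|k l]; first exact: smoothR_sum.
- by apply: eq_bigr => i _; case: (H i).
- by rewrite pd_sum //; apply: eq_bigr => i _; case: (H i).
- rewrite pd_sum // pd_sum => [|i]; last exact: smoothR_pd.
  by apply: eq_bigr => i _; case: (H i).
Qed.

Lemma jet2_coord i : jet2 (fun x => x 0 i) 0 (fun k => (k == i)%:R) (fun _ _ => 0).
Proof.
split=> [||k|k l]; first exact: smoothR_coord.
- by rewrite mxE.
- by rewrite pd_coord.
- by rewrite pd_coord pd_cst.
Qed.

(** Each function is the derivative of the other up to sign, so the induction treats both at
    once. *)
Lemma Ck_sin_cos k (U : set V) f : open U -> Ck_on k U f ->
  Ck_on k U (sin \o f) /\ Ck_on k U (cos \o f).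
Proof.
move=> oU; elim: k => [|k IH].
  move=> cf; split=> x Ux; apply: continuous_comp; try exact: cf.
    exact: continuous_sin.
  exact: continuous_cos.
move=> Cf; have [df Df] := Cf; have [Cs Cc] := IH (CkW Cf).
have dsin y : differentiable (@sin R) y by exact/derivable1_diffP/derivable_sin.
have dcos y : differentiable (@cos R) y by exact/derivable1_diffP/derivable_cos.
have dchain (u : R -> R) x v : differentiable u (f x) -> U x ->
    'D_v (u \o f) x = u^`()%classic (f x) * 'D_v f x.
  move=> du Ux; have dfx := df x Ux; rewrite deriveE; last exact: differentiable_comp.
  rewrite (congr1 (fun h => h v) (diff_comp dfx du)) /= -(deriveE v dfx).
  by rewrite (congr1 (fun h => h ('D_v f x)) (diff1E du)) [LHS]mulrC.
have dsinE y : (@sin R)^`()%classic y = cos y.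
  by rewrite derive1E; apply: derive_val; exact: is_derive_sin.
have dcosE y : (@cos R)^`()%classic y = - sin y.
  by rewrite derive1E; apply: derive_val; exact: is_derive_cos.
split; split=> [x Ux|v].
- by apply: differentiable_comp => //; exact: df.
- by apply: (Ck_ext oU (CkM oU Cc (Df v))) => x Ux; rewrite dchain // dsinE.
- by apply: differentiable_comp => //; exact: df.
- by apply: (Ck_ext oU (CkM oU (CkN oU Cs) (Df v))) => x Ux; rewrite dchain // dcosE.
Qed.

Lemma pd_chain k (u u' : R -> R) f : (forall t, is_derive t (1 : R) u (u' t)) ->
  smoothR f -> pd k (fun x => u (f x)) = (fun x => u' (f x) * pd k f x).
Proof.
move=> uu' sf; apply/funext => x; have df := smoothR_differentiable x sf.
have du : differentiable u (f x) by apply/derivable1_diffP; case: (uu' (f x)).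
rewrite /pd deriveE; last exact: differentiable_comp.
rewrite (congr1 (fun h => h (delta_mx 0 k)) (diff_comp df du)) /= -(deriveE _ df).
rewrite (congr1 (fun h => h ('D_(delta_mx 0 k) f x)) (diff1E du)) [LHS]mulrC.
by rewrite derive1E (@derive_val _ _ _ _ _ _ _ (uu' (f x))).
Qed.

(* Bounded by e, tangent to the identity to second order at the origin. *)
Definition cutoff (e t : R) : R := e * sin (e^-1 * t).

Lemma smoothR_cutoff e f : smoothR f -> smoothR (fun x => cutoff e (f x)).
Proof.
move=> sf; apply: smoothRM; first exact: smoothR_cst.
by move=> k; case: (Ck_sin_cos openT (smoothRM (smoothR_cst e^-1) sf k)).
Qed.

(** At 0 the cutoff has first derivative cos 0 = 1 and second derivative a multiple of sin 0 = 0;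
    higher ones do not enter a 2-jet. *)
Lemma jet2_cutoff e f g h : e != 0 -> jet2 f 0 g h ->
  jet2 (fun x => cutoff e (f x)) 0 g h.
Proof.
move=> e0 [sf f0 f1 f2]; have sef : smoothR (fun x => e^-1 * f x).
  by apply: smoothRM => //; exact: smoothR_cst.
have scos : smoothR (fun x => cos (e^-1 * f x)).
  by move=> k; case: (Ck_sin_cos openT (sef k)).
have ssin : smoothR (sin \o (fun x => e^-1 * f x)).
  by move=> k; case: (Ck_sin_cos openT (sef k)).
have pdE k : pd k (fun x => cutoff e (f x)) = (fun x => cos (e^-1 * f x) * pd k f x).
  rewrite pd_mul //; last exact: smoothR_cst.
  apply/funext => x; rewrite pd_cst mul0r add0r (pd_chain k (@is_derive_sin R) sef).
  rewrite pd_mul //; last exact: smoothR_cst.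
  by rewrite pd_cst mul0r add0r mulrCA mulVKf.
split=> [||k|k l]; first exact: smoothR_cutoff.
- by rewrite /cutoff f0 mulr0 sin0 mulr0.
- by rewrite pdE f0 mulr0 cos0 mul1r f1.
rewrite pdE pd_mul //; last exact: smoothR_pd.
rewrite f2 f0 mulr0 cos0 mul1r -[RHS]add0r; congr (_ + _).
apply/eqP; rewrite mulf_eq0; apply/orP; left; apply/eqP.
by rewrite (pd_chain l (@is_derive_cos R) sef) f0 mulr0 sin0 oppr0 mul0r.
Qed.

Lemma cutoff_bound e t : 0 <= e -> `|cutoff e t| <= e.
Proof.
by move=> e0; rewrite normrM ger0_norm // ler_piMr // sin_max.
Qed.

Lemma cutoff_lipschitz e t u : 0 < e -> `|cutoff e t - cutoff e u| <= `|t - u|.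
Proof.
move=> e0; have sinL (a b : R) : `|sin a - sin b| <= `|a - b|.
  wlog ab : a b / b <= a.
    by move=> H; case: (leP b a) => [/H//|/ltW/H]; rewrite distrC [leRHS]distrC.
  have [|c _ ->] := @MVT_segment _ sin cos b a ab.
    by apply: continuous_subspaceT => y; exact: continuous_sin.
  by rewrite normrM ler_piMl // cos_max.
have ei : 0 <= e^-1 by rewrite invr_ge0 ltW.
have H : `|sin (e^-1 * t) - sin (e^-1 * u)| <= e^-1 * `|t - u|.
  by apply: le_trans (sinL _ _) _; rewrite -mulrBr normrM (ger0_norm ei).
rewrite -mulrBr normrM (ger0_norm (ltW e0)).
by apply: le_trans (ler_wpM2l (ltW e0) H) _; rewrite mulVKf ?gt_eqF.
Qed.

End Jet2.

Lemma sum_delta_l (R : realType) n (F : 'I_n -> R) i : \sum_j (i == j)%:R * F j = F i.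
Proof.
rewrite (bigD1 i) //= eqxx mul1r big1 ?addr0 // => j ji.
by rewrite eq_sym (negbTE ji) mul0r.
Qed.

Section JetCoordinates.
Variables (R : realType) (n m : nat).
Local Notation V := 'rV[R]_n.

Definition mkY (w : 'M[R]_n) (a : 'I_n -> 'I_n -> 'I_n -> R)
    (b : 'I_n -> 'I_n -> 'I_n -> 'I_n -> R) (d : m.-tuple 'I_n -> R)
    (e : m.-tuple 'I_n -> 'I_n -> R) : Yspace R n m :=
  (w, mktens (fun I : 3.-tuple 'I_n => a (tnth I 0) (tnth I 1) (tnth I 2%:R)),
   mktens (fun I : 4.-tuple 'I_n =>
     b (tnth I 0) (tnth I 1) (tnth I 2%:R) (tnth I 3%:R)),
   mktens d,
   mktens (fun K : m.+1.-tuple 'I_n =>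
     e [tuple tnth K (widen_ord (leqnSn m) t) | t < m] (tnth K ord_max))).

Lemma jetE (G : V -> 'M[R]_n) (D : V -> tens R n m) x :
  jet G D x = mkY (G x) (fun i j k => pd k (fun y => G y i j) x)
    (fun i j k l => pd l (pd k (fun y => G y i j)) x)
    (tco (D x)) (fun I j => pd j (fun y => tco (D y) I) x).
Proof. by rewrite /mkY mktensK. Qed.

Definition upd (I : m.-tuple 'I_n) (s : 'I_m) (a : 'I_n) : m.-tuple 'I_n :=
  [tuple if t == s then a else tnth I t | t < m].

Lemma tnth_upd I s a t : tnth (upd I s a) t = if t == s then a else tnth I t.
Proof. exact: tnth_mktuple. Qed.

(** The product selects the multi-indices that agree with [I] off the place [s]; these are
    parametrized by their entry at [s]. *)
Lemma sum_upd (F : m.-tuple 'I_n -> R) I s :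
  \sum_J F J * \prod_(t < m | t != s) (tnth I t == tnth J t)%:R =
  \sum_a F (upd I s a).
Proof.
have E : \sum_J F J * \prod_(t < m | t != s) (tnth I t == tnth J t)%:R =
    \sum_(J | upd I s (tnth J s) == J) F J.
  rewrite [RHS]big_mkcond; apply: eq_bigr => J _.
  have [IJ|IJ] := boolP (upd I s (tnth J s) == J).
    rewrite big1 ?mulr1 // => t ts; rewrite -(eqP IJ) tnth_upd (negbTE ts).
    by rewrite eqxx.
  have : [exists t, (t != s) && (tnth I t != tnth J t)].
    apply: contraR IJ => /existsPn H; apply/eqP/eq_from_tnth => t; rewrite tnth_upd.
    by case: eqP => [->//|/eqP ts]; have := H t; rewrite ts /= negbK => /eqP.
  move=> /existsP[t /andP[ts IJt]].
  by rewrite (bigD1 t) //= (negbTE IJt) mul0r mulr0.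
rewrite E (reindex_onto (upd I s) (fun J => tnth J s)) /=; last by move=> J /eqP.
by apply: eq_bigl => a; rewrite tnth_upd eqxx !eqxx.
Qed.

End JetCoordinates.

Section JetMx.
Variables (R : realType) (n : nat).
Local Notation V := 'rV[R]_n.

Definition jet2mx (f : V -> 'M[R]_n) (c : 'M[R]_n) (g : 'I_n -> 'M[R]_n)
    (h : 'I_n -> 'I_n -> 'M[R]_n) :=
  forall i j, jet2 (fun x => f x i j) (c i j) (fun k => g k i j) (fun k l => h k l i j).

Lemma jet2mxM f c g h f' c' g' h' : jet2mx f c g h -> jet2mx f' c' g' h' ->
  jet2mx (fun x => f x *m f' x) (c *m c') (fun k => g k *m c' + c *m g' k)
    (fun k l => h k l *m c' + g k *m g' l + g l *m g' k + c *m h' k l).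
Proof.
move=> H H' i j.
have E : (fun x => (f x *m f' x) i j) = (fun x => \sum_a f x i a * f' x a j).
  by apply/funext => x; rewrite mxE.
rewrite E; apply: (jet2_eq (jet2_sum _ _ (fun a => jet2M (H i a) (H' a j)))).
- by rewrite mxE.
- by move=> k; rewrite !mxE -big_split.
- by move=> k l; rewrite !mxE -!big_split.
Qed.

Lemma jet2mxT f c g h : jet2mx f c g h ->
  jet2mx (fun x => (f x)^T) c^T (fun k => (g k)^T) (fun k l => (h k l)^T).
Proof.
move=> H i j; have E : (fun x => (f x)^T i j) = (fun x => f x j i).
  by apply/funext => x; rewrite mxE.
by rewrite E; apply: (jet2_eq (H j i)) => [|k|k l]; rewrite mxE.
Qed.

Lemma jet2mx_eq f c g h c' g' h' : jet2mx f c g h -> c = c' -> g =1 g' -> h =2 h' ->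
  jet2mx f c' g' h'.
Proof.
by move=> H cc gg hh i j; apply: (jet2_eq (H i j)) => [|k|k l]; rewrite ?cc ?gg ?hh.
Qed.

Lemma jet2mx_cst (c : 'M[R]_n) : jet2mx (fun=> c) c (fun=> 0) (fun _ _ => 0).
Proof.
by move=> i j; apply: (jet2_eq (jet2_cst _ (c i j))) => // [k|k l]; rewrite mxE.
Qed.

End JetMx.

(** * Global fields on R^n with prescribed jets at the origin *)

Section Model.
Variables (R : realType) (n m : nat).
Local Notation V := 'rV[R]_n.
Variables (w : 'M[R]_n) (b : 'I_n -> 'I_n -> 'I_n -> 'I_n -> R)
  (d : m.-tuple 'I_n -> R) (e : m.-tuple 'I_n -> 'I_n -> R).
Hypotheses (w_sym : w^T = w) (w_unit : w \in unitmx).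
Hypotheses (b_sym1 : forall i j k l, b i j k l = b j i k l)
  (b_sym2 : forall i j k l, b i j k l = b i j l k).
Variable r : R.

Definition b_mx k l : 'M[R]_n := \matrix_(i, j) b i j k l.

(** The factor 1/4 compensates the 2 from differentiating x_k x_l twice and the 2 from the two
    frames in [model_metric]. *)
Definition model_frame (x : V) : 'M[R]_n :=
  1%:M + \sum_k \sum_l (cutoff r (x 0 k) * cutoff r (x 0 l)) *:
    (4^-1 *: (b_mx k l *m invmx w)).

(* Congruence by an invertible matrix makes the Lorentz signature evident at
   every point; the 2-jet at the origin is (w, 0, b). *)
Definition model_metric (x : V) : 'M[R]_n :=
  model_frame x *m w *m (model_frame x)^T.

Definition model_tensor (x : V) : tens R n m :=
  mktens (fun I => d I + \sum_c e I c * cutoff r (x 0 c)).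

Hypothesis r_neq0 : r != 0.

(** The Hessian [B] of [s] drops out, because the nonconstant part of the frame is quadratic in
    cut-off coordinates that vanish at the origin. *)
Lemma model_frame_jet (s : V -> V) (A : 'M[R]_n) (B : 'I_n -> 'I_n -> 'I_n -> R) :
  (forall a, jet2 (fun y => s y 0 a) 0 (fun k => A k a) (B a)) ->
  jet2mx (fun y => model_frame (s y)) 1%:M (fun=> 0)
   (fun p q => 2^-1 *: (\sum_k \sum_l (A p k * A q l) *: (b_mx k l *m invmx w))).
Proof.
move=> sj i j.
have E : (fun y => model_frame (s y) i j) = (fun y => (i == j)%:R +
   \sum_k \sum_l (4^-1 * (b_mx k l *m invmx w) i j) *
     (cutoff r (s y 0 k) * cutoff r (s y 0 l))).
  apply/funext => y; rewrite !mxE; congr (_ + _); rewrite summxE.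
  apply: eq_bigr => k _; rewrite summxE; apply: eq_bigr => l _.
  by rewrite !mxE mulrC.
rewrite E; apply: (jet2_eq (jet2D (jet2_cst _ _) (jet2_sum _ _ (fun k => jet2_sum _ _ (fun l =>
   jet2Z _ (jet2M (jet2_cutoff r_neq0 (sj k)) (jet2_cutoff r_neq0 (sj l)))))))).
- rewrite mxE big1 ?addr0 // => k _; rewrite big1 // => l _.
  by rewrite !mulr0.
- move=> p; rewrite mxE add0r big1 // => k _; rewrite big1 // => l _.
  by rewrite mulr0 mul0r add0r mulr0.
move=> p q; rewrite add0r mxE summxE.
have -> : \sum_k (\sum_l (A p k * A q l) *: (b_mx k l *m invmx w)) i j =
  \sum_k \sum_l (A p k * A q l) * (b_mx k l *m invmx w) i j.
  by apply: eq_bigr => k _; rewrite summxE; apply: eq_bigr => l _; rewrite mxE.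
transitivity (4^-1 * (\sum_k \sum_l A p k * A q l * (b_mx k l *m invmx w) i j +
   \sum_k \sum_l A q k * A p l * (b_mx k l *m invmx w) i j)).
  rewrite -big_split mulr_sumr; apply: eq_bigr => k _.
  rewrite -big_split mulr_sumr; apply: eq_bigr => l _ /=.
  by rewrite !(mulr0, mul0r) addr0 add0r; ring.
rewrite [X in _ + X]exchange_big /=.
have -> : \sum_l \sum_k A q k * A p l * (b_mx k l *m invmx w) i j =
   \sum_k \sum_l A p k * A q l * (b_mx k l *m invmx w) i j.
  apply: eq_bigr => k _; apply: eq_bigr => l _; congr (_ * _); first by rewrite mulrC.
  congr ((_ *m _) i j); apply/matrixP => i' j'; rewrite !mxE; exact: b_sym2.
by field.
Qed.

Lemma model_metric_jet (s : V -> V) (A : 'M[R]_n) (B : 'I_n -> 'I_n -> 'I_n -> R) :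
  (forall a, jet2 (fun y => s y 0 a) 0 (fun k => A k a) (B a)) ->
  jet2mx (fun y => model_metric (s y)) w (fun=> 0)
   (fun p q => \sum_k \sum_l (A p k * A q l) *: b_mx k l).
Proof.
move=> /model_frame_jet Nj.
apply: (jet2mx_eq (jet2mxM (jet2mxM Nj (jet2mx_cst w)) (jet2mxT Nj))).
- by rewrite trmx1 mul1mx mulmx1.
- by move=> p; rewrite trmx0 !mul0mx !mulmx0 !addr0 mul0mx.
move=> p q; rewrite trmx0 trmx1 !mul0mx !mulmx0 !addr0 mulmx1 mul1mx.
set X := \sum_k _; set Z := \sum_k _.
have XE : X *m w = Z.
  rewrite mulmx_suml; apply: eq_bigr => k _; rewrite mulmx_suml; apply: eq_bigr => l _.
  by rewrite -scalemxAl mulmxKV.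
have ZT : Z^T = Z.
  apply/matrixP => i j; rewrite mxE !summxE; apply: eq_bigr => k _; rewrite !summxE.
  by apply: eq_bigr => l _; rewrite !mxE b_sym1.
rewrite -scalemxAl XE linearZ /= -scalemxAr -{1}w_sym -trmx_mul XE ZT -scalerDl.
by rewrite (_ : 2^-1 + 2^-1 = 1 :> R) ?scale1r //; field.
Qed.

(** Leibniz's rule for three factors. As the model metric has no first derivatives at the origin,
    the only cross terms pair the first derivatives of the two Jacobians. *)
Lemma model_pullback_metric (s : V -> V) (A : 'M[R]_n) B C T :
  (forall a, jet2 (fun y => s y 0 a) 0 (fun k => A k a) (B a)) ->
  jet2mx (fun y => 'J s y) A C T ->
  jet2mx (fun y => 'J s y *m model_metric (s y) *m ('J s y)^T)
   (A *m w *m A^T) (fun k => C k *m w *m A^T + A *m w *m (C k)^T)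
   (fun k l => T k l *m w *m A^T + A *m w *m (T k l)^T +
      (C k *m w *m (C l)^T + C l *m w *m (C k)^T) +
      \sum_k' \sum_l' (A k k' * A l l') *: (A *m b_mx k' l' *m A^T)).
Proof.
move=> /model_metric_jet Gj Jj.
apply: (jet2mx_eq (jet2mxM (jet2mxM Jj Gj) (jet2mxT Jj))) => // [k|k l].
  by rewrite mulmx0 addr0.
rewrite !mulmx0 !addr0 mulmxDl -!addrA; congr (_ + _).
have -> : A *m (\sum_k' \sum_l' (A k k' * A l l') *: b_mx k' l') *m A^T =
   \sum_k' \sum_l' (A k k' * A l l') *: (A *m b_mx k' l' *m A^T).
  rewrite mulmx_sumr mulmx_suml; apply: eq_bigr => k' _.
  rewrite mulmx_sumr mulmx_suml; apply: eq_bigr => l' _.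
  by rewrite -scalemxAr -scalemxAl.
by rewrite [LHS]addrC -!addrA [RHS]addrCA; congr (_ + _); rewrite [RHS]addrCA.
Qed.

Lemma model_pullback_tensor (s : V -> V) (A : 'M[R]_n) B C T I :
  (forall a, jet2 (fun y => s y 0 a) 0 (fun k => A k a) (B a)) ->
  jet2mx (fun y => 'J s y) A C T ->
  let f := fun y => tco (mktens (tens_change ('J s y)^T (tco (model_tensor (s y))))) I in
  f 0 = tens_change A^T d I /\
  forall k, pd k f 0 = \sum_(J : m.-tuple 'I_n)
    ((\sum_c e J c * A k c) * \prod_(t < m) A (tnth I t) (tnth J t) +
    d J * \sum_(u < m) C k (tnth I u) (tnth J u) *
       \prod_(t < m | t != u) A (tnth I t) (tnth J t)).
Proof.
move=> sj Jj f; pose D J y := d J + \sum_c e J c * cutoff r (s y 0 c).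
have Dj J := jet2D (jet2_cst _ (d J)) (jet2_sum (index_enum _) predT (fun c => jet2Z (e J c) (jet2_cutoff r_neq0 (sj c)))).
have fE : f = fun y => \sum_J D J y * \prod_(t < m) 'J s y (tnth I t) (tnth J t).
  apply/funext => y; rewrite /f tcoK /tens_change /model_tensor tcoK.
  by apply: eq_bigr => J _; congr (_ * _); apply: eq_bigr => t _; rewrite [LHS]mxE.
have sJ i j : smoothR (fun y => 'J s y i j) by case: (Jj i j).
have sD J : smoothR (D J) by case: (Dj J).
have D0 J : D J 0 = d J.
  by rewrite /D; have [_ -> _ _] := Dj J; rewrite big1 ?addr0 // => c _; rewrite mulr0.
have J0 i j : 'J s 0 i j = A i j by case: (Jj i j).
split.
  rewrite fE /tens_change; apply: eq_bigr => J _; rewrite D0; congr (_ * _).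
  by apply: eq_bigr => t _; rewrite J0 mxE.
move=> k; rewrite fE pd_sum; last by move=> J; apply: smoothRM => //; exact: smoothR_prod.
apply: eq_bigr => J _; rewrite pd_mul //; last exact: smoothR_prod.
congr (_ + _).
  congr (_ * _); last by apply: eq_bigr => t _; rewrite J0.
  by rewrite /D; have [_ _ -> _] := Dj J; rewrite add0r.
rewrite D0; congr (_ * _); rewrite /pd derive_prod_fun => [|t]; last exact: smoothR_differentiable.
apply: eq_bigr => u _; congr (_ * _); last by apply: eq_bigr => t _; rewrite J0.
by have [_ _ H _] := Jj (tnth I u) (tnth J u); exact: H.
Qed.

End Model.

(** * Extending 3-jets of diffeomorphisms *)

Lemma unitmx_inj (R : fieldType) n (A : 'M[R]_n) :
  (forall v : 'rV_n, v *m A = 0 -> v = 0) -> A \in unitmx.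
Proof.
move=> H; rewrite -row_free_unit -kermx_eq0; apply/rowV0P => v.
by rewrite sub_kermx => /eqP /H.
Qed.

Section ModelCharts.
Variables (R : realType) (n m : nat).
Local Notation V := 'rV[R]_n.

Lemma jacobian_entry (s : V -> V) x i a : differentiable s x ->
  'J s x i a = pd i (fun y => s y 0 a) x.
Proof.
by move=> ds; rewrite /pd -derive_mx_entry // deriveEjacobian // -rowE [RHS]mxE.
Qed.

Lemma norm_entry (x : V) i : `|x 0 i| <= `|x|.
Proof.
rewrite [leRHS]/Num.Def.normr /= mx_normrE.
exact: (le_bigmax _ (fun k : 'I_1 * 'I_n => `|x k.1 k.2|) (0, i)).
Qed.

Lemma norm_row_le (x : V) (c : R) : 0 <= c -> (forall i, `|x 0 i| <= c) -> `|x| <= c.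
Proof.
move=> c0 H; rewrite [leLHS]/Num.Def.normr /= mx_normrE.
by apply: bigmax_le => // -[a i] _ /=; rewrite ord1.
Qed.

(** A kernel vector satisfies |v| <= r^2 K |v|, while r (1 + K) <= 1 forces r^2 K <= 1 - r. All
    smaller r are allowed because the same r must also make a coordinate change a small
    perturbation. *)
Lemma model_frame_unit (w : 'M[R]_n) b : exists2 r0, 0 < r0 &
  forall r, 0 < r -> r <= r0 -> forall x, model_frame w b r x \in unitmx.
Proof.
pose E k l : 'M[R]_n := 4^-1 *: (b_mx b k l *m invmx w).
have cE k l : continuous (mulmxr (E k l) : V -> V) by exact: mx_linear_continuous.
have HC k l : exists C, 0 < C /\ forall v : V, `|v *m E k l| <= C * `|v|.
  by have [C C0 HC] := linear_lipschitz (cE k l); exists C.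
pose C k l := sval (cid (HC k l)).
have C0 k l : 0 < C k l by have [] := svalP (cid (HC k l)).
have CE k l (v : V) : `|v *m E k l| <= C k l * `|v|.
  by have [_ H] := svalP (cid (HC k l)); exact: H.
pose K := \sum_k \sum_l C k l.
have K0 : 0 <= K by apply: sumr_ge0 => k _; apply: sumr_ge0 => l _; exact: ltW.
exists ((1 + K)^-1); first by rewrite invr_gt0 ltr_pwDl.
move=> r r0 rK x; apply: unitmx_inj => v.
have rK1 : r * (1 + K) <= 1 by rewrite -ler_pdivlMr ?ltr_pwDl // div1r.
have r1 : r <= 1.
  by apply: le_trans rK _; rewrite invf_le1 ?ltr_pwDl // lerDl.
rewrite mulmxDr mulmx1 => /eqP; rewrite addr_eq0 => /eqP vE.
apply/eqP; rewrite -normr_le0.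
have H : `|v| <= r ^+ 2 * K * `|v|.
  rewrite {1}vE normrN mulmx_sumr mulr_sumr mulr_suml.
  apply: (le_trans (ler_norm_sum _ _ _)); apply: ler_sum => k _.
  rewrite mulmx_sumr mulr_sumr mulr_suml.
  apply: (le_trans (ler_norm_sum _ _ _)); apply: ler_sum => l _.
  rewrite -scalemxAr normrZ -mulrA; apply: ler_pM => //; last exact: CE.
  by rewrite normrM expr2 ler_pM // cutoff_bound // ltW.
have rK2 : r ^+ 2 * K <= 1 - r.
  have : r * (r * K) <= r * K by rewrite ler_piMl // mulr_ge0 // ltW.
  by rewrite expr2 -mulrA; lra.
have H2 := le_trans H (ler_wpM2r (normr_ge0 v) rK2).
by rewrite -(pmulr_rle0 `|v| r0); lra.
Qed.

Section Diffeo.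
Variables (S : 'I_n -> 'I_n -> 'I_n -> R) (T : 'I_n -> 'I_n -> 'I_n -> 'I_n -> R).
Hypotheses (S_sym : forall a i j, S a i j = S a j i)
  (T_sym1 : forall a i j k, T a i j k = T a j i k)
  (T_sym2 : forall a i j k, T a i j k = T a i k j).
Variable r : R.

(** The Taylor polynomial with second derivatives [S] and third derivatives [T], in cut-off
    coordinates. The cubic error of a cutoff enters a product of two or more of them only at order
    four, so the 3-jet is exact. *)
Definition bump_fun (a : 'I_n) (x : V) : R :=
  2^-1 * (\sum_i \sum_j S a i j * (cutoff r (x 0 i) * cutoff r (x 0 j))) +
  6^-1 * (\sum_i \sum_j \sum_k T a i j k *
     (cutoff r (x 0 i) * (cutoff r (x 0 j) * cutoff r (x 0 k)))).

Definition bump_map (x : V) : V := \row_a bump_fun a x.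

Hypothesis r_gt0 : 0 < r.
Let r_neq0 : r != 0. Proof. by rewrite gt_eqF. Qed.

Let c i (x : V) := cutoff r (x 0 i).
Let cj i : jet2 (c i) 0 (fun k => (k == i)%:R) (fun _ _ => 0) :=
  jet2_cutoff r_neq0 (jet2_coord R i).
Let sc i : smoothR (c i). Proof. by case: (cj i). Qed.

Let bumpj a := jet2D
  (jet2Z 2^-1 (jet2_sum (index_enum _) predT (fun i => jet2_sum (index_enum _) predT
     (fun j => jet2Z (S a i j) (jet2M (cj i) (cj j))))))
  (jet2Z 6^-1 (jet2_sum (index_enum _) predT (fun i => jet2_sum (index_enum _) predT
     (fun j => jet2_sum (index_enum _) predT (fun k =>
        jet2Z (T a i j k) (jet2M (cj i) (jet2M (cj j) (cj k)))))))).

Lemma bump_smoothR a : smoothR (bump_fun a).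
Proof. by case: (bumpj a). Qed.

Lemma bump_smooth : smooth_on setT bump_map.
Proof.
move=> k; apply: Ck_mx => [|i a]; first exact: openT.
by apply: (Ck_ext openT (bump_smoothR a k)) => x _; rewrite mxE.
Qed.

(** [B] may stay anonymous: the model fields composed with the map do not see it at the order
    required, and second derivatives of the map enter through [bump_jacobian_jet]. *)
Lemma bump_chart_jet a : exists B,
  jet2 (fun x => (x + bump_map x) 0 a) 0 (fun k => (1%:M : 'M[R]_n) k a) B.
Proof.
eexists; have -> : (fun x => (x + bump_map x) 0 a) = (fun x => x 0 a + bump_fun a x).
  by apply/funext => x; rewrite !mxE.
apply: (jet2_eq (jet2D (jet2_coord R a) (bumpj a))).
- rewrite big1 ?big1 ?mulr0 ?addr0 // => i _.
    by rewrite big1 // => j _; rewrite big1 // => k _; rewrite !(mulr0, mul0r).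
  by rewrite big1 // => j _; rewrite !(mulr0, mul0r).
- move=> p; rewrite big1 ?big1 ?mulr0 ?addr0 ?mxE // => i _.
    by rewrite big1 // => j _; rewrite big1 // => k _; rewrite !(mulr0, mul0r, addr0).
  by rewrite big1 // => j _; rewrite !(mulr0, mul0r, addr0).
- by move=> p q.
Qed.

Let u p i := pd p (c i).
Let uj p i : jet2 (u p i) (p == i)%:R (fun=> 0) (fun k l => pd l (pd k (u p i)) 0).
Proof.
have [_ _ c1 c2] := cj i; split=> [||k|//]; first exact: smoothR_pd.
  exact: c1.
exact: c2.
Qed.

Let pdZ k (t : R) f : smoothR f -> pd k (fun x : V => t * f x) = (fun x => t * pd k f x).
Proof.
move=> sf; rewrite pd_mul //; last exact: smoothR_cst.
by apply/funext => x; rewrite pd_cst mul0r add0r.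
Qed.

Let sZ (t : R) f : smoothR f -> smoothR (fun x : V => t * f x).
Proof. by move=> sf; apply: smoothRM => //; exact: smoothR_cst. Qed.

Let pd_bump p a : pd p (bump_fun a) = (fun x =>
  2^-1 * (\sum_i \sum_j S a i j * (u p i x * c j x + c i x * u p j x)) +
  6^-1 * (\sum_i \sum_j \sum_k T a i j k * (u p i x * (c j x * c k x) +
     c i x * (u p j x * c k x + c j x * u p k x)))).
Proof.
have s2 i j : smoothR (fun x => c i x * c j x) by exact: smoothRM (sc i) (sc j).
have s3 i j k : smoothR (fun x => c i x * (c j x * c k x)) by exact: smoothRM (sc i) (s2 j k).
have sS i : smoothR (fun x => \sum_j S a i j * (c i x * c j x)).
  by apply: smoothR_sum => j; apply: sZ.
have sT' i j : smoothR (fun x => \sum_k T a i j k * (c i x * (c j x * c k x))).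
  by apply: smoothR_sum => k; apply: sZ.
have sT i : smoothR (fun x => \sum_j \sum_k T a i j k * (c i x * (c j x * c k x))).
  by apply: smoothR_sum => j.
rewrite [LHS]pd_add; [|by apply: sZ; apply: smoothR_sum => i..].
apply/funext => x; rewrite !pdZ; [|by apply: smoothR_sum => i..].
congr (_ * _ + _ * _); rewrite pd_sum //; apply: eq_bigr => i _.
  rewrite pd_sum; last by move=> j; exact: sZ (s2 i j).
  by apply: eq_bigr => j _; rewrite (pdZ _ _ (s2 i j)) (pd_mul _ (sc i) (sc j)).
rewrite pd_sum //; apply: eq_bigr => j _.
rewrite pd_sum; last by move=> k; exact: sZ (s3 i j k).
by apply: eq_bigr => k _; rewrite (pdZ _ _ (s3 i j k)) (pd_mul _ (sc i) (s2 j k)) (pd_mul _ (sc j) (sc k)).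
Qed.

Let dl1 p (F : 'I_n -> R) : \sum_i F i * (p == i)%:R = F p.
Proof. by rewrite -[RHS](sum_delta_l F); apply: eq_bigr => i _; rewrite mulrC. Qed.

Let dl2 p q (F : 'I_n -> 'I_n -> R) :
  \sum_i \sum_j F i j * ((p == i)%:R * (q == j)%:R) = F p q.
Proof.
rewrite -(dl1 p (fun i => F i q)); apply: eq_bigr => i _.
by rewrite -(dl1 q (F i)) mulr_suml; apply: eq_bigr => j _; ring.
Qed.

Let dl3 p q t (F : 'I_n -> 'I_n -> 'I_n -> R) :
  \sum_i \sum_j \sum_k F i j k * ((p == i)%:R * ((q == j)%:R * (t == k)%:R)) = F p q t.
Proof.
rewrite -(dl1 p (fun i => F i q t)); apply: eq_bigr => i _.
rewrite -(dl2 q t (F i)) mulr_suml; apply: eq_bigr => j _.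
by rewrite mulr_suml; apply: eq_bigr => k _; ring.
Qed.

Lemma bump_jacobian_jet :
  jet2mx (fun y => 'J (fun x => x + bump_map x) y) 1%:M
    (fun p => \matrix_(i, a) S a i p) (fun p q => \matrix_(i, a) T a i p q).
Proof.
move=> i a.
have ds y : differentiable (fun x => x + bump_map x) y.
  by apply: differentiableD => //; exact: (bump_smooth 1%N).1.
have E : (fun y => 'J (fun x => x + bump_map x) y i a) = (fun y => (i == a)%:R + pd i (bump_fun a) y).
  apply/funext => y; rewrite jacobian_entry //.
  have -> : (fun x => (x + bump_map x) 0 a) = (fun x => x 0 a + bump_fun a x).
    by apply/funext => x; rewrite !mxE.
  by rewrite pd_add ?pd_coord //; [exact: smoothR_coord|exact: bump_smoothR].
(* The second derivatives of [u p i], third derivatives of a cutoff, need no value: they only occur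
   multiplied by a cutoff that vanishes at the origin. *)
have [h hj] : exists h, forall p i, jet2 (u p i) (p == i)%:R (fun=> 0) (h p i).
  by exists (fun p i k l => pd l (pd k (u p i)) 0); exact: uj.
rewrite E pd_bump.
apply: (jet2_eq (jet2D (jet2_cst _ _) (jet2D
  (jet2Z 2^-1 (jet2_sum _ _ (fun j => jet2_sum _ _ (fun k => jet2Z (S a j k)
     (jet2D (jet2M (hj i j) (cj k)) (jet2M (cj j) (hj i k)))))))
  (jet2Z 6^-1 (jet2_sum _ _ (fun j => jet2_sum _ _ (fun k => jet2_sum _ _ (fun l =>
     jet2Z (T a j k l) (jet2D (jet2M (hj i j) (jet2M (cj k) (cj l)))
        (jet2M (cj j) (jet2D (jet2M (hj i k) (cj l)) (jet2M (cj k) (hj i l))))))))))))).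
- rewrite [X in _ + (_ * X + _)]big1 => [|j _]; last by rewrite big1 // => k _; ring.
  rewrite [X in _ + (_ + _ * X)]big1 => [|j _]; last first.
    by rewrite big1 // => k _; rewrite big1 // => l _; ring.
  by rewrite mxE !mulr0 !addr0.
- move=> p; rewrite mxE add0r [X in _ + _ * X]big1 => [|j _]; last first.
    by rewrite big1 // => k _; rewrite big1 // => l _; ring.
  rewrite [6^-1 * 0]mulr0 addr0.
  transitivity (2^-1 * (\sum_j \sum_k S a j k * ((i == j)%:R * (p == k)%:R) +
      \sum_j \sum_k S a j k * ((p == j)%:R * (i == k)%:R))).
    congr (_ * _); rewrite -big_split; apply: eq_bigr => j _; rewrite -big_split.
    by apply: eq_bigr => k _ /=; ring.
  by rewrite !dl2 (S_sym a p i); field.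
move=> p q; rewrite mxE add0r [X in _ * X + _]big1 => [|j _]; last first.
  by rewrite big1 // => k _; ring.
rewrite [2^-1 * 0]mulr0 add0r.
(* Leibniz's rule produces the six orderings of i, p, q, which the symmetry of [T] identifies. *)
transitivity (6^-1 * (
  \sum_j \sum_k \sum_l T a j k l * ((i == j)%:R * ((p == k)%:R * (q == l)%:R)) +
  \sum_j \sum_k \sum_l T a j k l * ((i == j)%:R * ((q == k)%:R * (p == l)%:R)) +
  \sum_j \sum_k \sum_l T a j k l * ((p == j)%:R * ((i == k)%:R * (q == l)%:R)) +
  \sum_j \sum_k \sum_l T a j k l * ((p == j)%:R * ((q == k)%:R * (i == l)%:R)) +
  \sum_j \sum_k \sum_l T a j k l * ((q == j)%:R * ((i == k)%:R * (p == l)%:R)) +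
  \sum_j \sum_k \sum_l T a j k l * ((q == j)%:R * ((p == k)%:R * (i == l)%:R)))).
  congr (_ * _); rewrite -!big_split; apply: eq_bigr => j _; rewrite -!big_split.
  apply: eq_bigr => k _; rewrite -!big_split; apply: eq_bigr => l _ /=.
  by ring.
rewrite !dl3 (T_sym2 a i q p) (T_sym1 a p i q) (T_sym2 a p q i) (T_sym1 a p i q).
rewrite (T_sym1 a q i p) (T_sym2 a i q p) (T_sym2 a q p i) (T_sym1 a q i p) (T_sym2 a i q p).
by field.
Qed.

Definition bump_const : R := \sum_a (\sum_i \sum_j `|S a i j| +
  \sum_i \sum_j \sum_k `|T a i j k|).

Lemma bump_const_ge0 : 0 <= bump_const.
Proof.
apply: sumr_ge0 => a _; apply: addr_ge0.
  by apply: sumr_ge0 => i _; apply: sumr_ge0.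
by apply: sumr_ge0 => i _; apply: sumr_ge0 => j _; apply: sumr_ge0.
Qed.

Let cB i x : `|c i x| <= r. Proof. exact/cutoff_bound/ltW. Qed.

Let cL i x y : `|c i x - c i y| <= `|x - y|.
Proof.
apply: (le_trans (cutoff_lipschitz _ _ r_gt0)).
by have := norm_entry (x - y) i; rewrite !mxE.
Qed.

Let mulL (f g : V -> R) (Bf Bg Kf Kg : R) x y : `|f x| <= Bf -> `|g y| <= Bg ->
  `|f x - f y| <= Kf * `|x - y| -> `|g x - g y| <= Kg * `|x - y| ->
  `|f x * g x - f y * g y| <= (Bf * Kg + Kf * Bg) * `|x - y|.
Proof.
move=> fB gB fK gK.
have -> : f x * g x - f y * g y = f x * (g x - g y) + (f x - f y) * g y by ring.
rewrite [leRHS]mulrDl (le_trans (ler_normD _ _)) // !normrM lerD //.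
  by rewrite -mulrA ler_pM.
by rewrite mulrAC ler_pM.
Qed.

Let sumL (I : finType) (F G M : I -> R) : (forall i, `|F i - G i| <= M i) ->
  `|\sum_i F i - \sum_i G i| <= \sum_i M i.
Proof.
by move=> H; rewrite -sumrB (le_trans (ler_norm_sum _ _ _)) //; exact: ler_sum.
Qed.

Let comb (A A' B B' K L t z : R) : `|A - A'| <= K * (2 * t * z) ->
  `|B - B'| <= L * (6 * t * z) ->
  `|2^-1 * A + 6^-1 * B - (2^-1 * A' + 6^-1 * B')| <= (K + L) * (t * z).
Proof.
move=> HA HB.
have -> : 2^-1 * A + 6^-1 * B - (2^-1 * A' + 6^-1 * B') =
  2^-1 * (A - A') + 6^-1 * (B - B') by ring.
rewrite (le_trans (ler_normD _ _)) // !normrM.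
have h2 : `|2^-1| = 2^-1 :> R by rewrite ger0_norm // invr_ge0.
have h6 : `|6^-1| = 6^-1 :> R by rewrite ger0_norm // invr_ge0.
rewrite h2 h6.
have eK : K * (2 * t * z) = 2 * (K * (t * z)) by ring.
have eL : L * (6 * t * z) = 6 * (L * (t * z)) by ring.
rewrite mulrDl; rewrite eK in HA; rewrite eL in HB.
move: (K * (t * z)) (L * (t * z)) HA HB => p q; lra.
Qed.

(** Each term contains at least two cutoffs, bounded by r and 1-Lipschitz, so the Lipschitz constant
    is O(r) and can be made smaller than 1/2. *)
Lemma bump_lipschitz x y : r <= 1 ->
  `|bump_map x - bump_map y| <= r * bump_const * `|x - y|.
Proof.
move=> r1; have xy0 : 0 <= `|x - y| by [].
have c2B i j z : `|c i z * c j z| <= r.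
  rewrite normrM; apply: le_trans (ler_pM _ _ (cB i z) (cB j z)) _ => //.
  by rewrite ler_piMr // ltW.
have c2L i j : `|c i x * c j x - c i y * c j y| <= (2 * r) * `|x - y|.
  have -> : 2 * r = r * 1 + 1 * r by ring.
  by apply: (@mulL (c i) (c j)); rewrite ?mul1r.
(* A generous bound; 6 is chosen to cancel the 1/6 of [bump_fun]. *)
have c3L i j k : `|c i x * (c j x * c k x) - c i y * (c j y * c k y)| <= (6 * r) * `|x - y|.
  apply: (@le_trans _ _ ((r * (2 * r) + 1 * r) * `|x - y|)).
    by apply: (@mulL (c i) (fun x => c j x * c k x)); rewrite ?mul1r.
  rewrite ler_wpM2r //; have : r * r <= r by rewrite ler_piMr // ltW.
  by move: r_gt0; lra.
have xyr : 0 <= r * `|x - y| by rewrite mulr_ge0 // ltW.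
apply: norm_row_le => [|a]; first by rewrite !mulr_ge0 ?bump_const_ge0 // ltW.
have HS : `|\sum_i \sum_j S a i j * (c i x * c j x) -
    \sum_i \sum_j S a i j * (c i y * c j y)| <=
    \sum_i \sum_j `|S a i j| * (2 * r * `|x - y|).
  apply: sumL => i; apply: sumL => j.
  by rewrite -mulrBr normrM ler_wpM2l.
have HT : `|\sum_i \sum_j \sum_k T a i j k * (c i x * (c j x * c k x)) -
    \sum_i \sum_j \sum_k T a i j k * (c i y * (c j y * c k y))| <=
    \sum_i \sum_j \sum_k `|T a i j k| * (6 * r * `|x - y|).
  apply: sumL => i; apply: sumL => j; apply: sumL => k.
  by rewrite -mulrBr normrM ler_wpM2l.
have HSE : \sum_i \sum_j `|S a i j| * (2 * r * `|x - y|) =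
    (\sum_i \sum_j `|S a i j|) * (2 * r * `|x - y|).
  by rewrite mulr_suml; apply: eq_bigr => i _; rewrite mulr_suml.
have HTE : \sum_i \sum_j \sum_k `|T a i j k| * (6 * r * `|x - y|) =
    (\sum_i \sum_j \sum_k `|T a i j k|) * (6 * r * `|x - y|).
  rewrite mulr_suml; apply: eq_bigr => i _; rewrite mulr_suml.
  by apply: eq_bigr => j _; rewrite mulr_suml.
rewrite HSE in HS; rewrite HTE in HT.
have K : \sum_i \sum_j `|S a i j| + \sum_i \sum_j \sum_k `|T a i j k| <= bump_const.
  rewrite /bump_const [leRHS](bigD1 a) //= lerDl; apply: sumr_ge0 => a' _; apply: addr_ge0.
    by apply: sumr_ge0 => i _; apply: sumr_ge0.
  by apply: sumr_ge0 => i _; apply: sumr_ge0 => j _; apply: sumr_ge0.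
have := ler_wpM2r xyr K; rewrite [r * bump_const]mulrC -mulrA; apply: le_trans.
rewrite !mxE /bump_fun.
apply: (@comb _ _ _ _ _ _ _ _ HS HT).
Qed.

End Diffeo.
End ModelCharts.

(** * Invariance of L under the jet group *)

Section Invariance.
Variables (R : realType) (n m : nat) (L : Yspace R n m -> R).
Local Notation V := 'rV[R]_n.
Hypothesis L_inv : forall (M : manifold R n) (g : lorentz_metric M)
  (D : tensor_field M m), exists f : M -> R, represents L g D f.
Implicit Types (w : 'M[R]_n) (b : 'I_n -> 'I_n -> 'I_n -> 'I_n -> R)
  (d : m.-tuple 'I_n -> R) (e : m.-tuple 'I_n -> 'I_n -> R).

Definition sym_pairs b :=
  (forall i j k l, b i j k l = b j i k l) /\ (forall i j k l, b i j k l = b i j l k).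

Lemma lorentzian_unit w : lorentzian w -> w \in unitmx.
Proof.
move=> [_ [P uP E]]; have : Defs.minkowski R n \in unitmx.
  rewrite unitmxE unitfE det_diag; apply/prodf_neq0 => i _; rewrite mxE.
  by case: ifP => _; rewrite ?oppr_eq0 oner_neq0.
by rewrite -E !unitmx_mul => /andP[/andP[]].
Qed.

Lemma idm_jet a : jet2 (fun y : V => y 0 a) 0 (fun k => (1%:M : 'M[R]_n) k a) (fun _ _ => 0).
Proof. by apply: (jet2_eq (jet2_coord R a)) => // k; rewrite mxE. Qed.

(** Vanishing first derivatives of the metric suffice, since all others arise from these by the
    quadratic part of a coordinate change. *)
Lemma model_jet w b d e r : lorentzian w -> sym_pairs b -> r != 0 ->
  jet (model_metric w b r) (model_tensor d e r) 0 = mkY w (fun _ _ _ => 0) b d e.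
Proof.
move=> lw [b1 b2] r0; have uw := lorentzian_unit lw.
have Gj := model_metric_jet lw.1 uw b1 b2 r0 idm_jet.
rewrite jetE; congr (mkY _ _ _ _ _).
- by apply/matrixP => i j; have [_ -> _ _] := Gj i j.
- apply/funext => i; apply/funext => j; apply/funext => k.
  by have [_ _ -> _] := Gj i j; rewrite mxE.
- apply/funext => i; apply/funext => j; apply/funext => k; apply/funext => l.
  have [_ _ _ ->] := Gj i j; rewrite summxE (bigD1 k) //= [X in _ + X]big1 => [|k' kk'].
    rewrite addr0 summxE (bigD1 l) //= [X in _ + X]big1 => [|l' ll'].
      by rewrite addr0 !mxE !eqxx !mul1r.
    by rewrite !mxE (eq_sym l) (negbTE ll') mulr0 mul0r.
  by rewrite summxE big1 // => l' _; rewrite !mxE (eq_sym k) (negbTE kk') !mul0r.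
- rewrite tcoK; apply/funext => I; rewrite big1 ?addr0 // => c _.
  by rewrite /cutoff mxE mulr0 sin0 !mulr0.
- apply/funext => I; apply/funext => j.
  have Dj := jet2D (jet2_cst _ (d I)) (jet2_sum (index_enum _) predT
    (fun c => jet2Z (e I c) (jet2_cutoff r0 (jet2_coord R c)))).
  have -> : (fun y : V => tco (model_tensor d e r y) I) =
    (fun y => d I + \sum_c e I c * cutoff r (y 0 c)).
    by apply/funext => y; rewrite /model_tensor tcoK.
  have [_ _ -> _] := Dj; rewrite add0r -[RHS](sum_delta_l (e I)).
  by apply: eq_bigr => c _; rewrite mulrC.
Qed.

(** The common source of [GL_invariance], where C = T = 0, and of [ST_invariance], where A = 1. *)
Lemma model_invariance w b d e r (s t : V -> V) (A : 'M[R]_n) B C T :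
  lorentzian w -> sym_pairs b -> 0 < r ->
  (forall x, model_frame w b r x \in unitmx) ->
  cancel s t -> cancel t s -> smooth_on setT s -> smooth_on setT t ->
  (forall a, jet2 (fun y => s y 0 a) 0 (fun k => A k a) (B a)) ->
  jet2mx (fun y => 'J s y) A C T ->
  L (mkY w (fun _ _ _ => 0) b d e) =
  L (mkY (A *m w *m A^T) (fun i j k => (C k *m w *m A^T + A *m w *m (C k)^T) i j)
      (fun i j k l => (T k l *m w *m A^T + A *m w *m (T k l)^T +
        (C k *m w *m (C l)^T + C l *m w *m (C k)^T) +
        \sum_k' \sum_l' (A k k' * A l l') *: (A *m b_mx b k' l' *m A^T)) i j)
      (tens_change A^T d)
      (fun I k => \sum_(J : m.-tuple 'I_n)
        ((\sum_c e J c * A k c) * \prod_(t < m) A (tnth I t) (tnth J t) +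
        d J * \sum_(u < m) C k (tnth I u) (tnth J u) *
           \prod_(t < m | t != u) A (tnth I t) (tnth J t)))).
Proof.
move=> lw sb r0 uN st ts ss st' sj Jj; have rn0 : r != 0 by rewrite gt_eqF.
have uw := lorentzian_unit lw; have [b1 b2] := sb.
have s0 : s 0 = 0 by apply/rowP => a; rewrite [RHS]mxE; have [_ -> _ _] := sj a.
have sG : smooth_on setT (model_metric w b r).
  move=> k; apply: Ck_mx => [|i j]; first exact: openT.
  have [H _ _ _] := model_metric_jet lw.1 uw b1 b2 rn0 idm_jet i j; exact: H.
have sD : smooth_on setT (model_tensor d e r).
  move=> k; apply: Ck_mx => [|i j]; first exact: openT.
  have H : smoothR (fun y : V => d (enum_val j) + \sum_c e (enum_val j) c * cutoff r (y 0 c)).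
    apply: smoothRD; first exact: smoothR_cst.
    apply: smoothR_sum => c; apply: smoothRM; first exact: smoothR_cst.
    by apply: smoothR_cutoff; exact: smoothR_coord.
  by apply: (Ck_ext openT (H k)) => x _; rewrite mxE.
have lG x : lorentzian (model_metric w b r x) by exact: lorentzian_congr.
rewrite -(model_jet d e lw sb rn0) -{1}s0.
rewrite (jet_diffeo_invariant L_inv 0 sG sD lG st ts ss st') jetE.
have Gj := model_pullback_metric lw.1 uw b1 b2 rn0 sj Jj.
have Dj I := model_pullback_tensor d e rn0 I sj Jj.
congr (L (mkY _ _ _ _ _)).
- by apply/matrixP => i j; have [_ H _ _] := Gj i j; exact: H.
- apply/funext => i; apply/funext => j; apply/funext => k.
  by have [_ _ H _] := Gj i j; exact: H.
- apply/funext => i; apply/funext => j; apply/funext => k; apply/funext => l.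
  by have [_ _ _ H] := Gj i j; exact: H.
- by apply/funext => I; have [H _] := Dj I; exact: H.
- by apply/funext => I; apply/funext => k; have [_ H] := Dj I; exact: H.
Qed.

Lemma GL_invariance w b d e (A : 'M[R]_n) : lorentzian w -> sym_pairs b ->
  A \in unitmx ->
  L (mkY w (fun _ _ _ => 0) b d e) =
  L (mkY (A *m w *m A^T) (fun _ _ _ => 0)
      (fun i j k l => \sum_k' \sum_l' (A k k' * A l l') * (A *m b_mx b k' l' *m A^T) i j)
      (tens_change A^T d)
      (fun I k => \sum_(J : m.-tuple 'I_n)
        (\sum_c e J c * A k c) * \prod_(t < m) A (tnth I t) (tnth J t))).
Proof.
move=> lw sb uA; have [r0 r00 H] := model_frame_unit w b.
pose s : {linear V -> V} := mulmxr A; pose t : {linear V -> V} := mulmxr (invmx A).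
have lin_smooth (l : {linear V -> V}) : smooth_on setT l.
  move=> k; have := Ck_linear_comp openT (@mx_linear_continuous _ _ _ _ l) (Ck_id k openT).
  by [].
have sj a : jet2 (fun y => s y 0 a) 0 (fun k => A k a) (fun _ _ => 0).
  have -> : (fun y => s y 0 a) = (fun y => \sum_k A k a * y 0 k).
    by apply/funext => y; rewrite /s /= mxE; apply: eq_bigr => k _; rewrite mulrC.
  apply: (jet2_eq (jet2_sum _ _ (fun k => jet2Z (A k a) (jet2_coord R k)))).
  - by rewrite big1 // => k _; rewrite mulr0.
  - move=> k; rewrite -[RHS](sum_delta_l (fun k => A k a)); apply: eq_bigr => c _.
    by rewrite mulrC.
  - by move=> k l; rewrite big1 // => c _; rewrite mulr0.
have Jj : jet2mx (fun y => 'J s y) A (fun=> 0) (fun _ _ => 0).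
  have -> : (fun y => 'J s y) = (fun=> A).
    apply/funext => y; apply/matrixP => i a.
    rewrite jacobian_entry; last by case: (lin_smooth s 1%N) => + _; apply.
    have -> : (fun y => s y 0 a) = (fun y => \sum_k A k a * y 0 k).
      by apply/funext => z; rewrite /s /= mxE; apply: eq_bigr => k _; rewrite mulrC.
    rewrite pd_sum => [|k]; last by apply: smoothRM; [exact: smoothR_cst|exact: smoothR_coord].
    rewrite -[RHS](sum_delta_l (fun k => A k a)); apply: eq_bigr => k _.
    rewrite pd_mul; [|exact: smoothR_cst|exact: smoothR_coord].
    by rewrite pd_cst pd_coord mul0r add0r mulrC.
  exact: jet2mx_cst.
have st : cancel s t by move=> x; rewrite /s /t /= mulmxK.
have ts : cancel t s by move=> x; rewrite /s /t /= mulmxKV.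
rewrite (model_invariance d e lw sb r00 (H _ r00 (lexx _)) st ts (lin_smooth s) (lin_smooth t) sj Jj).
congr (L (mkY _ _ _ _ _)).
- apply/funext => i; apply/funext => j; apply/funext => k.
  by rewrite trmx0 mulmx0 !mul0mx addr0 mxE.
- apply/funext => i; apply/funext => j; apply/funext => k; apply/funext => l.
  rewrite trmx0 !mulmx0 !mul0mx !addr0 add0r summxE; apply: eq_bigr => k' _.
  by rewrite summxE; apply: eq_bigr => l' _; rewrite mxE.
- apply/funext => I; apply/funext => k; apply: eq_bigr => J _.
  by rewrite [X in _ + _ * X]big1 ?mulr0 ?addr0 // => u _; rewrite mxE mul0r.
Qed.

Lemma ST_invariance w b d e (S : 'I_n -> 'I_n -> 'I_n -> R)
    (T : 'I_n -> 'I_n -> 'I_n -> 'I_n -> R) : lorentzian w -> sym_pairs b ->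
  (forall a i j, S a i j = S a j i) -> (forall a i j k, T a i j k = T a j i k) ->
  (forall a i j k, T a i j k = T a i k j) ->
  L (mkY w (fun _ _ _ => 0) b d e) =
  L (mkY w (fun i j k => \sum_a (S a i k * w a j + w i a * S a j k))
      (fun i j k l => b i j k l + \sum_a (T a i k l * w a j + w i a * T a j k l) +
         \sum_a \sum_c (S a i k * w a c * S c j l + S a i l * w a c * S c j k))
      d
      (fun I k => e I k + \sum_(u < m) \sum_a S a (tnth I u) k * d (upd I u a))).
Proof.
move=> lw sb S1 T1 T2; have [r0 r00 H] := model_frame_unit w b.
have C0 := bump_const_ge0 S T.
(* The first bound keeps the frame invertible, the second makes the bump map Lipschitz with constant
   1/2. *)
pose r := Num.min r0 (2 * (1 + bump_const S T))^-1.
have D0 : 0 < 2 * (1 + bump_const S T) by rewrite mulr_gt0 // ltr_pwDl.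
have r_gt0 : 0 < r by rewrite lt_min r00 invr_gt0.
have rr0 : r <= r0 by rewrite ge_min lexx.
have rD : r * (2 * (1 + bump_const S T)) <= 1.
  by rewrite -ler_pdivlMr // div1r ge_min lexx orbT.
have r1 : r <= 1.
  by have : 0 <= r * bump_const S T := mulr_ge0 (ltW r_gt0) C0; lra.
have hL (x y : V) : `|bump_map S T r x - bump_map S T r y| <= 2^-1 * `|x - y|.
  apply: le_trans (bump_lipschitz S T r_gt0 x y r1) _; rewrite ler_wpM2r //.
  by move: rD r_gt0; lra.
have [t [st ts stt _]] := perturbation_diffeo (bump_smooth S T r_gt0) hL.
have ss : smooth_on setT (fun x => x + bump_map S T r x).
  by move=> k; apply: CkD; [exact: openT|apply: Ck_id; exact: openT|exact: bump_smooth].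
pose B a := projT1 (cid (bump_chart_jet S T r_gt0 a)).
have sj a := projT2 (cid (bump_chart_jet S T r_gt0 a)).
have Jj := bump_jacobian_jet S1 T1 T2 r_gt0.
rewrite (@model_invariance w b d e r _ t 1%:M B _ _ lw sb r_gt0 (H _ r_gt0 rr0) st ts ss stt sj Jj).
congr (L (mkY _ _ _ _ _)).
- by rewrite trmx1 mul1mx mulmx1.
- apply/funext => i; apply/funext => j; apply/funext => k.
  rewrite trmx1 mul1mx mulmx1 !mxE -big_split; apply: eq_bigr => a _.
  by rewrite !mxE.
- apply/funext => i; apply/funext => j; apply/funext => k; apply/funext => l.
  rewrite trmx1 !mul1mx !mulmx1 [LHS]mxE [X in _ + X]summxE.
  rewrite (bigD1 k) //= [X in _ + (_ + X)]big1 => [|k' kk']; last first.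
    by rewrite summxE big1 // => l' _; rewrite !mxE (eq_sym k) (negbTE kk') !mul0r.
  rewrite summxE (bigD1 l) //= [X in _ + (_ + X + _)]big1 => [|l' ll']; last first.
    by rewrite !mxE (eq_sym l) (negbTE ll') mulr0 mul0r.
  rewrite !addr0 mul1mx mulmx1 addrC -[RHS]addrA; congr (_ + _).
    by rewrite !mxE !eqxx !mul1r.
  rewrite !mxE; congr (_ + _).
    by rewrite -big_split; apply: eq_bigr => a _; rewrite !mxE.
  rewrite -big_split exchange_big; apply: eq_bigr => c _ /=.
  rewrite !mxE !mulr_suml -big_split; apply: eq_bigr => a _.
  by rewrite !mxE.
- by rewrite trmx1 tens_change1.
- apply/funext => I; apply/funext => k; rewrite big_split /=; congr (_ + _).
    have := congr1 (fun h => h I) (tens_change1 (fun J => e J k)).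
    rewrite /tens_change => <-; apply: eq_bigr => J _; congr (_ * _).
      rewrite -[RHS](sum_delta_l (e J)); apply: eq_bigr => c _.
      by rewrite mxE mulrC.
    by apply: eq_bigr => u _; rewrite !mxE eq_sym.
  under eq_bigr => J _ do rewrite mulr_sumr.
  rewrite exchange_big; apply: eq_bigr => u _.
  have := sum_upd (fun J => S (tnth J u) (tnth I u) k * d J) I u.
  under [in RHS]eq_bigr do rewrite tnth_upd eqxx.
  move=> <-; apply: eq_bigr => J _; rewrite mxE mulrA (mulrC (d J)) -mulrA -mulrA.
  congr (_ * (_ * _)); apply: eq_bigr => t' _; by rewrite mxE.
Qed.

End Invariance.

(** * The quadratic expansion of L *)

Section Taylor.
Variables (R : realType) (V : normedModType R).

(** With zero third derivative along the line, f is exactly quadratic there: subtracting the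
    primitive at each order leaves a function of derivative 0. *)
Lemma taylor2 (U : set V) (f : V -> R) (y u : V) : Ck_on 3 U f ->
  (forall t : R, U (y + t *: u)) ->
  (forall t : R, 'D_u (fun z => 'D_u (fun z => 'D_u f z) z) (y + t *: u) = 0) ->
  f (y + u) = f y + 'D_u f y + 2^-1 * 'D_u (fun z => 'D_u f z) y.
Proof.
move=> [d0 D0] Uy Z; have [d1 D1] := D0 u; have [d2 _] := D1 u.
pose g0 (t : R) := f (y + t *: u); pose g1 (t : R) := 'D_u f (y + t *: u).
pose g2 (t : R) := 'D_u (fun z => 'D_u f z) (y + t *: u).
have g0' t : is_derive t (1 : R) g0 (g1 t) by apply: line_derive; exact: d0.
have g1' t : is_derive t (1 : R) g1 (g2 t) by apply: line_derive; exact: d1.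
have g2' t : is_derive t (1 : R) g2 0 by rewrite -(Z t); apply: line_derive; exact: d2.
have c2 t : g2 t = g2 0 by apply: is_derive_0_is_cst.
have id' (t : R) : is_derive t (1 : R) (id : R -> R) 1 by exact: is_derive_id.
have c1 t : g1 t = g1 0 + g2 0 * t.
  have H s : is_derive s (1 : R) (fun s => g1 s - g2 0 * s) 0.
    have K := is_deriveB (g1' s) (is_deriveZ (g2 0) (id' s)).
    by apply: (is_derive_eq K); rewrite c2 /GRing.scale /= mulr1 subrr.
  by have := is_derive_0_is_cst t 0 H; rewrite mulr0 subr0 => <-; rewrite subrK.
have H s : is_derive s (1 : R) (fun s => g0 s - g1 0 * s - 2^-1 * g2 0 * (s * s)) 0.
  have K := is_deriveB (is_deriveB (g0' s) (is_deriveZ (g1 0) (id' s)))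
     (is_deriveZ (2^-1 * g2 0) (is_deriveM (id' s) (id' s))).
  by apply: (is_derive_eq K); rewrite c1 /GRing.scale /= !mulr1; field.
have := is_derive_0_is_cst 1 0 H.
rewrite /= !mulr0 !subr0 !mulr1 /g0 /g1 /g2 scale1r scale0r addr0 => <-.
by ring.
Qed.

End Taylor.

Section Expansion.
Variables (R : realType) (n m : nat) (L : Yspace R n m -> R).
Hypothesis L_smooth : smooth_on (@Ydom R n m) L.
Hypothesis L_deg2 : forall u v w : Yspace R n m,
  wmx u = 0 -> wmx v = 0 -> wmx w = 0 ->
  forall y, Ydom y ->
    'D_u (fun y1 => 'D_v (fun y2 => 'D_w L y2) y1) y = 0.

Lemma Ydom_open : open (@Ydom R n m).
Proof.
have dc : continuous (fun y : Yspace R n m => \det (wmx y)).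
  have sd : smooth_on setT (fun A : 'M[R]_n => \det A).
    by move=> k; apply: Ck_det; [exact: openT|apply: Ck_id; exact: openT].
  have wc : continuous (@wmx R n m).
    move=> y; rewrite /wmx.
    apply: (@continuous_comp _ _ _ (fun y => y.1.1.1) (fun y => y.1)); last exact: cvg_fst.
    apply: (@continuous_comp _ _ _ (fun y => y.1.1) (fun y => y.1)); last exact: cvg_fst.
    by apply: (@continuous_comp _ _ _ (fun y => y.1) (fun y => y.1)); exact: cvg_fst.
  move=> y; apply: (@continuous_comp _ _ _ (@wmx R n m) (fun A : 'M[R]_n => \det A)).
    exact: wc.
  exact: (sd 0%N).
have -> : @Ydom R n m = (fun y => \det (wmx y)) @^-1` [set x | x != 0].
  by apply/seteqP; split.
apply: open_comp; last exact: open_neq.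
by move=> y _; exact: dc.
Qed.

(** The expansion along directions that keep the metric fixed. The form [bil] plays the role of half
    the second derivative, so no factor 1/2 appears later. *)
Definition quadratic_at (y0 : Yspace R n m) (lin : Yspace R n m -> R)
    (bil : Yspace R n m -> Yspace R n m -> R) :=
  [/\ forall c u v, lin (c *: u + v) = c * lin u + lin v,
      forall c u v z, bil (c *: u + v) z = c * bil u z + bil v z,
      forall u v, bil u v = bil v u &
      forall u, wmx u = 0 -> L (y0 + u) = L y0 + lin u + bil u u].

Lemma quadratic_expansion y0 : Ydom y0 -> exists lin bil, quadratic_at y0 lin bil.
Proof.
move=> y0D; have [d0 D0] := L_smooth 2.
pose lin u := 'D_u L y0; pose h u v := 'D_u (fun y => 'D_v L y) y0.
have linE y (c : R) u v : Ydom y -> 'D_(c *: u + v) L y = c * 'D_u L y + 'D_v L y.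
  by move=> Yy; rewrite !deriveE ?linearP //; exact: d0.
have d1 v : differentiable (fun y => 'D_v L y) y0 by have [+ _] := D0 v; apply.
have hl (c : R) u v z : h (c *: u + v) z = c * h u z + h v z.
  by rewrite /h !deriveE ?linearP.
have hr (c : R) u v z : h z (c *: u + v) = c * h z u + h z v.
  rewrite /h; have dc : differentiable (fun y => c * 'D_u L y) y0.
    by apply: differentiableM => //; exact: differentiable_cst.
  rewrite -(deriveZ_fun c z (d1 u)) -(deriveD_fun z dc (d1 v)).
  apply: near_eq_derive; apply: filterS (open_nbhs_nbhs (conj Ydom_open y0D)).
  by move=> y Yy; exact: linE.
have [h' [hl' hr' hE]] : exists h', [/\ forall c u v z, h' (c *: u + v) z = c * h' u z + h' v z,
   forall (c : R) u v z, h' z (c *: u + v) = c * h' z u + h' z v & forall u, h u u = h' u u].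
  by exists h; split; [exact: hl|exact: hr|reflexivity].
(* Symmetrized by hand: 1/4 is the 1/2 of Taylor's formula times the 1/2 of averaging. *)
exists lin, (fun u v => 4^-1 * (h' u v + h' v u)); split.
- by move=> c u v; exact: linE.
- by move=> c u v z; rewrite hl' hr'; ring.
- by move=> u v; rewrite addrC.
move=> u wu; have Yt (t : R) : Ydom (y0 + t *: u).
  rewrite /Ydom /= (_ : wmx (y0 + t *: u) = wmx y0) //.
  by rewrite -[LHS]/(wmx y0 + t *: wmx u) wu scaler0 addr0.
rewrite (taylor2 (L_smooth 3) Yt); last by move=> t; exact: L_deg2.
have := hE u; rewrite /h => ->; congr (_ + _); by field.
Qed.

End Expansion.

(** * Functionals of the second derivatives of the metric *)

Section FourTensors.
Variables (R : realType) (n : nat).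
Local Notation vec := ('I_n -> R).
Local Notation tens4 := ('I_n -> 'I_n -> 'I_n -> 'I_n -> R).
Implicit Types (x y z t : vec) (b : tens4).

Definition linear4 (f : tens4 -> R) := forall c b b',
  f (fun i j k l => c * b i j k l + b' i j k l) = c * f b + f b'.

(** A product of two symmetric squares. By [sprod_decomp] these span the possible second derivatives
    of a metric, so functionals are tested on them. *)
Definition sprod x y z t : tens4 :=
  fun i j k l => (x i * y j + y i * x j) * (z k * t l + t k * z l).

Lemma funext4 b b' : (forall i j k l, b i j k l = b' i j k l) -> b = b'.
Proof.
by move=> H; apply/funext => i; apply/funext => j; apply/funext => k; apply/funext.
Qed.

Section Linear4.
Variable f : tens4 -> R.
Hypothesis fl : linear4 f.

Lemma linear4_0 : f (fun _ _ _ _ => 0) = 0.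
Proof.
have := fl 1 (fun _ _ _ _ => 0) (fun _ _ _ _ => 0).
rewrite (_ : (fun _ _ _ _ => 1 * 0 + 0) = (fun _ _ _ _ => 0)); first by lra.
by apply: funext4 => i j k l; rewrite mulr0 addr0.
Qed.

Lemma linear4D b b' : f (fun i j k l => b i j k l + b' i j k l) = f b + f b'.
Proof.
have := fl 1 b b'; rewrite mul1r => <-; congr (f _).
by apply: funext4 => i j k l; rewrite mul1r.
Qed.

Lemma linear4Z c b : f (fun i j k l => c * b i j k l) = c * f b.
Proof.
have := fl c b (fun _ _ _ _ => 0); rewrite linear4_0 addr0 => <-; congr (f _).
by apply: funext4 => i j k l; rewrite addr0.
Qed.

Lemma linear4_sum (I : Type) (r : seq I) (F : I -> tens4) :
  f (fun i j k l => \sum_(a <- r) F a i j k l) = \sum_(a <- r) f (F a).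
Proof.
elim: r => [|a r IH].
  rewrite (_ : (fun i j k l => _) = (fun _ _ _ _ => 0)) ?linear4_0 ?big_nil //.
  by apply: funext4 => i j k l; rewrite big_nil.
rewrite (_ : (fun i j k l => _) = fun i j k l => F a i j k l + \sum_(a <- r) F a i j k l).
  by rewrite linear4D IH big_cons.
by apply: funext4 => i j k l; rewrite big_cons.
Qed.

Let dl (i : 'I_n) : vec := fun j => (j == i)%:R.

(** Each product of basis vectors picks up [b] at four permuted positions, where its values agree;
    hence 1/4. *)
Lemma sprod_decomp b : sym_pairs b -> b = fun i j k l =>
  \sum_i' \sum_j' \sum_k' \sum_l' 4^-1 * b i' j' k' l' * sprod (dl i') (dl j') (dl k') (dl l') i j k l.
Proof.
move=> [b1 b2]; apply: funext4 => i j k l.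
have dE p (F : 'I_n -> R) : \sum_q F q * dl q p = F p.
  rewrite -[RHS](sum_delta_l F); apply: eq_bigr => q _.
  by rewrite /dl mulrC.
have H p q s r : \sum_i' \sum_j' \sum_k' \sum_l'
   b i' j' k' l' * (dl i' p * (dl j' q * (dl k' s * dl l' r))) = b p q s r.
  rewrite -(dE p (fun i' => b i' q s r)); apply: eq_bigr => i' _.
  rewrite -(dE q (fun j' => b i' j' s r)) mulr_suml; apply: eq_bigr => j' _.
  rewrite -(dE s (fun k' => b i' j' k' r)) !mulr_suml; apply: eq_bigr => k' _.
  rewrite -(dE r (fun l' => b i' j' k' l')) !mulr_suml; apply: eq_bigr => l' _.
  by ring.
have -> : b i j k l = 4^-1 * (b i j k l + b j i k l + b i j l k + b j i l k).
  by rewrite (b1 j i k l) (b1 j i l k) (b2 i j l k); field.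
rewrite -(H i j k l) -(H j i k l) -(H i j l k) -(H j i l k).
rewrite -!big_split mulr_sumr; apply: eq_bigr => i' _.
rewrite -!big_split mulr_sumr; apply: eq_bigr => j' _.
rewrite -!big_split mulr_sumr; apply: eq_bigr => k' _.
rewrite -!big_split mulr_sumr; apply: eq_bigr => l' _ /=.
by rewrite /sprod; ring.
Qed.

Lemma linear4_sprod b : sym_pairs b -> f b = \sum_i \sum_j \sum_k \sum_l
   4^-1 * b i j k l * f (sprod (dl i) (dl j) (dl k) (dl l)).
Proof.
move=> sb; rewrite {1}(sprod_decomp sb) linear4_sum; apply: eq_bigr => i' _.
rewrite linear4_sum; apply: eq_bigr => j' _; rewrite linear4_sum; apply: eq_bigr => k' _.
by rewrite linear4_sum; apply: eq_bigr => l' _; rewrite linear4Z.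
Qed.

Lemma linear4_eq0 b : (forall x y z t, f (sprod x y z t) = 0) -> sym_pairs b -> f b = 0.
Proof.
move=> H sb; rewrite linear4_sprod //.
apply: big1 => i _; apply: big1 => j _; apply: big1 => k _; apply: big1 => l _.
by rewrite H mulr0.
Qed.

Variable w : 'M[R]_n.
Hypothesis lw : lorentzian w.

(** What a coordinate change with third derivatives [T] adds to g_ij,kl. *)
Definition dT (T : 'I_n -> 'I_n -> 'I_n -> 'I_n -> R) : tens4 :=
  fun i j k l => \sum_a (T a i k l * w a j + w i a * T a j k l).

(** What a coordinate change with second derivatives [S] adds to g_ij,kl, starting from vanishing
    first derivatives of the metric. *)
Definition SS (S : 'I_n -> 'I_n -> 'I_n -> R) : tens4 := fun i j k l =>
  \sum_a \sum_c (S a i k * w a c * S c j l + S a i l * w a c * S c j k).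

Definition sym2 (S : 'I_n -> 'I_n -> 'I_n -> R) := forall a i j, S a i j = S a j i.
Definition sym3 (T : tens4) :=
  (forall a i j k, T a i j k = T a j i k) /\ (forall a i j k, T a i j k = T a i k j).

Hypothesis f_dT : forall T, sym3 T -> f (dT T) = 0.

(** Take T to be v times the symmetrized product of y, z, t, where v is [x] with its index raised by
    [w]; then [dT T] is the sum of these three products. It is an identity of Bianchi type. *)
Lemma sprod_cyclic x y z t :
  f (sprod x y z t) + f (sprod x z y t) + f (sprod x t y z) = 0.
Proof.
have ws : w^T = w by case: lw.
pose v a := \sum_c invmx w a c * x c.
have wv j : \sum_a w j a * v a = x j.
  have := congr1 (fun A : 'M[R]_(n, 1) => A j 0) (mulmxA w (invmx w) (\col_c x c)).
  rewrite mulmxV ?lorentzian_unit // mul1mx !mxE => <-; apply: eq_bigr => a _.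
  by rewrite !mxE; congr (_ * _); apply: eq_bigr => c _; rewrite mxE.
pose u i k l := y i * (z k * t l + t k * z l) + z i * (y k * t l + t k * y l) +
  t i * (y k * z l + z k * y l).
have := f_dT (T := fun a i k l => v a * u i k l) _.
have -> : dT (fun a i k l => v a * u i k l) = fun i j k l => sprod x y z t i j k l +
   (sprod x z y t i j k l + sprod x t y z i j k l).
  apply: funext4 => i j k l; rewrite /dT.
  transitivity ((\sum_a w j a * v a) * u i k l + (\sum_a w i a * v a) * u j k l).
    rewrite !mulr_suml -big_split; apply: eq_bigr => a _ /=.
    by rewrite -{1}ws mxE; ring.
  by rewrite !wv /u /sprod; ring.
rewrite !linear4D addrA; apply; split=> a i j k; rewrite /u; ring.
Qed.

Hypothesis f_SS : forall S, sym2 S -> f (SS S) = 0.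

(** For S = v times h with [v] not isotropic, [SS S] is a nonzero multiple of a symmetrized square
    of h. So [f] kills these squares and, by polarization, mixed products. *)
Lemma sprod_flat x y z t :
  f (sprod x y z t) + f (sprod x t z y) + f (sprod z y x t) + f (sprod z t x y) = 0.
Proof.
have [_ [P _ Pw]] := lw.
(* When n = 0 all arrays are empty and hence equal to 0. *)
case: (pickP 'I_n) => [i0 _|H]; last first.
  have -> : sprod x y z t = fun _ _ _ _ => 0 by apply/funext => i; have := H i.
  have -> : sprod x t z y = fun _ _ _ _ => 0 by apply/funext => i; have := H i.
  have -> : sprod z y x t = fun _ _ _ _ => 0 by apply/funext => i; have := H i.
  have -> : sprod z t x y = fun _ _ _ _ => 0 by apply/funext => i; have := H i.
  by rewrite linear4_0 !addr0.
(* A row of an orthonormal frame: its square [c] is 1 or -1. *)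
pose v a := P i0 a; pose c := \sum_a \sum_c v a * w a c * v c.
have c0 : c != 0.
  have := congr1 (fun A : 'M[R]_n => A i0 i0) Pw; rewrite !mxE eqxx mulr1n.
  have -> : \sum_j (P *m w) i0 j * P^T j i0 = c.
    rewrite /c exchange_big; apply: eq_bigr => j _ /=; rewrite !mxE mulr_suml.
    by apply: eq_bigr.
  by move=> ->; case: ifP; rewrite ?oppr_eq0 oner_neq0.
pose S (h : 'I_n -> 'I_n -> R) a i k : R := v a * h i k.
have SSE (h : 'I_n -> 'I_n -> R) : SS (S h) = fun i j k l => c * (h i k * h j l + h i l * h j k).
  apply: funext4 => i j k l; rewrite /SS /c mulr_suml; apply: eq_bigr => a _.
  by rewrite mulr_suml; apply: eq_bigr => e _; rewrite /S; ring.
have fS (h : 'I_n -> 'I_n -> R) : (forall i k, h i k = h k i) ->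
    f (fun i j k l => h i k * h j l + h i l * h j k) = 0.
  move=> hs; apply/eqP; rewrite -(mulrI_eq0 _ (mulfI c0)) -linear4Z -SSE f_SS //.
  by move=> a i j; rewrite /S hs.
pose p i k := x i * z k + z i * x k; pose q i k := y i * t k + t i * y k.
have ps i k : p i k = p k i by rewrite /p; ring.
have qs i k : q i k = q k i by rewrite /q; ring.
have hpq := fS (fun i k => p i k + q i k) (fun i k => f_equal2 +%R (ps i k) (qs i k)).
have hp := fS p ps; have hq := fS q qs.
rewrite -!linear4D.
(* The square of p + q minus those of p and q leaves exactly the four products of the statement. *)
transitivity (f (fun i j k l => (p i k + q i k) * (p j l + q j l) +
    (p i l + q i l) * (p j k + q j k))); last exact: hpq.
transitivity (f (fun i j k l => (p i k + q i k) * (p j l + q j l) +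
    (p i l + q i l) * (p j k + q j k)) + (-1) * f (fun i j k l => p i k * p j l + p i l * p j k)
    + (-1) * f (fun i j k l => q i k * q j l + q i l * q j k)).
  rewrite -!linear4Z -!linear4D; congr (f _); apply: funext4 => i j k l.
  by rewrite /sprod /p /q; ring.
by rewrite hp hq !mulr0 !addr0.
Qed.

(* Adding the cyclic identities based at x and at z leaves twice f(x z|y t)
   besides the four terms of sprod_flat. *)
Lemma flat_functional_eq0 b : sym_pairs b -> f b = 0.
Proof.
apply: linear4_eq0 => x z y t.
have sC1 (p q r s : vec) : sprod p q r s = sprod q p r s.
  by apply: funext4 => i j k l; rewrite /sprod; ring.
have sC2 (p q r s : vec) : sprod p q r s = sprod p q s r.
  by apply: funext4 => i j k l; rewrite /sprod; ring.
have := sprod_cyclic x y z t; have := sprod_cyclic z t x y; have := sprod_flat x y z t.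
rewrite (sC1 z x) (sC2 x z t y) (sC2 x t z y) (sC2 z y x t) => H1 H2 H3.
have : f (sprod x z y t) + f (sprod x z y t) = 0 by lra.
lra.
Qed.

End Linear4.
End FourTensors.

(** * Consequences of quadratic and cubic coordinate changes *)

Section Decomposition.
Variables (R : realType) (n m : nat) (L : Yspace R n m -> R).
Hypothesis L_inv : forall (M : manifold R n) (g : lorentz_metric M)
  (D : tensor_field M m), exists f : M -> R, represents L g D f.
Local Notation tens3 := ('I_n -> 'I_n -> 'I_n -> R).
Local Notation tens4 := ('I_n -> 'I_n -> 'I_n -> 'I_n -> R).
Local Notation tensm := (m.-tuple 'I_n -> R).
Local Notation tensm1 := (m.-tuple 'I_n -> 'I_n -> R).
Implicit Types (w : 'M[R]_n) (a : tens3) (b : tens4) (d : tensm) (e : tensm1).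

(** The term that a quadratic coordinate change with second derivatives [S] adds to g_ij,k; [Sd] is
    the corresponding term for D_I,k. *)
Definition dS w (S : tens3) : tens3 :=
  fun i j k => \sum_c (S c i k * w c j + w i c * S c j k).

Definition Sd (S : tens3) d : tensm1 :=
  fun I k => \sum_(u < m) \sum_c S c (tnth I u) k * d (upd I u c).

Lemma mkY_comb c w a b d e w' a' b' d' e' :
  c *: mkY w a b d e + mkY w' a' b' d' e' =
  mkY (c *: w + w') (fun i j k => c * a i j k + a' i j k)
    (fun i j k l => c * b i j k l + b' i j k l) (fun I => c * d I + d' I)
    (fun I k => c * e I k + e' I k).
Proof.
rewrite /mkY; congr (_, _, _, _, _);
  by apply/rowP => r; rewrite !mxE.
Qed.

Definition metricY w : Yspace R n m :=
  mkY w (fun _ _ _ => 0) (fun _ _ _ _ => 0) (fun _ => 0) (fun _ _ => 0).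
Definition a_Y a : Yspace R n m := mkY 0 a (fun _ _ _ _ => 0) (fun _ => 0) (fun _ _ => 0).
Definition b_Y b : Yspace R n m := mkY 0 (fun _ _ _ => 0) b (fun _ => 0) (fun _ _ => 0).
Definition d_Y d : Yspace R n m :=
  mkY 0 (fun _ _ _ => 0) (fun _ _ _ _ => 0) d (fun _ _ => 0).
Definition e_Y e : Yspace R n m :=
  mkY 0 (fun _ _ _ => 0) (fun _ _ _ _ => 0) (fun _ => 0) e.

Lemma mkY_ext w a b d e a' b' d' e' : (forall i j k, a i j k = a' i j k) ->
  (forall i j k l, b i j k l = b' i j k l) -> (forall I, d I = d' I) ->
  (forall I k, e I k = e' I k) -> mkY w a b d e = mkY w a' b' d' e'.
Proof.
move=> aa bb dd ee; congr (mkY w _ _ _ _).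
- by apply/funext => i; apply/funext => j; apply/funext => k.
- exact: funext4.
- exact/funext.
- by apply/funext => I; apply/funext.
Qed.

Lemma mkYD w a b d e w' a' b' d' e' :
  mkY w a b d e + mkY w' a' b' d' e' =
  mkY (w + w') (fun i j k => a i j k + a' i j k)
    (fun i j k l => b i j k l + b' i j k l) (fun I => d I + d' I)
    (fun I k => e I k + e' I k).
Proof.
rewrite -[X in X + _]scale1r mkY_comb scale1r.
by apply: mkY_ext => *; rewrite mul1r.
Qed.

Lemma mkY0 : mkY 0 (fun _ _ _ => 0) (fun _ _ _ _ => 0) (fun _ => 0) (fun _ _ => 0) = 0
  :> Yspace R n m.
Proof. by rewrite /mkY; congr (_, _, _, _, _); apply/rowP => r; rewrite !mxE. Qed.

Lemma mkYZ c w a b d e : c *: mkY w a b d e =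
  mkY (c *: w) (fun i j k => c * a i j k) (fun i j k l => c * b i j k l)
    (fun I => c * d I) (fun I k => c * e I k).
Proof.
rewrite -[LHS]addr0 -mkY0 mkY_comb addr0.
by apply: mkY_ext => *; rewrite addr0.
Qed.

Lemma mkY_split w a b d e :
  mkY w a b d e = metricY w + (a_Y a + b_Y b + d_Y d + e_Y e).
Proof.
rewrite !mkYD !addr0; apply: mkY_ext => *; rewrite ?addr0 ?add0r //.
Qed.

Section Balance.
Variables (w : 'M[R]_n) (lin : Yspace R n m -> R) (bil : Yspace R n m -> Yspace R n m -> R).
Hypothesis (lw : lorentzian w) (Hq : quadratic_at L (metricY w) lin bil).

Lemma linD u v : lin (u + v) = lin u + lin v.
Proof. by case: Hq => /(_ 1 u v) + _ _ _; rewrite scale1r mul1r. Qed.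

Lemma lin0 : lin 0 = 0.
Proof. by have := linD 0 0; rewrite addr0; lra. Qed.

Lemma linZ c u : lin (c *: u) = c * lin u.
Proof. by case: Hq => /(_ c u 0) + _ _ _; rewrite !addr0 lin0 addr0. Qed.

Lemma bilC u v : bil u v = bil v u. Proof. by case: Hq. Qed.

Lemma bilDl u v z : bil (u + v) z = bil u z + bil v z.
Proof. by case: Hq => _ /(_ 1 u v z) + _ _; rewrite scale1r mul1r. Qed.

Lemma bil0l z : bil 0 z = 0.
Proof. by have := bilDl 0 0 z; rewrite addr0; lra. Qed.

Lemma bilZl c u z : bil (c *: u) z = c * bil u z.
Proof. by case: Hq => _ /(_ c u 0 z) + _ _; rewrite !addr0 bil0l addr0. Qed.

Lemma bilDr u v z : bil z (u + v) = bil z u + bil z v.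
Proof. by rewrite ![bil z _]bilC bilDl. Qed.

Lemma bilZr c u z : bil z (c *: u) = c * bil z u.
Proof. by rewrite ![bil z _]bilC bilZl. Qed.

Lemma L_split a b d e : let u := a_Y a + b_Y b + d_Y d + e_Y e in
  L (mkY w a b d e) = L (metricY w) + lin u + bil u u.
Proof.
move=> u; rewrite mkY_split; case: Hq => _ _ _; apply.
by rewrite /wmx /u /= !addr0.
Qed.

Lemma bil_balance X D : lin X + bil X X = lin (X + D) + bil (X + D) (X + D) ->
  lin D + 2 * bil X D + bil D D = 0.
Proof. by rewrite linD !bilDl !bilDr (bilC D X); lra. Qed.

Lemma bil_quartic X D1 D2 s : let D := s *: D1 + s ^+ 2 *: D2 in
  lin D + 2 * bil X D + bil D D = (lin D1 + 2 * bil X D1) * s +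
  (lin D2 + 2 * bil X D2 + bil D1 D1) * s ^+ 2 + 2 * bil D1 D2 * s ^+ 3 +
  bil D2 D2 * s ^+ 4.
Proof.
by rewrite /= linD !linZ !bilDl !bilDr !bilZl !bilZr (bilC D2 D1); ring.
Qed.

(* The left side is what a change of coordinates with 2-jet s S and 3-jet t T adds
   to the quadratic expansion of L; as a polynomial in s and t it vanishes
   coefficientwise. *)
Lemma ST_balance b d e S T (s t : R) : sym_pairs b -> sym2 S -> sym3 T ->
  let X := b_Y b + d_Y d + e_Y e in
  let D := s *: (a_Y (dS w S) + e_Y (Sd S d)) + s ^+ 2 *: b_Y (SS w S) + t *: b_Y (dT w T) in
  lin D + 2 * bil X D + bil D D = 0.
Proof.
move=> sb sS [sT1 sT2] X D.
have h1 c i j : s * S c i j = s * S c j i by rewrite sS.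
have h2 c i j k : t * T c i j k = t * T c j i k by rewrite sT1.
have h3 c i j k : t * T c i j k = t * T c i k j by rewrite sT2.
have := ST_invariance L_inv d e lw sb h1 h2 h3.
rewrite [LHS]L_split; set Y := mkY _ _ _ _ _ => E.
have YE : Y = metricY w + (X + D).
  rewrite /Y /X /D /metricY /a_Y /b_Y /d_Y /e_Y !(mkYZ, mkYD) !addr0 !scaler0 !addr0; apply: mkY_ext.
  - move=> i j k; rewrite /dS !mulr0 !addr0 !add0r mulr_sumr.
    by apply: eq_bigr => c _; ring.
  - move=> i j k l; rewrite !mulr0 !addr0 !add0r -addrA; congr (_ + _).
    rewrite /dT /SS addrC mulr_sumr mulr_sumr; congr (_ + _); apply: eq_bigr => c _.
      by rewrite mulr_sumr; apply: eq_bigr => c' _; ring.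
    by ring.
  - by move=> I; rewrite !mulr0 !addr0 !add0r.
  - move=> I k; rewrite !mulr0 !addr0 !add0r; congr (_ + _); rewrite /Sd mulr_sumr.
    apply: eq_bigr => u _; rewrite mulr_sumr; apply: eq_bigr => c _; ring.
have wY : wmx (X + D) = 0 by rewrite /wmx /X /D /= !(addr0, scaler0).
move: E; rewrite YE; case: Hq => _ _ _ /(_ _ wY) ->.
have -> : a_Y (fun _ _ _ => 0) = 0 by exact: mkY0.
rewrite add0r -/X => H; clear YE wY Y; clearbody X D.
by apply: bil_balance; lra.
Qed.

(** The values at 1, -1, 2, -2 determine all four coefficients linearly. *)
Lemma quartic_eq0 (c1 c2 c3 c4 : R) :
  (forall s, c1 * s + c2 * s ^+ 2 + c3 * s ^+ 3 + c4 * s ^+ 4 = 0) ->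
  c1 = 0 /\ c2 = 0.
Proof.
move=> H; have H1 := H 1; have H2 := H (-1); have H3 := H 2; have H4 := H (-2).
by split; lra.
Qed.

Lemma sym3_0 : sym3 (fun _ _ _ _ : 'I_n => 0 : R). Proof. by []. Qed.
Lemma sym2_0 : sym2 (fun _ _ _ : 'I_n => 0 : R). Proof. by []. Qed.

(** For s = 0 the balance is a polynomial in t without constant term. Its values at 1 and -1 isolate
    the linear coefficient, and the case X = 0 separates [lin] from [bil] there. *)
Lemma T_balance b d e T : sym_pairs b -> sym3 T ->
  lin (b_Y (dT w T)) = 0 /\ bil (b_Y b + d_Y d + e_Y e) (b_Y (dT w T)) = 0.
Proof.
move=> sb sT.
have H b' d' e' : sym_pairs b' ->
    lin (b_Y (dT w T)) + 2 * bil (b_Y b' + d_Y d' + e_Y e') (b_Y (dT w T)) = 0.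
  move=> sb'; set X := _ + _ + _; set D := b_Y (dT w T).
  have K t := ST_balance d' e' 0 t sb' sym2_0 sT.
  have := K 1; have := K (-1); rewrite /= -/X -/D !scale0r expr0n /= scale0r !add0r.
  clearbody X D; rewrite !linZ !bilZl !bilZr; lra.
have z : sym_pairs (fun _ _ _ _ : 'I_n => 0 : R) by [].
have H0 := H _ (fun=> 0) (fun _ _ => 0) z; have H1 := H b d e sb.
have E0 : b_Y (fun _ _ _ _ => 0) + d_Y (fun=> 0) + e_Y (fun _ _ => 0) = 0 :> Yspace R n m.
  by rewrite /b_Y /d_Y /e_Y !mkY0 !addr0.
rewrite E0 bil0l in H0.
have l0 : lin (b_Y (dT w T)) = 0 by lra.
by split=> //; lra.
Qed.

Lemma S_balance b d e S : sym_pairs b -> sym2 S ->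
  let X := b_Y b + d_Y d + e_Y e in
  let D1 := a_Y (dS w S) + e_Y (Sd S d) in let D2 := b_Y (SS w S) in
  lin D1 + 2 * bil X D1 = 0 /\ lin D2 + 2 * bil X D2 + bil D1 D1 = 0.
Proof.
move=> sb sS X D1 D2.
have K s := ST_balance d e s 0 sb sS sym3_0.
apply: (@quartic_eq0 _ _ (2 * bil D1 D2) (bil D2 D2)) => s.
by rewrite -bil_quartic; have := K s; rewrite /= scale0r addr0.
Qed.

Lemma Sd0 S : Sd S (fun=> 0) = (fun _ _ => 0).
Proof.
by apply/funext => I; apply/funext => k; rewrite /Sd big1 // => u _; rewrite big1 // => c _; rewrite mulr0.
Qed.

Let z4 : sym_pairs (fun _ _ _ _ : 'I_n => 0 : R). Proof. by []. Qed.
Let b0 : b_Y (fun _ _ _ _ => 0) = 0. Proof. exact: mkY0. Qed.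
Let d0 : d_Y (fun _ => 0) = 0. Proof. exact: mkY0. Qed.
Let e0 : e_Y (fun _ _ => 0) = 0. Proof. exact: mkY0. Qed.

(** This lemma and the next ones read [S_balance] at jets where some of b, d, e vanish, each using
    those before it. *)
Lemma lin_dS S : sym2 S -> lin (a_Y (dS w S)) = 0.
Proof.
move=> sS; have [+ _] := S_balance (fun=> 0) (fun _ _ => 0) z4 sS.
by rewrite Sd0 b0 d0 e0 !addr0 bil0l; lra.
Qed.

Lemma bil_b_dS b S : sym_pairs b -> sym2 S -> bil (b_Y b) (a_Y (dS w S)) = 0.
Proof.
move=> sb sS; have [+ _] := S_balance (fun=> 0) (fun _ _ => 0) sb sS.
by rewrite Sd0 d0 e0 !addr0 lin_dS //; lra.
Qed.

Lemma bil_e_dS e S : sym2 S -> bil (e_Y e) (a_Y (dS w S)) = 0.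
Proof.
move=> sS; have [+ _] := S_balance (fun=> 0) e z4 sS.
by rewrite Sd0 b0 d0 e0 !addr0 !add0r lin_dS //; lra.
Qed.

Let SdN S d : e_Y (Sd S (fun I => -1 * d I)) = (-1) *: e_Y (Sd S d).
Proof.
rewrite mkYZ scaler0; apply: mkY_ext => *; rewrite ?mulr0 //.
rewrite /Sd mulr_sumr; apply: eq_bigr => u _; rewrite mulr_sumr; apply: eq_bigr => c _.
by ring.
Qed.

Let dN d : d_Y (fun I => -1 * d I) = (-1) *: d_Y d.
Proof. by rewrite mkYZ scaler0; apply: mkY_ext => *; rewrite ?mulr0. Qed.

(** The coefficient of s has terms linear in [d] and one quadratic in [d]; comparing [d] with its
    opposite separates them. *)
Lemma lin_Sd S d : sym2 S ->
  lin (e_Y (Sd S d)) + 2 * bil (d_Y d) (a_Y (dS w S)) = 0 /\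
  bil (d_Y d) (e_Y (Sd S d)) = 0.
Proof.
move=> sS; have [H1 _] := S_balance d (fun _ _ => 0) z4 sS.
have [H2 _] := S_balance (fun I => -1 * d I) (fun _ _ => 0) z4 sS.
move: H1 H2; rewrite b0 e0 !addr0 !add0r SdN dN !linD !bilDr !bilZl !bilZr linZ lin_dS //.
by move=> H1 H2; split; lra.
Qed.

Lemma bil_e_Sd e S d : sym2 S -> bil (e_Y e) (e_Y (Sd S d)) = 0.
Proof.
move=> sS; have [+ _] := S_balance d e z4 sS.
have [H1 H2] := lin_Sd d sS; rewrite b0 !add0r linD !bilDl !bilDr lin_dS // bil_e_dS // H2.
by lra.
Qed.

Lemma lin_SS S : sym2 S ->
  lin (b_Y (SS w S)) + bil (a_Y (dS w S)) (a_Y (dS w S)) = 0.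
Proof.
move=> sS; have [_] := S_balance (fun=> 0) (fun _ _ => 0) z4 sS.
by rewrite Sd0 b0 d0 e0 !addr0 bil0l mulr0 addr0.
Qed.

(** In the coefficient of s^2 only the metric part of [bil D1 D1] survives, and [lin_SS] cancels it
    against [lin D2]. *)
Lemma bil_SS b d e S : sym_pairs b -> sym2 S ->
  bil (b_Y b + d_Y d + e_Y e) (b_Y (SS w S)) = 0.
Proof.
move=> sb sS; have [_] := S_balance d e sb sS.
rewrite [bil (a_Y _ + _) _]bilDl !(bilDr (a_Y _) (e_Y _)) (bilC (a_Y _) (e_Y _)).
rewrite bil_e_dS // bil_e_Sd //; have := lin_SS sS; lra.
Qed.

Let b_lin : linear4 (fun b => lin (b_Y b)).
Proof.
move=> c b b'; rewrite -linZ -linD; congr lin.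
by rewrite mkY_comb scaler0 addr0; apply: mkY_ext => *; rewrite ?mulr0 ?addr0.
Qed.

Lemma b_linear4 : linear4 (fun b => lin (b_Y b)). Proof. exact: b_lin. Qed.

(** For fixed left argument, [T_balance] and [bil_SS] are the two hypotheses of
    [flat_functional_eq0]. *)
Lemma bil_b_eq0 b b' d e : sym_pairs b -> sym_pairs b' ->
  bil (b_Y b + d_Y d + e_Y e) (b_Y b') = 0.
Proof.
move=> sb; apply: (@flat_functional_eq0 _ _ (fun b' => bil (b_Y b + d_Y d + e_Y e) (b_Y b')) _ w lw).
- move=> c b1 b2; rewrite -bilZr -bilDr; congr bil.
  by rewrite mkY_comb scaler0 addr0; apply: mkY_ext => *; rewrite ?mulr0 ?addr0.
- by move=> T sT; case: (T_balance d e sb sT).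
- by move=> S sS; exact: bil_SS.
Qed.

Lemma L_scaled d e c c' : L (mkY w (fun _ _ _ => 0) (fun _ _ _ _ => 0)
     (fun I => c * d I) (fun I j => c' * e I j)) =
  L (metricY w) + c * lin (d_Y d) + c' * lin (e_Y e) + c * c * bil (d_Y d) (d_Y d)
   + 2 * (c * c' * bil (d_Y d) (e_Y e)) + c' * c' * bil (e_Y e) (e_Y e).
Proof.
have dE : d_Y (fun I => c * d I) = c *: d_Y d.
  by rewrite mkYZ scaler0; apply: mkY_ext => *; rewrite ?mulr0.
have eE : e_Y (fun I j => c' * e I j) = c' *: e_Y e.
  by rewrite mkYZ scaler0; apply: mkY_ext => *; rewrite ?mulr0.
have a0 : a_Y (fun _ _ _ => 0) = 0 by exact: mkY0.
rewrite L_split a0 b0 dE eE !add0r.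
move: (d_Y d) (e_Y e) => u v.
by rewrite linD !linZ bilDl !bilDr !bilZl !bilZr (bilC v u); ring.
Qed.

(* The change of coordinates x |-> - x gives D and its first derivatives opposite
   parities. *)
Lemma bil_d_e d e : bil (d_Y d) (e_Y e) = 0.
Proof.
have A1 : ((-1)%:M : 'M[R]_n) \in unitmx.
  by rewrite unitmxE det_scalar unitfE expf_neq0 // oppr_eq0 oner_neq0.
have wE : (-1)%:M *m w *m ((-1)%:M)^T = w.
  by rewrite tr_scalar_mx mul_scalar_mx mul_mx_scalar scalerA mulrNN mulr1 scale1r.
(* Each index of D contributes a sign; the index of differentiation contributes one more to the
   derivative. *)
pose k := (-1) ^+ m : R.
have prodN (J I : m.-tuple 'I_n) : \prod_(t < m) ((-1)%:M : 'M[R]_n) (tnth J t) (tnth I t) =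
    k * \prod_(t < m) (1%:M : 'M[R]_n) (tnth J t) (tnth I t).
  have -> : k = \prod_(t < m) (-1) by rewrite prodr_const card_ord.
  rewrite -big_split; apply: eq_bigr => t _; rewrite !mxE.
  by case: eqP => _ /=; rewrite ?mulr1n ?mulr0n ?mulr1 ?mulr0.
have parity : forall d e, L (mkY w (fun _ _ _ => 0) (fun _ _ _ _ => 0) d e) =
  L (mkY w (fun _ _ _ => 0) (fun _ _ _ _ => 0) (fun I => k * d I) (fun I j => - k * e I j)).
  move=> d' e'; rewrite (GL_invariance L_inv d' e' lw z4 A1) wE; congr L; apply: mkY_ext => //.
  - move=> i j k' l; rewrite big1 // => k1 _; rewrite big1 // => l1 _.
    have -> : b_mx (fun _ _ _ _ => 0) k1 l1 = 0 :> 'M[R]_n by apply/matrixP => i1 j1; rewrite !mxE.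
    by rewrite mulmx0 mul0mx [X in _ * X]mxE mulr0.
  - move=> I; rewrite tr_scalar_mx.
    have := congr1 (fun h => h I) (tens_change1 d'); rewrite /tens_change => <-.
    rewrite mulr_sumr; apply: eq_bigr => J _; rewrite mulrCA; congr (_ * _).
    exact: prodN.
  - move=> I j; have := congr1 (fun h => h I) (tens_change1 (fun J => e' J j)).
    rewrite /tens_change => <-; rewrite mulr_sumr; apply: eq_bigr => J _.
    have -> : \sum_c e' J c * (-1)%:M j c = - e' J j.
      rewrite (bigD1 j) //= big1 => [|c cj]; first by rewrite mxE eqxx mulrN1 addr0.
      by rewrite mxE eq_sym (negbTE cj) mulr0.
    have -> : \prod_(t < m) ((-1)%:M : 'M[R]_n) (tnth I t) (tnth J t) =
        \prod_(t < m) ((-1)%:M : 'M[R]_n) (tnth J t) (tnth I t).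
      by apply: eq_bigr => t _; rewrite !mxE eq_sym.
    by rewrite prodN; ring.
have kk : k * k = 1 by rewrite /k -exprD addnn -mul2n exprM sqrrN !expr1n.
have scaled c c' : L (mkY w (fun _ _ _ => 0) (fun _ _ _ _ => 0)
     (fun I => c * d I) (fun I j => c' * e I j)) =
   L (mkY w (fun _ _ _ => 0) (fun _ _ _ _ => 0)
     (fun I => k * c * d I) (fun I j => - k * c' * e I j)).
  by rewrite parity; congr L; apply: mkY_ext => *; rewrite ?mulrA.
(* In the sum of these two equations the linear terms cancel, and the cross term changes sign from
   one side to the other. *)
have K1 := scaled 1 1; have K2 := scaled (-1) (-1).
rewrite !L_scaled in K1; rewrite !L_scaled in K2.
move: (L (metricY w)) (lin (d_Y d)) (lin (e_Y e)) (bil (d_Y d) (d_Y d))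
  (bil (d_Y d) (e_Y e)) (bil (e_Y e) (e_Y e)) K1 K2 => q p1 p2 p3 p4 p5 K1 K2.
have eq1 x : k * (k * x) = x by rewrite mulrA kk mul1r.
have E1 : k * 1 * (k * 1) = 1 by rewrite !mulr1.
have E2 : k * 1 * (- k * 1) = -1 by rewrite !mulr1 mulrN kk.
have E3 : (- k * 1) * (- k * 1) = 1 by rewrite !mulr1 mulrNN.
have F1 : k * -1 * (k * -1) = 1 by rewrite !mulrN1 mulrNN.
have F2 : k * -1 * (- k * -1) = -1 by rewrite !mulrN1 opprK mulNr kk.
have F3 : (- k * -1) * (- k * -1) = 1 by rewrite !mulrN1 !opprK.
move: K1 K2; rewrite E1 E2 E3 F1 F2 F3; lra.
Qed.

End Balance.
End Decomposition.

Arguments metricY {R n m} w.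
Arguments a_Y {R n m} a.
Arguments b_Y {R n m} b.

(** * Reduction to normalized jets *)

Section Components.
Variables (R : realType) (n m : nat) (L : Yspace R n m -> R).
Hypothesis L_inv : forall (M : manifold R n) (g : lorentz_metric M)
  (D : tensor_field M m), exists f : M -> R, represents L g D f.
Local Notation tens3 := ('I_n -> 'I_n -> 'I_n -> R).
Local Notation tens4 := ('I_n -> 'I_n -> 'I_n -> 'I_n -> R).
Local Notation tensm := (m.-tuple 'I_n -> R).
Local Notation tensm1 := (m.-tuple 'I_n -> 'I_n -> R).
Implicit Types (w : 'M[R]_n) (a : tens3) (b : tens4) (d : tensm) (e : tensm1).

Definition chr w a : tens3 := fun l i j =>
  2^-1 * \sum_p invmx w l p * (a p i j + a p j i - a i j p).

Definition sym12 a := forall i j k, a i j k = a j i k.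

Lemma chr_sym w a : sym12 a -> sym2 (chr w a).
Proof.
move=> sa l i j; rewrite /chr; congr (_ * _); apply: eq_bigr => p _.
by rewrite (sa i j); congr (_ * _); ring.
Qed.

Lemma lower_chr w a i j k : w \in unitmx ->
  \sum_c w i c * chr w a c j k = 2^-1 * (a i j k + a i k j - a j k i).
Proof.
move=> uw; have := congr1 (fun A : 'M[R]_(n, 1) => A i 0)
  (mulmxA w (invmx w) (\col_p (a p j k + a p k j - a j k p))).
rewrite mulmxV // mul1mx !mxE => <-; rewrite mulr_sumr; apply: eq_bigr => c _.
by rewrite !mxE /chr mulrCA; congr (_ * (_ * _)); apply: eq_bigr => p _; rewrite mxE.
Qed.

(** Metric compatibility: g_ij,k is the sum of two lowered Christoffel symbols. So every admissible
    first derivative comes from a quadratic coordinate change. *)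
Lemma dS_chr w a : lorentzian w -> sym12 a -> dS w (chr w a) = a.
Proof.
move=> lw sa; have uw := lorentzian_unit lw; have [ws _] := lw.
apply/funext => i; apply/funext => j; apply/funext => k; rewrite /dS big_split /=.
have -> : \sum_c chr w a c i k * w c j = \sum_c w j c * chr w a c i k.
  by apply: eq_bigr => c _; rewrite mulrC -{1}ws mxE.
by rewrite !lower_chr // (sa j i k); field.
Qed.

Definition GLb (A : 'M[R]_n) b : tens4 := fun i j k l =>
  \sum_k' \sum_l' (A k k' * A l l') * (A *m b_mx b k' l' *m A^T) i j.

Definition GLe (A : 'M[R]_n) e : tensm1 := fun I k =>
  \sum_(J : m.-tuple 'I_n) (\sum_c e J c * A k c) * \prod_(t < m) A (tnth I t) (tnth J t).

Lemma GLb_sym A b : sym_pairs b -> sym_pairs (GLb A b).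
Proof.
move=> [b1 b2]; split=> i j k l.
  apply: eq_bigr => k' _; apply: eq_bigr => l' _; congr (_ * _).
  have bT : (b_mx b k' l')^T = b_mx b k' l' by apply/matrixP => p q; rewrite !mxE b1.
  have E : (A *m b_mx b k' l' *m A^T)^T = A *m b_mx b k' l' *m A^T.
    by rewrite !trmx_mul trmxK bT mulmxA.
  by rewrite -[in LHS]E mxE.
rewrite /GLb exchange_big; apply: eq_bigr => k' _; apply: eq_bigr => l' _.
rewrite [A l _ * _]mulrC; congr (_ * (_ *m _ *m _) i j).
by apply/matrixP => p q; rewrite !mxE b2.
Qed.

Lemma GLb0 A : GLb A (fun _ _ _ _ => 0) = fun _ _ _ _ => 0.
Proof.
apply: funext4 => i j k l; rewrite /GLb big1 // => k' _; rewrite big1 // => l' _.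
have -> : b_mx (fun _ _ _ _ => 0) k' l' = 0 :> 'M[R]_n by apply/matrixP => i1 j1; rewrite !mxE.
by rewrite mulmx0 mul0mx [X in _ * X]mxE mulr0.
Qed.

Lemma GLd0 A : tens_change A^T (fun _ : m.-tuple 'I_n => 0) = (fun _ => 0) :> tensm.
Proof. by apply/funext => I; rewrite /tens_change big1 // => J _; rewrite mul0r. Qed.

Lemma GLdZ A c d : tens_change A^T (fun I => c * d I) = fun I => c * tens_change A^T d I.
Proof.
by apply/funext => I; rewrite /tens_change mulr_sumr; apply: eq_bigr => J _; rewrite mulrA.
Qed.

Lemma GLe0 A : GLe A (fun _ _ => 0) = (fun _ _ => 0).
Proof.
apply/funext => I; apply/funext => k; rewrite /GLe big1 // => J _.
by rewrite big1 ?mul0r // => c _; rewrite mul0r.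
Qed.

Lemma GLeZ A c e : GLe A (fun I k => c * e I k) = fun I k => c * GLe A e I k.
Proof.
apply/funext => I; apply/funext => k; rewrite /GLe mulr_sumr; apply: eq_bigr => J _.
rewrite mulrA; congr (_ * _); rewrite mulr_sumr; apply: eq_bigr => c' _; by rewrite mulrA.
Qed.

Let a0 : a_Y (fun _ _ _ => 0) = 0 :> Yspace R n m. Proof. exact: mkY0. Qed.
Let b0 : b_Y (fun _ _ _ _ => 0) = 0 :> Yspace R n m. Proof. exact: mkY0. Qed.
Let d0 : d_Y (fun _ => 0) = 0 :> Yspace R n m. Proof. exact: mkY0. Qed.
Let e0 : e_Y (fun _ _ => 0) = 0 :> Yspace R n m. Proof. exact: mkY0. Qed.
Let z4 : sym_pairs (fun _ _ _ _ : 'I_n => 0 : R). Proof. by []. Qed.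

(** With [a] written as [dS w S] every pairing is known: 2 bil(d, a) is - lin(Sd S d), bil(a, a) is
    - lin(SS w S), and the remaining cross terms vanish. *)
Lemma decomposition w lin bil a b d e : lorentzian w ->
  quadratic_at L (metricY w) lin bil -> sym12 a -> sym_pairs b ->
  L (mkY w a b d e) = L (metricY w)
    + (lin (b_Y b) - lin (b_Y (SS w (chr w a)))) + lin (d_Y d)
    + (lin (e_Y e) - lin (e_Y (Sd (chr w a) d)))
    + bil (d_Y d) (d_Y d) + bil (e_Y e) (e_Y e).
Proof.
move=> lw Hq sa sb; have sS := chr_sym w sa; set S := chr w a in sS *.
have aE : a = dS w S by rewrite dS_chr.
rewrite (L_split Hq) [in a_Y a]aE.
have H1 := lin_dS L_inv lw Hq sS.
have H2 := bil_b_dS L_inv lw Hq sb sS.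
have H3 := bil_e_dS L_inv lw Hq e sS.
have [H4 _] := lin_Sd L_inv lw Hq d sS.
have H5 := lin_SS L_inv lw Hq sS.
have H6 := bil_d_e L_inv lw Hq d e.
have H7 := bil_b_eq0 L_inv lw Hq d (fun _ _ => 0) z4 sb.
have H8 := bil_b_eq0 L_inv lw Hq (fun=> 0) e z4 sb.
have H9 := bil_b_eq0 L_inv lw Hq (fun=> 0) (fun _ _ => 0) sb sb.
rewrite b0 e0 add0r addr0 in H7; rewrite b0 d0 !add0r in H8; rewrite d0 e0 !addr0 in H9.
move: (a_Y _) (b_Y b) (b_Y (SS w S)) (d_Y d) (e_Y e) (e_Y (Sd S d)) H1 H2 H3 H4 H5 H6 H7 H8 H9.
move=> va vb vs vd ve vsd H1 H2 H3 H4 H5 H6 H7 H8 H9.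
rewrite !(linD Hq) !(bilDl Hq) !(bilDr Hq) (bilC Hq va vb) (bilC Hq va vd) (bilC Hq va ve).
rewrite (bilC Hq vb vd) (bilC Hq vb ve) (bilC Hq ve vd).
lra.
Qed.

Section Equivariance.
Variables (w A : 'M[R]_n).
Local Notation w' := (A *m w *m A^T).
Variables (lin lin' : Yspace R n m -> R) (bil bil' : Yspace R n m -> Yspace R n m -> R).
Hypotheses (lw : lorentzian w) (uA : A \in unitmx).
Hypotheses (Hq : quadratic_at L (metricY w) lin bil) (Hq' : quadratic_at L (metricY w') lin' bil').

Let lw' : lorentzian w' := lorentzian_congr uA lw.

Lemma GL_jet b d e : sym_pairs b -> L (mkY w (fun _ _ _ => 0) b d e) =
  L (mkY w' (fun _ _ _ => 0) (GLb A b) (tens_change A^T d) (GLe A e)).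
Proof. by move=> sb; exact: GL_invariance. Qed.

Lemma GL_metric : L (metricY w) = L (metricY w').
Proof. by rewrite /metricY GL_jet // GLb0 GLd0 GLe0. Qed.

Lemma GL_lin_b b : sym_pairs b -> lin (b_Y b) = lin' (b_Y (GLb A b)).
Proof.
move=> sb; have := GL_jet (fun=> 0) (fun _ _ => 0) sb.
rewrite GLd0 GLe0 (L_split Hq) (L_split Hq') a0 d0 e0 !addr0 !add0r -GL_metric.
have H := bil_b_eq0 L_inv lw Hq (fun=> 0) (fun _ _ => 0) sb sb.
have H' := bil_b_eq0 L_inv lw' Hq' (fun=> 0) (fun _ _ => 0) (GLb_sym A sb) (GLb_sym A sb).
by move: H H'; rewrite d0 e0 !addr0 => -> ->; rewrite !addr0 => /addrI.
Qed.

(** Independent factors on d and e let the values at 1 and -1 separate linear from quadratic parts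
    in both expansions. *)
Let scaled d e c c' : c * lin (d_Y d) + c' * lin (e_Y e) + c * c * bil (d_Y d) (d_Y d) +
    c' * c' * bil (e_Y e) (e_Y e) =
  c * lin' (d_Y (tens_change A^T d)) + c' * lin' (e_Y (GLe A e)) +
    c * c * bil' (d_Y (tens_change A^T d)) (d_Y (tens_change A^T d)) +
    c' * c' * bil' (e_Y (GLe A e)) (e_Y (GLe A e)).
Proof.
have := GL_jet (fun I => c * d I) (fun I k => c' * e I k) z4.
rewrite GLb0 GLdZ GLeZ (L_scaled Hq) (L_scaled Hq') -GL_metric.
rewrite (bil_d_e L_inv lw Hq) (bil_d_e L_inv lw' Hq').
move: (L _) (lin _) (lin _) (lin' _) (lin' _) (bil _ _) (bil _ _) (bil' _ _) (bil' _ _).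
by move=> *; lra.
Qed.

Lemma GL_lin_d d : lin (d_Y d) = lin' (d_Y (tens_change A^T d)).
Proof. by have := scaled d (fun _ _ => 0) 1 0; have := scaled d (fun _ _ => 0) (-1) 0; lra. Qed.

Lemma GL_lin_e e : lin (e_Y e) = lin' (e_Y (GLe A e)).
Proof. by have := scaled (fun=> 0) e 0 1; have := scaled (fun=> 0) e 0 (-1); lra. Qed.

Lemma GL_bil_d d : bil (d_Y d) (d_Y d) =
  bil' (d_Y (tens_change A^T d)) (d_Y (tens_change A^T d)).
Proof. by have := scaled d (fun _ _ => 0) 1 0; have := scaled d (fun _ _ => 0) (-1) 0; lra. Qed.

Lemma GL_bil_e e : bil (e_Y e) (e_Y e) = bil' (e_Y (GLe A e)) (e_Y (GLe A e)).
Proof. by have := scaled (fun=> 0) e 0 1; have := scaled (fun=> 0) e 0 (-1); lra. Qed.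

End Equivariance.
End Components.

(** * Lorentz reflections *)

Section Reflections.
Variables (R : realType) (n : nat).
Local Notation vec := ('I_n -> R).
Implicit Types (x y z t v : vec) (i j k l p : 'I_n).

Definition basis_vec i : vec := fun j => (j == i)%:R.
Local Notation dl := basis_vec.

Definition act (A : 'M[R]_n) x : vec := fun i => \sum_j A i j * x j.

Definition eta i : R := if i == 0%N :> nat then - 1 else 1.

Definition dot x y : R := \sum_i eta i * x i * y i.

Definition refl v : 'M[R]_n :=
  \matrix_(i, j) ((i == j)%:R - 2 / dot v v * v i * (eta j * v j)).

Lemma eta2 i : eta i * eta i = 1.
Proof. by rewrite /eta; case: ifP => _; rewrite ?mulrNN mulr1. Qed.

Lemma minkowskiE i j : Defs.minkowski R n i j = (i == j)%:R * eta i.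
Proof. by rewrite !mxE /eta; case: (i == j); rewrite ?mul1r ?mul0r ?mulr1n ?mulr0n. Qed.

Lemma sum_delta_r (F : 'I_n -> R) i : \sum_j (i == j)%:R * F j = F i.
Proof. exact: sum_delta_l. Qed.

Lemma act_refl v x i : act (refl v) x i = x i - 2 * dot v x / dot v v * v i.
Proof.
rewrite /act -[x i in RHS](sum_delta_r x i).
have -> : 2 * dot v x / dot v v * v i = \sum_j 2 / dot v v * v i * (eta j * v j) * x j.
  rewrite {1}/dot mulr_sumr !mulr_suml; apply: eq_bigr => j _; ring.
rewrite -sumrB; apply: eq_bigr => j _; rewrite mxE.
by ring.
Qed.

Lemma act_dl (A : 'M[R]_n) i j : act A (dl i) j = A j i.
Proof.
rewrite /act -[RHS](sum_delta_r (fun k => A j k) i); apply: eq_bigr => k _.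
by rewrite mulrC /dl eq_sym.
Qed.

Lemma dot_dl v i : dot v (dl i) = eta i * v i.
Proof.
rewrite /dot -[RHS](sum_delta_r (fun k => eta k * v k) i); apply: eq_bigr => k _.
by rewrite mulrC /dl eq_sym.
Qed.

Lemma refl_minkowski v : dot v v != 0 ->
  refl v *m Defs.minkowski R n *m (refl v)^T = Defs.minkowski R n.
Proof.
move=> v0; apply/matrixP => i j; rewrite [LHS]mxE.
have E k : (refl v *m Defs.minkowski R n) i k =
    eta k * (i == k)%:R - 2 / dot v v * v i * v k.
  rewrite !mxE; transitivity (\sum_p (k == p)%:R * (eta k * refl v i p)).
    by apply: eq_bigr => p _; rewrite minkowskiE eq_sym; case: eqP => [->|]; rewrite ?mul0r ?mulr0 //; ring.
  rewrite sum_delta_r mxE mulrBr; congr (_ - _).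
  by rewrite !mulrA [eta k * _]mulrC -!mulrA [eta k * (_ * _)]mulrCA [eta k * (v i * _)]mulrCA [eta k * (eta k * _)]mulrA eta2 mul1r !mulrA.
transitivity (\sum_k ((i == k)%:R * (eta k * refl v j k) -
     2 / dot v v * v i * (refl v j k * v k))).
  by apply: eq_bigr => k _; rewrite E mxE; ring.
rewrite sumrB sum_delta_r -mulr_sumr.
have -> : \sum_k refl v j k * v k = - v j by rewrite -/(act _ _ j) act_refl; field.
rewrite minkowskiE mxE [j == i]eq_sym; have := eta2 i.
move: (eta i) (v i) (v j) (2 / dot v v) ((i == j)%:R) => h a b c e hh.
transitivity (e * h + c * b * a * (1 - h * h)); first by ring.
by rewrite hh subrr mulr0 addr0.
Qed.

Lemma refl_unit v : dot v v != 0 -> refl v \in unitmx.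
Proof.
move=> v0; have := refl_minkowski v0 => /(congr1 determinant); rewrite !det_mulmx => H.
rewrite unitmxE unitfE; apply/eqP => d0; move: H; rewrite d0 !mul0r => /esym/eqP.
rewrite det_diag; apply/negP/prodf_neq0 => i _; rewrite !mxE.
by case: ifP; rewrite ?oppr_eq0 oner_eq0.
Qed.

Lemma dot_dl_neq0 i : dot (dl i) (dl i) != 0.
Proof. by rewrite dot_dl /dl eqxx mulr1 /eta; case: ifP; rewrite ?oppr_eq0 oner_eq0. Qed.

Definition sgn_at p i : R := if i == p then -1 else 1.

Lemma refl_flip p i : act (refl (dl p)) (dl i) = fun j => sgn_at p i * dl i j.
Proof.
apply/funext => j; rewrite act_refl !dot_dl /dl eqxx mulr1 /sgn_at.
have e0 : eta p != 0 by have := dot_dl_neq0 p; rewrite dot_dl /dl eqxx mulr1.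
case: (i =P p) => [->|_] /=; last by rewrite mulr0n !mulr0 !mul0r subr0 mul1r.
by rewrite !mulr1n mulr1 mulfK //; ring.
Qed.

(* For i <> k this vector is never isotropic, since 4 eta_i + eta_k is odd; its
   reflection mixes the i-th and k-th directions. *)
Definition mixv i k : vec := fun j => 2 * dl i j + dl k j.

Lemma dot_mixv i k : i != k -> dot (mixv i k) (mixv i k) = 4 * eta i + eta k.
Proof.
move=> ik; transitivity (2 * dot (mixv i k) (dl i) + dot (mixv i k) (dl k)).
  by rewrite /dot mulr_sumr -big_split; apply: eq_bigr => p _ /=; rewrite /mixv; ring.
rewrite !dot_dl /mixv /dl !eqxx [k == i]eq_sym (negbTE ik) /=; ring.
Qed.

Lemma dot_mixv_neq0 i k : i != k -> dot (mixv i k) (mixv i k) != 0.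
Proof.
move=> ik; rewrite dot_mixv // /eta; case: ifP => _; case: ifP => _; apply/eqP; lra.
Qed.

Lemma refl_mix_fix i k j : j != i -> j != k ->
  act (refl (mixv i k)) (dl j) = dl j.
Proof.
move=> ji jk; apply/funext => p; rewrite act_refl dot_dl.
have -> : mixv i k j = 0 by rewrite /mixv /dl (negbTE ji) (negbTE jk) mulr0 addr0.
by rewrite !mulr0 !mul0r subr0.
Qed.

(** The point is that [be] is nonzero: information at the i-th basis vector is carried to the
    k-th. *)
Lemma refl_mix i k : i != k -> exists al be : R, be != 0 /\
  act (refl (mixv i k)) (dl i) = fun j => al * dl i j + be * dl k j.
Proof.
move=> ik; pose N := dot (mixv i k) (mixv i k).
have N0 : N != 0 by exact: dot_mixv_neq0.
exists (1 - 8 * eta i / N), (- (4 * eta i / N)); split.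
  rewrite oppr_eq0 !mulf_neq0 ?invr_eq0 //.
  by rewrite /eta; case: ifP => _; rewrite ?oppr_eq0 oner_eq0.
apply/funext => j; rewrite act_refl dot_dl -/N /mixv.
have -> : dl i i = 1 by rewrite /dl eqxx.
have -> : dl k i = 0 by rewrite /dl (negbTE ik).
by move: (dl i j) (dl k j) => u u'; field.
Qed.

End Reflections.

(** * The curvature term *)

Section CurvatureFunctional.
Variables (R : realType) (n : nat).
Local Notation vec := ('I_n -> R).
Local Notation tens4 := ('I_n -> 'I_n -> 'I_n -> 'I_n -> R).
Local Notation dl := (@basis_vec R n).
Implicit Types (x y z t v : vec) (i j k l p : 'I_n) (A w : 'M[R]_n) (b : tens4).

Lemma sprod_sym x y z t : sym_pairs (sprod x y z t).
Proof. by split=> i j k l; rewrite /sprod; ring. Qed.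

Lemma GLb_sprod A x y z t :
  GLb A (sprod x y z t) = sprod (act A x) (act A y) (act A z) (act A t).
Proof.
apply: funext4 => i j k l; rewrite /GLb.
have E k' l' : (A *m b_mx (sprod x y z t) k' l' *m A^T) i j =
    (act A x i * act A y j + act A y i * act A x j) * (z k' * t l' + t k' * z l').
  have P u v : (A *m (\matrix_(i, j) (u i * v j)) *m A^T) i j = act A u i * act A v j.
    rewrite mxE [act A v j]/act mulr_sumr; apply: eq_bigr => q _.
    rewrite !mxE /act !mulr_suml; apply: eq_bigr => p _; rewrite !mxE; ring.
  have -> : b_mx (sprod x y z t) k' l' = (z k' * t l' + t k' * z l') *:
     (\matrix_(i, j) (x i * y j) + \matrix_(i, j) (y i * x j)).
    by apply/matrixP => p q; rewrite !mxE /sprod mulrC.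
  by rewrite -scalemxAr -scalemxAl mxE mulmxDr mulmxDl mxE !P mulrC.
have PP u v : act A u k * act A v l = \sum_k' \sum_l' A k k' * u k' * (A l l' * v l').
  by rewrite /act mulr_suml; apply: eq_bigr => k' _; rewrite mulr_sumr.
rewrite [RHS]/sprod !PP -big_split mulr_sumr; apply: eq_bigr => k' _ /=.
rewrite -big_split mulr_sumr; apply: eq_bigr => l' _ /=; rewrite E.
by move: (act A x i) (act A y j) (act A y i) (act A x j) => *; ring.
Qed.

Definition pairing w x y : R := \sum_i \sum_j invmx w i j * x i * y j.

(** The scalar curvature of a jet with vanishing first derivatives of the metric, as a linear
    function of the second derivatives. *)
Definition Rlin w b : R := \sum_i \sum_j \sum_k \sum_p
  invmx w i j * invmx w k p * (b p i j k - b i j p k).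

Lemma Rlin_linear4 w : linear4 (Rlin w).
Proof.
move=> c b b'; rewrite /Rlin mulr_sumr -big_split; apply: eq_bigr => i _ /=.
rewrite mulr_sumr -big_split; apply: eq_bigr => j _ /=.
rewrite mulr_sumr -big_split; apply: eq_bigr => k _ /=.
rewrite mulr_sumr -big_split; apply: eq_bigr => p _ /=; ring.
Qed.

Lemma pairing_swap w x y : w^T = w -> pairing w x y = pairing w y x.
Proof.
move=> ws; rewrite /pairing exchange_big; apply: eq_bigr => j _; apply: eq_bigr => i _ /=.
by rewrite -{1}ws -trmx_inv mxE; ring.
Qed.

Lemma Rlin_sprod w x y z t : w^T = w -> Rlin w (sprod x y z t) =
  2 * (pairing w x t * pairing w y z + pairing w x z * pairing w y t)
  - 4 * (pairing w x y * pairing w z t).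
Proof.
move=> ws.
have P u v u' v' : pairing w u v * pairing w u' v' = \sum_i \sum_j \sum_k \sum_p
    invmx w i j * invmx w k p * (u i * v j * u' k * v' p).
  rewrite /pairing mulr_suml; apply: eq_bigr => i _; rewrite mulr_suml; apply: eq_bigr => j _.
  rewrite mulr_sumr; apply: eq_bigr => k _; rewrite mulr_sumr; apply: eq_bigr => p _; ring.
transitivity (pairing w y z * pairing w t x + pairing w x z * pairing w t y
  + pairing w y t * pairing w z x + pairing w x t * pairing w z y
  - (pairing w x y * pairing w t z + pairing w y x * pairing w t z
  + pairing w x y * pairing w z t + pairing w y x * pairing w z t)); last first.
  rewrite (pairing_swap t x ws) (pairing_swap t y ws) (pairing_swap z x ws).
  rewrite (pairing_swap z y ws) (pairing_swap y x ws) (pairing_swap t z ws); ring.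
rewrite !P -!big_split -sumrB; apply: eq_bigr => i _ /=.
rewrite -!big_split -sumrB; apply: eq_bigr => j _ /=.
rewrite -!big_split -sumrB; apply: eq_bigr => k _ /=.
rewrite -!big_split -sumrB; apply: eq_bigr => p _ /=.
by rewrite /sprod; ring.
Qed.

Lemma pairing_mx w x y : pairing w x y = ((\row_i x i) *m invmx w *m (\col_j y j)) 0 0.
Proof.
rewrite mxE /pairing exchange_big; apply: eq_bigr => j _ /=; rewrite !mxE mulr_suml.
by apply: eq_bigr => i _; rewrite !mxE; ring.
Qed.

Lemma act_col A x : \col_i act A x i = A *m \col_i x i.
Proof. by apply/colP => i; rewrite !mxE; apply: eq_bigr => j _; rewrite mxE. Qed.

Lemma act_row A x : \row_i act A x i = \row_i x i *m A^T.
Proof. by apply/rowP => i; rewrite !mxE; apply: eq_bigr => j _; rewrite !mxE mulrC. Qed.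

Lemma pairing_act w A x y : A \in unitmx -> w \in unitmx ->
  pairing (A *m w *m A^T) (act A x) (act A y) = pairing w x y.
Proof.
move=> uA uw; rewrite !pairing_mx act_col act_row.
congr (_ 0 0); have uT : A^T \in unitmx by rewrite unitmx_tr.
have -> : invmx (A *m w *m A^T) = invmx A^T *m invmx w *m invmx A.
  have u1 : A *m w *m A^T \in unitmx by rewrite !unitmx_mul uA uw uT.
  apply: (can_inj (mulKmx u1)); rewrite mulmxV // -!mulmxA (mulmxA A^T) mulmxV // mul1mx.
  by rewrite (mulmxA w) mulmxV // mul1mx mulmxV.
by rewrite -!mulmxA (mulmxA A^T) mulmxV // mul1mx (mulmxA (invmx A)) mulVmx // mul1mx.
Qed.

Lemma Rlin_sprod_cyclic w x y z t : w^T = w ->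
  Rlin w (sprod x y z t) + Rlin w (sprod x z y t) + Rlin w (sprod x t y z) = 0.
Proof.
move=> ws; rewrite !Rlin_sprod //.
by rewrite (pairing_swap z y ws) (pairing_swap t z ws) (pairing_swap t y ws); ring.
Qed.

(** * Reflection-invariant functionals with the cyclic identity *)

Section Uniqueness.
Variable h : tens4 -> R.
Hypotheses (hl : linear4 h)
  (h_cyc : forall x y z t, h (sprod x y z t) + h (sprod x z y t) + h (sprod x t y z) = 0)
  (h_refl : forall v x y z t, dot v v != 0 -> h (sprod x y z t) =
    h (sprod (act (refl v) x) (act (refl v) y) (act (refl v) z) (act (refl v) t))).

Let q i j k l := h (sprod (dl i) (dl j) (dl k) (dl l)).

Let q_flip p i j k l :
  q i j k l = sgn_at R p i * sgn_at R p j * sgn_at R p k * sgn_at R p l * q i j k l.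
Proof.
rewrite {1}/q (h_refl _ _ _ _ (@dot_dl_neq0 R n p)) !refl_flip /q -(linear4Z hl); congr h.
by apply: funext4 => i' j' k' l'; rewrite /sprod; ring.
Qed.

Let qC1 i j k l : q i j k l = q j i k l.
Proof. by congr h; apply: funext4 => i' j' k' l'; rewrite /sprod; ring. Qed.

Let qC2 i j k l : q i j k l = q i j l k.
Proof. by congr h; apply: funext4 => i' j' k' l'; rewrite /sprod; ring. Qed.

Let q_cyc i j k l : q i j k l + q i k j l + q i l j k = 0. Proof. exact: h_cyc. Qed.

(** The cyclic identities for (i, i, j, j) and (j, j, i, i) share the same mixed value. *)
Let rC i j : q i i j j = q j j i i.
Proof.
have := q_cyc i i j j; have := q_cyc j j i i.
by rewrite (qC1 j i j i) (qC2 i j j i); move: (q i j i j) (q i i j j) (q j j i i) => *; lra.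
Qed.

(* Reflections in basis vectors kill each q i j k l in which some index occurs an
   odd number of times. *)
Lemma sprod_paired_eq0 : (forall i j, i != j -> q i i j j = 0) ->
  forall b, sym_pairs b -> h b = 0.
Proof.
move=> r0 b sb; rewrite (linear4_sprod hl sb).
apply: big1 => i _; apply: big1 => j _; apply: big1 => k _; apply: big1 => l _.
rewrite -/(q i j k l); suff -> : q i j k l = 0 by rewrite mulr0.
have F p := q_flip p i j k l.
have [ij|ij] := eqVneq i j.
  subst j; have [kl|kl] := eqVneq k l.
    subst l; have [ik|ik] := eqVneq i k; last exact: r0.
    by subst k; have := q_cyc i i i i; lra.
  by have := F k; rewrite /sgn_at eqxx (eq_sym l) (negbTE kl); case: ifP => _; lra.
have [kl|kl] := eqVneq k l.
  subst l; have := F i; rewrite /sgn_at eqxx (eq_sym j) (negbTE ij).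
  by case: ifP => _; lra.
have [ki|ki] := eqVneq k i.
  subst k; have [lj|lj] := eqVneq l j.
    subst l; have := q_cyc i i j j; rewrite r0 //.
    by move: (q i j i j) => *; lra.
  have := F j; rewrite /sgn_at eqxx (negbTE ij) (negbTE lj); lra.
have [kj|kj] := eqVneq k j.
  subst k; have [li|li] := eqVneq l i.
    subst l; rewrite (qC2 i j j i); have := q_cyc i i j j; rewrite r0 //.
    by  move: (q i j i j) => *; lra.
  have := F i; rewrite /sgn_at eqxx (eq_sym j) (negbTE ij) (negbTE li); lra.
by have := F k; rewrite /sgn_at eqxx !(eq_sym _ k) (negbTE ki) (negbTE kj) (negbTE kl); lra.
Qed.

(** The reflection in [mixv i k] fixes the j-th basis vector. After expansion, the known zero and a
    value that is odd in i disappear, which leaves be^2 times the wanted value. *)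
Let r_move i j k : i != j -> k != j -> i != k -> q i i j j = 0 -> q k k j j = 0.
Proof.
move=> ij kj ik r0; have [al [be [be0 E]]] := refl_mix R ik.
have jE : act (refl (mixv R i k)) (dl j) = dl j by apply: refl_mix_fix; rewrite eq_sym.
have := h_refl (dl i) (dl i) (dl j) (dl j) (@dot_mixv_neq0 R n i k ik); rewrite jE E.
rewrite -/(q i i j j) r0.
have -> : h (sprod (fun p => al * dl i p + be * dl k p) (fun p => al * dl i p + be * dl k p)
    (dl j) (dl j)) = al ^+ 2 * q i i j j + (2 * al * be) * q i k j j + be ^+ 2 * q k k j j.
  rewrite /q -!(linear4Z hl) -!(linear4D hl); congr h.
  by apply: funext4 => i' j' k' l'; rewrite /sprod; ring.
have -> : q i k j j = 0.
  have := q_flip i i k j j; rewrite /sgn_at eqxx (eq_sym k) (negbTE ik) (eq_sym j) (negbTE ij).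
  lra.
rewrite r0 !mulr0 !add0r => /esym/eqP.
by rewrite mulf_eq0 expf_eq0 /= (negbTE be0) => /eqP.
Qed.

(** Any pair is reached by moving the first index, exchanging the two pairs by [rC], and moving
    again. *)
Lemma sprod_pair_eq0 i0 i1 : i0 != i1 -> q i0 i0 i1 i1 = 0 ->
  forall i j, i != j -> q i i j j = 0.
Proof.
move=> i01 r01.
have A i : i != i1 -> q i i i1 i1 = 0.
  by move=> ii1; have [<-//|i0i] := eqVneq i0 i; exact: r_move r01.
move=> i j ij; have [j1|j1] := eqVneq j i1; first by subst j; exact: A.
have [i1E|ii1] := eqVneq i i1; first by subst i; rewrite rC A // eq_sym.
have r1j : q i1 i1 j j = 0 by rewrite rC A.
by apply: (r_move _ _ _ r1j); rewrite // eq_sym.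
Qed.

End Uniqueness.
End CurvatureFunctional.

(** * Proportionality to the linearized scalar curvature *)

Section CurvatureTerm.
Variables (R : realType) (n m : nat) (L : Yspace R n m -> R).
Hypothesis L_inv : forall (M : manifold R n) (g : lorentz_metric M)
  (D : tensor_field M m), exists f : M -> R, represents L g D f.
Local Notation tens4 := ('I_n -> 'I_n -> 'I_n -> 'I_n -> R).
Local Notation dl := (@basis_vec R n).
Local Notation eta_mx := (Defs.minkowski R n).
Implicit Types (b : tens4) (w A : 'M[R]_n).

Lemma minkowski_lorentzian : lorentzian eta_mx.
Proof.
by split; [exact: tr_diag_mx|exists 1%:M; rewrite ?unitmx1 // trmx1 mulmx1 mul1mx].
Qed.

Lemma minkowski_inv : invmx eta_mx = eta_mx.
Proof.
have u := lorentzian_unit minkowski_lorentzian.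
apply: (can_inj (mulKmx u)); rewrite mulmxV //; apply/matrixP => i j; rewrite !mxE.
transitivity (\sum_k (i == k)%:R * (eta R i * eta R k * (k == j)%:R)).
  by rewrite sum_delta_r eta2 mul1r.
by apply: eq_bigr => k _; rewrite !minkowskiE; ring.
Qed.

Lemma pairing_minkowski x y : pairing eta_mx x y = dot x y.
Proof.
rewrite /pairing /dot minkowski_inv; apply: eq_bigr => i _.
transitivity (\sum_k (i == k)%:R * (eta R k * x i * y k)).
  by apply: eq_bigr => k _; rewrite minkowskiE; case: eqP => [->|_] /=; rewrite ?mul1r ?mul0r.
by rewrite sum_delta_r.
Qed.

(** Both sides are linear in [b], so it suffices to compare them on products, where only the
    invariant [pairing] occurs. *)
Lemma Rlin_GL w A b : w^T = w -> w \in unitmx -> A \in unitmx -> sym_pairs b ->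
  Rlin (A *m w *m A^T) (GLb A b) = Rlin w b.
Proof.
move=> ws uw uA sb; apply/eqP; rewrite -subr_eq0; apply/eqP.
apply: (@linear4_eq0 _ _ (fun b => Rlin (A *m w *m A^T) (GLb A b) - Rlin w b)) => //.
  move=> c b1 b2; rewrite (Rlin_linear4 w).
  have -> : GLb A (fun i j k l => c * b1 i j k l + b2 i j k l) =
     fun i j k l => c * GLb A b1 i j k l + GLb A b2 i j k l.
    apply: funext4 => i j k l; rewrite /GLb mulr_sumr -big_split; apply: eq_bigr => k' _ /=.
    rewrite mulr_sumr -big_split; apply: eq_bigr => l' _ /=.
    have -> : b_mx (fun i j k l => c * b1 i j k l + b2 i j k l) k' l' =
      c *: b_mx b1 k' l' + b_mx b2 k' l' by apply/matrixP => p q; rewrite !mxE.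
    by rewrite mulmxDr mulmxDl -scalemxAr -scalemxAl mxE [X in X + _]mxE; ring.
  by rewrite (Rlin_linear4 _); ring.
move=> x y z t; rewrite GLb_sprod !Rlin_sprod // ?pairing_act ?subrr //.
by rewrite !trmx_mul trmxK ws mulmxA.
Qed.

Hypotheses (L_smooth : smooth_on (@Ydom R n m) L)
  (L_deg2 : forall u v w : Yspace R n m, wmx u = 0 -> wmx v = 0 -> wmx w = 0 ->
      forall y, Ydom y -> 'D_u (fun y1 => 'D_v (fun y2 => 'D_w L y2) y1) y = 0).

Lemma metricY_expansion w : lorentzian w ->
  exists lin bil, quadratic_at L (metricY w) lin bil.
Proof.
move=> lw; apply: quadratic_expansion => //.
by rewrite /Ydom /= /wmx /=; rewrite -unitfE -unitmxE; exact: lorentzian_unit.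
Qed.

(* At the Minkowski metric, subtracting the right multiple of Rlin kills one
   sectional value, hence everything; an orthonormal frame transports the result
   to any other metric, with the same coefficient. *)
Lemma curvature_coefficient : exists rho, forall w lin bil, lorentzian w ->
  quadratic_at L (metricY w) lin bil ->
  forall b, sym_pairs b -> lin (b_Y b) = rho * Rlin w b.
Proof.
have le := minkowski_lorentzian; have ue := lorentzian_unit le.
have [lin0 [bil0 Hq0]] := metricY_expansion le.
suff [rho H] : exists rho, forall b, sym_pairs b -> lin0 (b_Y b) = rho * Rlin eta_mx b.
  exists rho => w lin bil lw Hq b sb; have uw := lorentzian_unit lw.
  have [ws [P uP Pw]] := lw.
  have Hq1 : quadratic_at L (metricY (P *m w *m P^T)) lin0 bil0 by rewrite Pw.
  by rewrite (GL_lin_b L_inv lw uP Hq Hq1 sb) (H _ (GLb_sym P sb)) -Pw Rlin_GL.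
have es : eta_mx^T = eta_mx by case: le.
have lin_refl v x y z t : dot v v != 0 -> lin0 (b_Y (sprod x y z t)) =
    lin0 (b_Y (sprod (act (refl v) x) (act (refl v) y) (act (refl v) z) (act (refl v) t))).
  move=> v0; rewrite -GLb_sprod.
  have Hq1 : quadratic_at L (metricY (refl v *m eta_mx *m (refl v)^T)) lin0 bil0.
    by rewrite refl_minkowski.
  exact: (GL_lin_b L_inv le (refl_unit v0) Hq0 Hq1 (sprod_sym x y z t)).
have lin_cyc x y z t : lin0 (b_Y (sprod x y z t)) + lin0 (b_Y (sprod x z y t)) +
    lin0 (b_Y (sprod x t y z)) = 0.
  apply: (sprod_cyclic (b_linear4 Hq0) le) => T sT.
  by case: (T_balance L_inv le Hq0 (b := fun _ _ _ _ => 0) (fun=> 0) (fun _ _ => 0) _ sT).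
pose h rho b := lin0 (b_Y b) - rho * Rlin eta_mx b.
have hl rho : linear4 (h rho).
  by move=> c b b'; rewrite /h (b_linear4 Hq0) (Rlin_linear4 eta_mx); ring.
have h_cyc rho x y z t :
    h rho (sprod x y z t) + h rho (sprod x z y t) + h rho (sprod x t y z) = 0.
  have E (r l1 l2 l3 x1 x2 x3 : R) : l1 + l2 + l3 = 0 -> x1 + x2 + x3 = 0 ->
      l1 - r * x1 + (l2 - r * x2) + (l3 - r * x3) = 0.
    move=> H1 H2; transitivity ((l1 + l2 + l3) - r * (x1 + x2 + x3)); first by ring.
    by rewrite H1 H2 mulr0 subr0.
  exact: E (lin_cyc x y z t) (Rlin_sprod_cyclic x y z t es).
have h_refl rho v x y z t : dot v v != 0 -> h rho (sprod x y z t) = h rho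
    (sprod (act (refl v) x) (act (refl v) y) (act (refl v) z) (act (refl v) t)).
  move=> v0; rewrite /h -lin_refl //; congr (_ - _ * _).
  by rewrite -GLb_sprod -[in RHS](refl_minkowski v0) Rlin_GL ?refl_unit //; exact: sprod_sym.
have sE rho (H : forall b, sym_pairs b -> h rho b = 0) b : sym_pairs b ->
    lin0 (b_Y b) = rho * Rlin eta_mx b.
  by move=> /H /eqP; rewrite subr_eq0 => /eqP.
(* Without two distinct indices, as for n = 1, the linear part vanishes on all admissible [b], and
   the coefficient 0 serves. *)
have [[i0 [i1 i01]]|no] := pselect (exists i0 i1 : 'I_n, i0 != i1); last first.
  exists 0; apply: sE; apply: (sprod_paired_eq0 (hl 0) (h_cyc 0) (h_refl 0)) => i j ij.
  by case: no; exists i, j.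
pose s := sprod (dl i0) (dl i0) (dl i1) (dl i1).
(* The value is -4 eta_i0 eta_i1, that is 4 or -4. *)
have R0 : Rlin eta_mx s != 0.
  rewrite Rlin_sprod // !pairing_minkowski !dot_dl.
  have -> : dl i0 i1 = 0 by rewrite /basis_vec eq_sym (negbTE i01).
  rewrite {1 2}/basis_vec !eqxx !mulr0 addr0 mulr0 add0r oppr_eq0 !mulr1.
  by rewrite /eta; case: ifP => _; case: ifP => _; apply/eqP; lra.
exists (lin0 (b_Y s) / Rlin eta_mx s); apply: sE.
apply: (sprod_paired_eq0 (hl _) (h_cyc _) (h_refl _)).
apply: (sprod_pair_eq0 (hl _) (h_cyc _) (h_refl _) i01).
by rewrite /h divfK // subrr.
Qed.

End CurvatureTerm.

(** * The scalar curvature in a chart *)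

Section ChartCurvature.
Variables (R : realType) (n : nat) (U : set 'rV[R]_n) (G : 'rV[R]_n -> 'M[R]_n).
Hypotheses (oU : open U) (sG : smooth_on U G)
  (uG : forall y, U y -> G y \in unitmx) (Gs : forall y, U y -> (G y)^T = G y).
Implicit Types (x y : 'rV[R]_n) (i j k l p c : 'I_n).

Definition d1 y i j k := pd k (fun z => G z i j) y.
Definition d2 y i j k l := pd l (pd k (fun z => G z i j)) y.

Lemma pd_near k (f g : 'rV[R]_n -> R) y :
  U y -> (forall z, U z -> f z = g z) -> pd k f y = pd k g y.
Proof.
move=> Uy fg; apply: near_eq_derive.
by apply: filterS (open_nbhs_nbhs (conj oU Uy)) => z Uz; rewrite fg.
Qed.

Lemma smooth_entry i j : smooth_on U (fun z => G z i j : R).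
Proof. by move=> k; exact: Ck_entry. Qed.

Lemma smooth_pd k (f : 'rV[R]_n -> R) : smooth_on U f -> smooth_on U (pd k f).
Proof. by move=> sf j; exact: (sf j.+1).2. Qed.

Lemma smooth_diff (f : 'rV[R]_n -> R) y : smooth_on U f -> U y -> differentiable f y.
Proof. by move=> /(_ 1%N)[+ _]; apply. Qed.

Lemma d1_sym y : U y -> sym12 (d1 y).
Proof. by move=> Uy i j k; apply: pd_near => // z Uz; rewrite -{1}(Gs Uz) mxE. Qed.

Lemma d2_sym y : U y -> sym_pairs (d2 y).
Proof.
move=> Uy; split=> i j k l.
  by apply: pd_near => // z Uz; exact: d1_sym.
by apply: schwarz Uy (smooth_entry i j 2).
Qed.

Lemma smooth_christoffel l i j : smooth_on U (christoffel G l i j).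
Proof.
move=> k; apply: CkM => //; first exact: Ck_cst.
apply: Ck_sum => // p; apply: CkM => //.
  by apply: Ck_entry => //; apply: Ck_invmx => //; exact: sG.
by apply: CkB => //; [apply: CkD => //|]; exact: smooth_pd (smooth_entry _ _) k.
Qed.

Lemma christoffelE y l i j : christoffel G l i j y = chr (G y) (d1 y) l i j.
Proof. by []. Qed.

(* Differentiating the lowered Christoffel symbols avoids the derivative of the
   inverse metric. *)
Lemma pd_christoffel y l i j k : U y -> pd k (christoffel G l i j) y =
  \sum_p invmx (G y) l p * (2^-1 * (d2 y p i j k + d2 y p j i k - d2 y i j p k)
     - \sum_c d1 y p c k * chr (G y) (d1 y) c i j).
Proof.
move=> Uy.
have low p : \sum_c G y p c * pd k (christoffel G c i j) y =
    2^-1 * (d2 y p i j k + d2 y p j i k - d2 y i j p k)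
     - \sum_c d1 y p c k * chr (G y) (d1 y) c i j.
  have E : pd k (fun z => \sum_c G z p c * christoffel G c i j z) y =
      pd k (fun z => 2^-1 * (pd j (fun z => G z p i) z + pd i (fun z => G z p j) z
          - pd p (fun z => G z i j) z)) y.
    by apply: pd_near => // z Uz; exact: (lower_chr (d1 z) p i j (uG Uz)).
  have dd c : differentiable (fun z => G z p c * christoffel G c i j z) y.
    apply: smooth_diff => // h; apply: CkM => //; first exact: smooth_entry.
    exact: smooth_christoffel.
  have L1 : pd k (fun z => \sum_c G z p c * christoffel G c i j z) y =
    \sum_c (d1 y p c k * christoffel G c i j y + G y p c * pd k (christoffel G c i j) y).
    apply: etrans (derive_sum_fun _ _ _ dd) _; apply: eq_bigr => c _.
    apply: deriveM_fun; first exact: smooth_diff (smooth_entry _ _) Uy.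
    exact: smooth_diff (smooth_christoffel _ _ _) Uy.
  have df i' j' k' : differentiable (pd k' (fun z => G z i' j')) y.
    exact: smooth_diff (smooth_pd _ (smooth_entry _ _)) Uy.
  have R1 : pd k (fun z => 2^-1 * (pd j (fun z => G z p i) z + pd i (fun z => G z p j) z
          - pd p (fun z => G z i j) z)) y =
     2^-1 * (d2 y p i j k + d2 y p j i k - d2 y i j p k).
    have dA := df p i j; have dB := df p j i; have dC := df i j p.
    rewrite /d2; move: (pd j _) (pd i _) (pd p _) dA dB dC => A B C dA dB dC.
    have dAB : differentiable (fun z => A z + B z) y by exact: differentiableD.
    have dABC : differentiable (fun z => A z + B z - C z) y by exact: differentiableB.
    apply: etrans (deriveZ_fun _ _ dABC) _; congr (_ * _).
    apply: etrans (deriveB_fun _ dAB dC) _; congr (_ - _).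
    exact: deriveD_fun.
  by rewrite -R1 -E L1 big_split /= [X in X - _]addrC addrK.
have := congr1 (fun A : 'M[R]_(n, 1) => A l 0) (mulmxA (invmx (G y)) (G y)
  (\col_c pd k (christoffel G c i j) y)).
rewrite mulVmx ?uG // mul1mx !mxE => <-; apply: eq_bigr => p _; rewrite mxE -low.
by congr (_ * _); apply: eq_bigr => c _; rewrite mxE.
Qed.

Lemma nabla_coord k i y : nabla G k (@coord_vf R n i) y = \row_l christoffel G l k i y.
Proof.
apply/rowP => l; rewrite !mxE /coord_vf.
have -> : pd k (fun=> (delta_mx 0 i : 'rV[R]_n) 0 l) y = 0 by exact: derive_cst.
rewrite add0r; transitivity (\sum_p (i == p)%:R * christoffel G l k p y).
  by apply: eq_bigr => p _; rewrite mxE eqxx mulrC eq_sym.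
exact: sum_delta_r.
Qed.

Lemma ricciE i j y : ricci G i j y = \sum_k
  (pd k (christoffel G k j i) y + \sum_p christoffel G k k p y * christoffel G p j i y
   - (pd j (christoffel G k k i) y + \sum_p christoffel G k j p y * christoffel G p k i y)).
Proof.
apply: eq_bigr => k _; rewrite mxE [X in _ + X]mxE.
have E k' j' : nabla G k' (nabla G j' (@coord_vf R n i)) y 0 k =
    pd k' (christoffel G k j' i) y + \sum_p christoffel G k k' p y * christoffel G p j' i y.
  have H c z : nabla G j' (@coord_vf R n i) z 0 c = christoffel G c j' i z.
    by rewrite nabla_coord mxE.
  rewrite {1}/nabla [LHS]mxE; congr (_ + _).
    by congr (pd k' _ y); apply/funext => z; exact: H.
  by apply: eq_bigr => p _; rewrite H.
by congr (_ - _); exact: E.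
Qed.

Section AtPoint.
Variable y : 'rV[R]_n.
Hypotheses (Uy : U y) (lw : lorentzian (G y)).
Local Notation V := (invmx (G y)).
Local Notation Gam := (chr (G y) (d1 y)).

(** Full contraction with two copies of the inverse metric. The swap lemmas are its symmetries; they
    let curvature terms be matched without reopening the sums. *)
Definition S4 (F : 'I_n -> 'I_n -> 'I_n -> 'I_n -> R) : R :=
  \sum_i \sum_j \sum_k \sum_p V i j * V k p * F i j k p.

Let Vs i j : V i j = V j i.
Proof. by rewrite -[in LHS](Gs Uy) -trmx_inv mxE. Qed.

Lemma S4_ext F F' : (forall i j k p, F i j k p = F' i j k p) -> S4 F = S4 F'.
Proof. by move=> E; congr S4; exact: funext4. Qed.

Lemma S4D F F' : S4 (fun i j k p => F i j k p + F' i j k p) = S4 F + S4 F'.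
Proof.
rewrite /S4 -big_split; apply: eq_bigr => i _; rewrite -big_split; apply: eq_bigr => j _ /=.
rewrite -big_split; apply: eq_bigr => k _; rewrite -big_split; apply: eq_bigr => p _ /=.
by rewrite mulrDr.
Qed.

Lemma S4Z (r : R) F : S4 (fun i j k p => r * F i j k p) = r * S4 F.
Proof.
rewrite /S4 mulr_sumr; apply: eq_bigr => i _; rewrite mulr_sumr; apply: eq_bigr => j _ /=.
rewrite mulr_sumr; apply: eq_bigr => k _; rewrite mulr_sumr; apply: eq_bigr => p _ /=.
by rewrite mulrCA.
Qed.

Lemma S4B F F' : S4 (fun i j k p => F i j k p - F' i j k p) = S4 F - S4 F'.
Proof.
rewrite -[X in _ - X]mul1r -mulNr -S4Z -S4D.
by apply: S4_ext => i j k p; rewrite mulN1r.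
Qed.

Lemma S4_comb F1 F2 F3 F4 F5 F6 F7 F8 :
  S4 (fun i j k p => 2^-1 * (F1 i j k p + F2 i j k p - F3 i j k p) - F4 i j k p
    - (2^-1 * (F5 i j k p + F6 i j k p - F7 i j k p) - F8 i j k p)) =
  2^-1 * (S4 F1 + S4 F2 - S4 F3) - S4 F4 - (2^-1 * (S4 F5 + S4 F6 - S4 F7) - S4 F8).
Proof. by rewrite !S4B !S4Z !S4B !S4D. Qed.

Lemma S4_swap12 F : S4 F = S4 (fun i j k p => F j i k p).
Proof.
rewrite {1}/S4 exchange_big; apply: eq_bigr => j _; apply: eq_bigr => i _ /=.
by apply: eq_bigr => k _; apply: eq_bigr => p _; rewrite Vs.
Qed.

Lemma S4_swap34 F : S4 F = S4 (fun i j k p => F i j p k).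
Proof.
apply: eq_bigr => i _; apply: eq_bigr => j _ /=.
rewrite exchange_big; apply: eq_bigr => k _; apply: eq_bigr => p _ /=.
by rewrite (Vs k p).
Qed.

Lemma S4_swap_pairs F : S4 F = S4 (fun i j k p => F k p i j).
Proof.
transitivity (\sum_i \sum_k \sum_j \sum_p V i j * V k p * F i j k p).
  by apply: eq_bigr => i _; rewrite exchange_big.
rewrite exchange_big; apply: eq_bigr => k _ /=.
transitivity (\sum_i \sum_p \sum_j V i j * V k p * F i j k p).
  by apply: eq_bigr => i _; rewrite exchange_big.
rewrite exchange_big; apply: eq_bigr => p _ /=.
by apply: eq_bigr => i _; apply: eq_bigr => j _; rewrite [V i j * _]mulrC.
Qed.

(** The inner product in the metric of the vectors Gamma_ij and Gamma_kl. *)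
Definition BG i j k l : R := \sum_a \sum_c G y a c * (Gam a i j * Gam c k l).

Let Gam_sym : sym2 Gam. Proof. exact/chr_sym/d1_sym. Qed.

Let BG1 i j k l : BG i j k l = BG j i k l.
Proof. by apply: eq_bigr => a _; apply: eq_bigr => c _; rewrite (Gam_sym a i j). Qed.

Let BG2 i j k l : BG i j k l = BG k l i j.
Proof.
rewrite /BG exchange_big; apply: eq_bigr => c _; apply: eq_bigr => a _ /=.
have -> : G y a c = G y c a by rewrite -{1}(Gs Uy) mxE.
by rewrite [Gam a _ _ * _]mulrC.
Qed.

Let g p k c := \sum_e G y p e * Gam e k c.

Let raise k c k' : Gam k k' c = \sum_p V k p * g p k' c.
Proof.
have := congr1 (fun A : 'M[R]_(n, 1) => A k 0)
  (mulmxA V (G y) (\col_p Gam p k' c)).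
rewrite mulVmx ?uG // mul1mx !mxE => <-; apply: eq_bigr => p _; rewrite mxE.
by congr (_ * _); apply: eq_bigr => e _; rewrite mxE.
Qed.

(** By metric compatibility g_pc,k splits into two lowered Christoffel symbols; one of them cancels
    against the quadratic term of the Ricci curvature. *)
Let quadratic_part p k j i :
  \sum_c g p k c * Gam c j i - \sum_c d1 y p c k * Gam c j i = - BG p k j i.
Proof.
rewrite -sumrB /BG exchange_big -sumrN; apply: eq_bigr => c _.
rewrite -[d1 y p c k](congr1 (fun f => f p c k) (dS_chr lw (d1_sym Uy))) /dS big_split /=.
have -> : \sum_a G y p a * Gam a c k = g p k c.
  by apply: eq_bigr => a _; rewrite Gam_sym.
rewrite mulrDl opprD addrCA subrr addr0; congr (- _); rewrite mulr_suml.
by apply: eq_bigr => a _; ring.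
Qed.

Let alg (a v h1 t1 s1 h2 t2 s2 : R) :
    a * (v * (h1 - t1) + v * s1 - (v * (h2 - t2) + v * s2)) =
    a * v * (h1 + (s1 - t1) - (h2 + (s2 - t2))).
Proof. ring. Qed.

Let alg2 (u v e s t : R) : u = s + t -> v = e + s -> e = s -> u - v = t - s.
Proof. by move=> -> -> ->; ring. Qed.

Let alg3 (x1 x1' x2 x2' x2'' x3 x3' t s : R) :
  x1' = x1 -> x2' = x2 -> x2'' = x2 -> x3' = x3 ->
  2^-1 * (x1' + x1 - x2') - t - (2^-1 * (x2'' + x3' - x3) - s) = x1 - x2 - (t - s).
Proof. by move=> -> -> -> ->; field. Qed.

(* The Christoffel terms enter as the value of Rlin on the second derivatives
   SS of a metric that is flat to second order: subtracting them normalizes the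
   first derivatives to 0. *)
Lemma scalar_curvE :
  scalar_curv G y = Rlin (G y) (d2 y) - Rlin (G y) (SS (G y) Gam).
Proof.
have [b1 b2] := d2_sym Uy; set b := d2 y in b1 b2 *.
have -> : scalar_curv G y = S4 (fun i j k p =>
    2^-1 * (b p j i k + b p i j k - b j i p k) - BG p k j i
    - (2^-1 * (b p k i j + b p i k j - b k i p j) - BG p j k i)).
  apply: eq_bigr => i _; apply: eq_bigr => j _; rewrite ricciE mulr_sumr.
  apply: eq_bigr => k _.
  have -> : \sum_p christoffel G k k p y * christoffel G p j i y =
      \sum_p V k p * \sum_c g p k c * Gam c j i.
    transitivity (\sum_c Gam k k c * Gam c j i); first by [].
    rewrite (eq_bigr (fun c => \sum_p V k p * (g p k c * Gam c j i))); last first.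
      by move=> c _; rewrite raise mulr_suml; apply: eq_bigr => p _; exact: esym (mulrA _ _ _).
    by rewrite exchange_big; apply: eq_bigr => p _; rewrite mulr_sumr.
  have -> : \sum_p christoffel G k j p y * christoffel G p k i y =
      \sum_p V k p * \sum_c g p j c * Gam c k i.
    transitivity (\sum_c Gam k j c * Gam c k i); first by [].
    rewrite (eq_bigr (fun c => \sum_p V k p * (g p j c * Gam c k i))); last first.
      by move=> c _; rewrite raise mulr_suml; apply: eq_bigr => p _; exact: esym (mulrA _ _ _).
    by rewrite exchange_big; apply: eq_bigr => p _; rewrite mulr_sumr.
  rewrite !pd_christoffel // -!big_split -sumrB mulr_sumr; apply: eq_bigr => p _ /=.
  rewrite -!quadratic_part /ginv -/b.
  exact: alg.
have -> : Rlin (G y) b = S4 (fun i j k p => b p i j k) - S4 (fun i j k p => b i j p k).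
  exact: (S4B (fun i j k p => b p i j k) (fun i j k p => b i j p k)).
have SE i j k l : SS (G y) Gam i j k l = BG i k j l + BG i l j k.
  rewrite /BG -big_split; apply: eq_bigr => a _; rewrite -big_split; apply: eq_bigr => c _ /=.
  by ring.
have -> : Rlin (G y) (SS (G y) Gam) = S4 (fun i j k p => BG p k j i) - S4 (fun i j k p => BG p j k i).
  have E1 : S4 (fun i j k p => BG i p j k) = S4 (fun i j k p => BG p j k i).
    rewrite S4_swap34; apply: S4_ext => i j k p.
    by rewrite BG2 (BG1 j p) BG2 (BG1 i k) BG2.
  have -> : Rlin (G y) (SS (G y) Gam) = S4 (fun i j k p =>
      (BG p j k i + BG p k j i) - (BG i p j k + BG p j k i)).
    apply: S4_ext => i j k p; rewrite !SE.
    have -> : BG p j i k = BG p j k i by rewrite BG2 BG1 BG2.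
    have -> : BG p k i j = BG p k j i by rewrite BG2 BG1 BG2.
    by have -> : BG i k j p = BG p j k i by rewrite BG2 (BG1 j p) BG2 (BG1 i k) BG2.
  etransitivity; first exact: (S4B (fun i j k p => BG p j k i + BG p k j i)
     (fun i j k p => BG i p j k + BG p j k i)).
  exact: alg2 (S4D _ _) (S4D _ _) E1.
etransitivity; first exact: (S4_comb (fun i j k p => b p j i k) (fun i j k p => b p i j k)
  (fun i j k p => b j i p k) (fun i j k p => BG p k j i) (fun i j k p => b p k i j)
  (fun i j k p => b p i k j) (fun i j k p => b k i p j) (fun i j k p => BG p j k i)).
(* By the symmetries of [b] and of the contraction, the second-derivative terms reduce to [x1], [x2]
   and a cancelling pair [x3], [x3']. *)
apply: alg3.
- exact: S4_swap12.
- by apply: S4_ext => *; exact: b1.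
- by etransitivity; [exact: S4_swap_pairs|apply: S4_ext => i j k p; rewrite b1 b2].
- exact: S4_swap34.
Qed.

End AtPoint.
End ChartCurvature.

(** * The exterior derivative term *)

Section Tuples.
Variables (n m : nat).
Implicit Types (I J : m.-tuple 'I_n) (K : m.+1.-tuple 'I_n) (i j k p c : 'I_n).

Definition front K : m.-tuple 'I_n := [tuple tnth K (widen_ord (leqnSn m) t) | t < m].
Definition rc I k : m.+1.-tuple 'I_n := [tuple of rcons I k].

Lemma rc_last I k : tnth (rc I k) ord_max = k.
Proof. by rewrite (tnth_nth k) /= nth_rcons size_tuple ltnn eqxx. Qed.

Lemma rc_front I k : front (rc I k) = I.
Proof.
apply: eq_from_tnth => s; rewrite tnth_mktuple (tnth_nth k) /= nth_rcons size_tuple ltn_ord.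
by rewrite -tnth_nth.
Qed.

Lemma frontK K : rc (front K) (tnth K ord_max) = K.
Proof.
apply: eq_from_tnth => s; case: (unliftP ord_max s) => [t ->|->]; last by rewrite rc_last.
have -> : lift ord_max t = widen_ord (leqnSn m) t.
  by apply: val_inj; rewrite /= /bump leqNgt ltn_ord.
transitivity (tnth (front (rc (front K) (tnth K ord_max))) t); first by rewrite tnth_mktuple.
by rewrite rc_front tnth_mktuple.
Qed.

Lemma rc_eq I J i j : (rc I i == rc J j) = (I == J) && (i == j).
Proof.
apply/eqP/andP => [E|[/eqP-> /eqP->]//].
by rewrite -(rc_front I i) E rc_front -{1}(rc_last I i) E rc_last !eqxx.
Qed.

(** Both sides say that [I] and [J] differ at most at the place u, where they have the entries c and
    p. *)
Lemma upd_eq I J u p c :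
  (tnth J u == p) && (upd J u c == I) = (tnth I u == c) && (J == upd I u p).
Proof.
apply/andP/andP => -[/eqP E1 /eqP E2].
  subst I; rewrite tnth_upd eqxx; split=> //; apply/eqP/eq_from_tnth => t.
  by rewrite !tnth_upd; case: eqP => // ->.
subst J; rewrite tnth_upd eqxx; split=> //; apply/eqP/eq_from_tnth => t.
by rewrite !tnth_upd; case: eqP => // ->.
Qed.

End Tuples.

(** * Invariant symmetric forms that annihilate the tensors [Sd S d] *)

Section AlternatingUniqueness.
Variables (R : realType) (n m : nat).
Local Notation tq := (m.+1.-tuple 'I_n -> R).
Local Notation dl := (@basis_vec R n).
Implicit Types (F : tq) (I J : m.-tuple 'I_n) (K : m.+1.-tuple 'I_n) (i j k p c : 'I_n).

Variable H : tq -> tq -> R.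
Hypotheses (Hl : forall r F F' F2, H (fun K => r * F K + F' K) F2 = r * H F F2 + H F' F2)
  (Hs : forall F F', H F F' = H F' F)
  (HSd : forall F S d, sym2 S -> H F (fun K => Sd S d (front K) (tnth K ord_max)) = 0)
  (Hr : forall v F, dot v v != 0 ->
     H (tens_change (refl v)^T F) (tens_change (refl v)^T F) = H F F).

Definition delta K : tq := fun K' => (K' == K)%:R.

Let H0 F : H (fun=> 0) F = 0.
Proof.
have := Hl 1 (fun=> 0) (fun=> 0) F.
have -> : (fun K : m.+1.-tuple 'I_n => 1 * 0 + 0) = (fun=> 0 : R) by apply/funext => K; rewrite mulr0 addr0.
lra.
Qed.

Let HD F F' F2 : H (fun K => F K + F' K) F2 = H F F2 + H F' F2.
Proof.
have := Hl 1 F F' F2; rewrite mul1r => <-; congr H.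
by apply/funext => K; rewrite mul1r.
Qed.

Let HZ r F F2 : H (fun K => r * F K) F2 = r * H F F2.
Proof.
have := Hl r F (fun=> 0) F2; rewrite H0 addr0 => <-; congr H.
by apply/funext => K; rewrite addr0.
Qed.

Let Hsum (T : Type) (r : seq T) (P : pred T) (F : T -> tq) F2 :
  H (fun K => \sum_(a <- r | P a) F a K) F2 = \sum_(a <- r | P a) H (F a) F2.
Proof.
elim: r => [|a r IH].
  rewrite big_nil -[RHS](H0 F2); congr H.
  by apply/funext => K; rewrite big_nil.
rewrite big_cons; case: ifP => Pa; rewrite -IH -?HD; congr H;
  by apply/funext => K; rewrite big_cons Pa.
Qed.

Let H_expand F F2 : H F F2 = \sum_K F K * H (delta K) F2.
Proof.
rewrite -(eq_bigr _ (fun K _ => HZ _ _ _)) -Hsum; congr H; apply/funext => K.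
rewrite (bigD1 K) //= /delta eqxx mulr1 big1 ?addr0 // => K' K'K.
by rewrite eq_sym (negbTE K'K) mulr0.
Qed.

Section Vanishing.
Variable F : tq.
Let om K := H F (delta K).

Let om_rel I p q c : \sum_(u < m | tnth I u == c)
  (om (rc (upd I u p) q) + om (rc (upd I u q) p)) = 0.
Proof.
pose S a i j : R := (a == c)%:R * ((i == p)%:R * (j == q)%:R + (i == q)%:R * (j == p)%:R).
have sS : sym2 S by move=> a i j; rewrite /S; ring.
rewrite -[RHS](@HSd F S (fun J => (J == I)%:R) sS) Hs.
have -> : (fun K => Sd S (fun J => (J == I)%:R) (front K) (tnth K ord_max)) =
   fun K => \sum_(u < m | tnth I u == c)
     (delta (rc (upd I u p) q) K + delta (rc (upd I u q) p) K).
  apply/funext => K; rewrite -[in RHS](frontK K); set J := front K; set k := tnth K ord_max.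
  rewrite /Sd [RHS]big_mkcond; apply: eq_bigr => u _.
  have -> : \sum_a S a (tnth J u) k * (upd J u a == I)%:R =
     ((tnth J u == p) && (upd J u c == I))%:R * (k == q)%:R +
     ((tnth J u == q) && (upd J u c == I))%:R * (k == p)%:R.
    rewrite (bigD1 c) //= big1 => [|a ac]; last by rewrite /S (negbTE ac) !mul0r.
    rewrite /S eqxx addr0 mul1r -!mulnb !natrM; ring.
  rewrite !upd_eq /delta !rc_eq; case: (tnth I u == c) => /=; last by rewrite !mul0r addr0.
  by rewrite -!mulnb !natrM.
by rewrite Hsum; apply: eq_bigr => u _; rewrite HD /om !(Hs F).
Qed.

(** In [om_rel] with p = q = c the summands coincide and at least one is present, so their common
    value is 0. *)
Let om_last I u : om (rc I (tnth I u)) = 0.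
Proof.
have := om_rel I (tnth I u) (tnth I u) (tnth I u).
rewrite (eq_bigr (fun=> om (rc I (tnth I u)) + om (rc I (tnth I u)))); last first.
  move=> v /eqP vu; suff -> : upd I v (tnth I u) = I by [].
  by apply: eq_from_tnth => t; rewrite tnth_upd; case: eqP => // ->.
rewrite sumr_const -mulr2n -mulrnA => /eqP; rewrite mulrn_eq0 muln_eq0.
case/orP => [/orP[//|/eqP/card0_eq/(_ u) E]|/eqP//].
by have : tnth I u == tnth I u = false := E; rewrite eqxx.
Qed.

(** In [om_rel] with p = c the first halves of the summands coincide. The second halves still carry
    the repeated value, now also in the last place, and vanish by [om_last]. *)
Let om_front I k u v : u != v -> tnth I u = tnth I v -> om (rc I k) = 0.
Proof.
move=> uv E; have := om_rel I (tnth I u) k (tnth I u).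
rewrite (eq_bigr (fun=> om (rc I k))); last first.
  move=> t /eqP tu; have -> : upd I t (tnth I u) = I.
    by apply: eq_from_tnth => s; rewrite tnth_upd; case: eqP => // ->.
  suff [s sE] : exists s, tnth (upd I t k) s = tnth I u.
    by rewrite -sE om_last addr0.
  have [tE|tu'] := eqVneq t u; first by exists v; rewrite tnth_upd tE eq_sym (negbTE uv).
  by exists u; rewrite tnth_upd eq_sym (negbTE tu').
rewrite sumr_const => /eqP; rewrite mulrn_eq0.
case/orP => [/eqP/card0_eq/(_ u) E0|/eqP//].
by have : tnth I u == tnth I u = false := E0; rewrite eqxx.
Qed.

(* om_rel is HSd for S a symmetrized elementary tensor and d = delta_I. *)
Lemma alternating_noninj K : ~ injective (tnth K) -> om K = 0.
Proof.
move=> nK; suff [s [t [st E]]] : exists s t, s != t /\ tnth K s = tnth K t.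
  have wE u : lift ord_max u = widen_ord (leqnSn m) u.
    by apply: val_inj; rewrite /= /bump leqNgt ltn_ord.
  have fE u : tnth K (lift ord_max u) = tnth (front K) u by rewrite tnth_mktuple wE.
  rewrite -(frontK K); move: st E.
  case: (unliftP ord_max s) => [s' ->|->]; case: (unliftP ord_max t) => [t' ->|->].
  - by rewrite (inj_eq lift_inj) !fE => st; exact: om_front.
  - by rewrite fE => _ <-; exact: om_last.
  - by rewrite fE => _ ->; exact: om_last.
  - by rewrite eqxx.
apply: contrapT => no; apply: nK => s t E; apply: contrapT => st; apply: no.
by exists s, t; split=> //; apply/eqP.
Qed.

Definition permt (rho : 'S_m.+1) K := [tuple tnth K (rho t) | t < m.+1].

(** For an injective multi-index [om_rel] has a single summand: exchanging the last entry with
    another one changes the sign. *)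
Let om_star K u : injective (tnth K) ->
  om (permt (tperm (lift ord_max u) ord_max) K) = - om K.
Proof.
move=> iK; have wE v : lift ord_max v = widen_ord (leqnSn m) v.
  by apply: val_inj; rewrite /= /bump leqNgt ltn_ord.
have fE v : tnth (front K) v = tnth K (lift ord_max v) by rewrite tnth_mktuple wE.
set I := front K; set q := tnth K ord_max.
have := om_rel I (tnth I u) q (tnth I u).
rewrite (big_pred1 u) => [|v]; last first.
  by rewrite /= !fE (inj_eq iK) (inj_eq lift_inj).
have -> : upd I u (tnth I u) = I.
  by apply: eq_from_tnth => s; rewrite tnth_upd; case: eqP => // ->.
rewrite frontK => E; rewrite -[RHS]addr0 -[in RHS]E addKr; congr om.
apply: eq_from_tnth => t; rewrite tnth_mktuple.
case: (unliftP ord_max t) => [v ->|->]; last by rewrite tpermR rc_last fE.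
have -> : tnth (rc (upd I u q) (tnth I u)) (lift ord_max v) = tnth (upd I u q) v.
  transitivity (tnth (front (rc (upd I u q) (tnth I u))) v); last by rewrite rc_front.
  by rewrite [RHS]tnth_mktuple wE.
rewrite tnth_upd; case: (eqVneq v u) => [->|vu]; first by rewrite tpermL.
have D1 : lift ord_max u != lift ord_max v by rewrite (inj_eq lift_inj) eq_sym.
by rewrite (tpermD D1 (neq_lift _ _)) -fE.
Qed.

Lemma permt_inj rho K : injective (tnth K) -> injective (tnth (permt rho K)).
Proof. by move=> iK s t; rewrite !tnth_mktuple => /iK /perm_inj. Qed.

Lemma permtM rho rho' K : permt (rho * rho')%g K = permt rho (permt rho' K).
Proof. by apply: eq_from_tnth => t; rewrite !tnth_mktuple permM. Qed.

(** Transpositions with the last place generate all permutations: (u v) is a product of three of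
    them. *)
Lemma alternating_perm rho K : injective (tnth K) -> om K = 0 -> om (permt rho K) = 0.
Proof.
have star u K' : injective (tnth K') -> om K' = 0 ->
    om (permt (tperm u ord_max) K') = 0.
  move=> iK oK; case: (unliftP ord_max u) => [v ->|->]; first by rewrite om_star // oK oppr0.
  rewrite tperm1; suff -> : permt 1 K' = K' by [].
  by apply: eq_from_tnth => t; rewrite tnth_mktuple perm1.
have transp u v K' : injective (tnth K') -> om K' = 0 -> om (permt (tperm u v) K') = 0.
  move=> iK oK; have [->|uv] := eqVneq u v.
    rewrite tperm1; suff -> : permt 1 K' = K' by [].
    by apply: eq_from_tnth => t; rewrite tnth_mktuple perm1.
  have [->|um] := eqVneq v ord_max; first exact: star.
  have [->|vm] := eqVneq u ord_max; first by rewrite tpermC; exact: star.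
  have -> : tperm u v = (tperm v ord_max * (tperm u ord_max * tperm v ord_max))%g.
    rewrite -[X in (X * _)%g]tpermV -conjgE tpermJ [tperm v ord_max _]tpermD ?tpermR //.
      by rewrite eq_sym.
    by rewrite eq_sym.
  rewrite permtM; apply: (star); first exact: permt_inj.
  by rewrite permtM; apply: (star); [exact: permt_inj|exact: star].
have [ts -> _] := prod_tpermP rho.
elim: ts K => [|[u v] ts IH] K iK oK.
  rewrite big_nil; suff -> : permt 1 K = K by [].
  by apply: eq_from_tnth => t; rewrite tnth_mktuple perm1.
by rewrite big_cons permtM; apply: (transp); [exact: permt_inj|exact: IH].
Qed.

End Vanishing.

Let H_polar v F F' : dot v v != 0 ->
  H (tens_change (refl v)^T F) (tens_change (refl v)^T F') = H F F'.
Proof.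
move=> v0; set T := tens_change _.
have TD f g : T (fun K => f K + g K) = fun K => T f K + T g K.
  apply/funext => K; rewrite /T /tens_change -big_split; apply: eq_bigr => J _ /=.
  by rewrite mulrDl.
have := Hr (fun K => F K + F' K) v0; rewrite -/T TD !HD !(Hs _ (fun K => _ + _)) !HD.
by rewrite !Hr // !(Hs (T F') (T F)) !(Hs F' F); lra.
Qed.

Lemma tens_change_delta (A : 'M[R]_n) K :
  tens_change A^T (delta K) = fun K' => \prod_s act A (dl (tnth K s)) (tnth K' s).
Proof.
apply/funext => K'; rewrite /tens_change (bigD1 K) //= /delta eqxx mul1r.
rewrite [X in _ + X]big1 ?addr0 => [|J JK]; last by rewrite (negbTE JK) mul0r.
by apply: eq_bigr => s _; rewrite act_dl mxE.
Qed.

Lemma deltaE K K' : delta K K' = \prod_s dl (tnth K s) (tnth K' s).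
Proof.
rewrite /delta /basis_vec; have [->|ne] := eqVneq K' K.
  by rewrite big1 // => s _; rewrite eqxx.
have : [exists s, tnth K' s != tnth K s].
  by apply: contraR ne => /existsPn H1; apply/eqP/eq_from_tnth => s; have := H1 s; rewrite negbK => /eqP.
by move=> /existsP[s Ks]; rewrite (bigD1 s) //= (negbTE Ks) mul0r.
Qed.

Let flip_delta p K : tens_change (refl (dl p))^T (delta K) =
  fun K' => (\prod_s sgn_at R p (tnth K s)) * delta K K'.
Proof.
rewrite tens_change_delta; apply/funext => K'; rewrite deltaE -big_split.
by apply: eq_bigr => s _ /=; rewrite refl_flip.
Qed.

Let sgn_inj p K s : injective (tnth K) -> tnth K s = p ->
  \prod_s sgn_at R p (tnth K s) = -1.
Proof.
move=> iK Ks; rewrite (bigD1 s) //= /sgn_at Ks eqxx big1 ?mulr1 // => t ts.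
by rewrite -Ks (inj_eq iK) (negbTE ts).
Qed.

Let sgn_out p K : (forall s, tnth K s != p) -> \prod_s sgn_at R p (tnth K s) = 1.
Proof. by move=> Kp; rewrite big1 // => s _; rewrite /sgn_at (negbTE (Kp s)). Qed.

(** Reflection in a basis vector that occurs once in [K] and not in [K'] reverses the sign of
    exactly one argument. *)
Let cross K K' s : injective (tnth K) -> (forall t, tnth K' t != tnth K s) ->
  H (delta K) (delta K') = 0.
Proof.
move=> iK K's; have := H_polar (delta K) (delta K') (@dot_dl_neq0 R n (tnth K s)).
by rewrite !flip_delta (sgn_inj iK erefl) (sgn_out K's) HZ Hs HZ Hs; lra.
Qed.

Let perm_exists K K' : injective (tnth K) -> injective (tnth K') ->
  (forall t, exists s, tnth K s = tnth K' t) -> exists rho, K' = permt rho K.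
Proof.
move=> iK iK' H1; have [f fE] := choice H1.
have fi : injective f by move=> s t st; apply: iK'; rewrite -!fE st.
exists (perm fi); apply: eq_from_tnth => t; by rewrite tnth_mktuple permE fE.
Qed.

Let H_comb2 (al be : R) F F' :
  H (fun K => al * F K + be * F' K) (fun K => al * F K + be * F' K) =
  al ^+ 2 * H F F + 2 * al * be * H F F' + be ^+ 2 * H F' F'.
Proof.
rewrite HD !HZ !(Hs _ (fun K => _ + _)) !HD !HZ (Hs F' F).
by move: (H F F) (H F F') (H F' F') => *; ring.
Qed.

Let diag0 K := H (delta K) (delta K) = 0.

Let diag_perm K rho : injective (tnth K) -> diag0 K -> diag0 (permt rho K).
Proof.
move=> iK dK; apply: (alternating_perm rho iK).
by rewrite Hs; exact: (alternating_perm rho iK).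
Qed.

(** The reflection in [mixv] sends the basis tensor of [K] to a combination with that of the new
    index. The mixed value is 0 by [cross], so be^2 times the new diagonal value is 0. *)
Let diag_move K s k : injective (tnth K) -> (forall t, tnth K t != k) ->
  diag0 K -> diag0 (upd K s k).
Proof.
move=> iK Kk dK; have ik : tnth K s != k by exact: Kk.
have iK' : injective (tnth (upd K s k)).
  move=> t t'; rewrite !tnth_upd; case: eqP => [->|ts]; case: eqP => [->|t's] //.
  - by move=> /esym/eqP; rewrite (negbTE (Kk t')).
  - by move=> /eqP; rewrite (negbTE (Kk t)).
  - exact: iK.
have [al [be [be0 E]]] := refl_mix R ik.
have := H_polar (delta K) (delta K) (@dot_mixv_neq0 R n _ _ ik).
have -> : tens_change (refl (mixv R (tnth K s) k))^T (delta K) =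
    fun K' => al * delta K K' + be * delta (upd K s k) K'.
  have dE K2 K' : delta K2 K' = dl (tnth K2 s) (tnth K' s) *
      \prod_(t | t != s) dl (tnth K2 t) (tnth K' t) by rewrite deltaE (bigD1 s).
  rewrite tens_change_delta; apply/funext => K'; rewrite !dE (bigD1 s) //= E tnth_upd eqxx.
  set p1 := \prod_(i | _) _; set p2 := \prod_(i | _) _; set p3 := \prod_(i | _) _.
  have -> : p1 = p2.
    apply: eq_bigr => t ts; rewrite refl_mix_fix // (inj_eq iK) //.
  have -> : p3 = p2 by apply: eq_bigr => t ts; rewrite tnth_upd (negbTE ts).
  ring.
have c0 : H (delta (upd K s k)) (delta K) = 0.
  by apply: (@cross _ _ s iK') => t; rewrite tnth_upd eqxx.
rewrite H_comb2 dK (Hs (delta K)) c0 !mulr0 !add0r => /eqP.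
by rewrite mulf_eq0 expf_eq0 /= (negbTE be0) => /eqP.
Qed.

(** Two injective multi-indices either differ by a permutation, which reduces to the diagonal, or
    one has a value absent from the other, and [cross] applies. *)
Lemma alternating_eq0 F : (forall K, injective (tnth K) -> diag0 K) -> H F F = 0.
Proof.
move=> D; rewrite H_expand big1 // => K _; rewrite Hs H_expand big1 ?mulr0 // => K' _.
have [iK'|nK'] := pselect (injective (tnth K')); last first.
  by rewrite Hs alternating_noninj // mulr0.
have [iK|nK] := pselect (injective (tnth K)); last by rewrite alternating_noninj // mulr0.
have [sub|nsub] := pselect (forall t, exists s, tnth K s = tnth K' t).
  have [rho ->] := perm_exists iK iK' sub.
  by rewrite Hs (alternating_perm rho iK) ?mulr0 //; exact: D.
have [t Kt] : exists t, forall s, tnth K s != tnth K' t.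
  apply: contrapT => no; apply: nsub => t; apply: contrapT => nt; apply: no.
  by exists t => s; apply/eqP => st; apply: nt; exists s.
by rewrite (cross iK' Kt) mulr0.
Qed.

(* Any two injective multi-indices are joined by permutations and by replacements
   of one entry by a missing value. *)
Lemma alternating_diag K0 : injective (tnth K0) -> diag0 K0 ->
  forall K, injective (tnth K) -> diag0 K.
Proof.
move=> i0 d0 K1 i1.
(* Induction on the number of entries of [K1] absent from [K]; each replacement lowers it. *)
pose miss K := #|[pred s | [forall t, tnth K t != tnth K1 s]]|.
move: {-1}(miss K0) (leqnn (miss K0)) => N; elim: N K0 i0 d0 => [|N IH] K iK dK.
all: have [sub|nsub] := pselect (forall t, exists s, tnth K s = tnth K1 t);
  first by have [rho ->] := perm_exists iK i1 sub; move=> _; exact: diag_perm.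
all: have [t Kt] : exists t, forall s, tnth K s != tnth K1 t by
  apply: contrapT => no; apply: nsub => t; apply: contrapT => nt; apply: no;
  exists t => s; apply/eqP => st; apply: nt; exists s.
  rewrite leqn0 => /eqP/card0_eq/(_ t); rewrite !inE => /negbT/negP; case.
  exact/forallP.
(* As [K] lacks an entry of [K1] and has the same length, it has an entry outside [K1] that can be
   given up. *)
move=> missN; have [s Ks] : exists s, forall t', tnth K1 t' != tnth K s.
  apply: contrapT => no; have [rho KE] : exists rho, K = permt rho K1.
    apply: perm_exists => // s; apply: contrapT => ns; apply: no.
    by exists s => t'; apply/eqP => st; apply: ns; exists t'.
  by have := Kt ((rho^-1)%g t); rewrite KE tnth_mktuple permKV eqxx.
have iK2 : injective (tnth (upd K s (tnth K1 t))).
  move=> u u'; rewrite !tnth_upd; case: eqP => [->|us]; case: eqP => [->|u's] //.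
  - by move=> /esym/eqP; rewrite (negbTE (Kt u')).
  - by move=> /eqP; rewrite (negbTE (Kt u)).
  - exact: iK.
apply: (IH (upd K s (tnth K1 t)) iK2 (diag_move s iK Kt dK)).
rewrite -ltnS; apply: leq_trans missN; rewrite /miss; apply/proper_card/properP; split.
  apply/fintype.subsetP => u; rewrite !inE => /forallP Hu; apply/forallP => t'.
  have [->|ts] := eqVneq t' s; first by rewrite eq_sym.
  by have := Hu t'; rewrite tnth_upd (negbTE ts).
exists t; rewrite inE; first exact/forallP.
by apply/negP => /forallP/(_ s); rewrite tnth_upd !eqxx.
Qed.

End AlternatingUniqueness.

(** * The norm of the exterior derivative as a quadratic form *)

Section AlternatingForm.
Variables (R : realType) (n m : nat).
Local Notation tq := (m.+1.-tuple 'I_n -> R).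
Implicit Types (F : tq) (I J : m.-tuple 'I_n) (K : m.+1.-tuple 'I_n) (w A : 'M[R]_n).

Definition Alt F : tq := fun K => \sum_(rho : 'S_m.+1) (-1) ^+ rho * F (permt rho K).

(** The polarized squared norm of the alternation. As [Alt] is an unnormalized sum, its value on dD
    is m!^2 times |d gamma|^2; see [dgamma_sqE]. *)
Definition Gform w F F' : R := \sum_K Alt F K * tens_change (invmx w) (Alt F') K.

Lemma permtK rho : cancel (@permt n m rho) (permt rho^-1).
Proof. by move=> K; apply: eq_from_tnth => t; rewrite !tnth_mktuple permKV. Qed.

Lemma Alt_tens_change A F : Alt (tens_change A F) = tens_change A (Alt F).
Proof.
apply/funext => K; rewrite /Alt /tens_change.
under [RHS]eq_bigr do rewrite mulr_suml.
rewrite exchange_big; apply: eq_bigr => rho _ /=.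
rewrite mulr_sumr (reindex_inj (can_inj (permtK rho))); apply: eq_bigr => J _ /=.
rewrite -mulrA; congr (_ * (_ * _)).
rewrite [RHS](reindex_inj (@perm_inj _ rho)) /=; apply: eq_bigr => t _.
by rewrite !tnth_mktuple.
Qed.

Lemma tens_change_dual A F F' :
  \sum_K F K * tens_change A F' K = \sum_K tens_change A^T F K * F' K.
Proof.
rewrite /tens_change; under eq_bigr do rewrite mulr_sumr.
rewrite exchange_big; apply: eq_bigr => J _; rewrite mulr_suml; apply: eq_bigr => K _ /=.
have -> : \prod_(s < m.+1) A^T (tnth K s) (tnth J s) = \prod_(s < m.+1) A (tnth J s) (tnth K s).
  by apply: eq_bigr => s _; rewrite mxE.
by ring.
Qed.

Lemma Gform_GL w A F F' : w \in unitmx -> A \in unitmx ->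
  Gform (A *m w *m A^T) (tens_change A^T F) (tens_change A^T F') = Gform w F F'.
Proof.
move=> uw uA; have uT : A^T \in unitmx by rewrite unitmx_tr.
rewrite /Gform !Alt_tens_change -tens_change_dual !tens_change_comp.
suff -> : A^T *m (invmx (A *m w *m A^T) *m A) = invmx w by [].
have -> : invmx (A *m w *m A^T) = invmx A^T *m invmx w *m invmx A.
  have u1 : A *m w *m A^T \in unitmx by rewrite !unitmx_mul uA uw uT.
  apply: (can_inj (mulKmx u1)); rewrite mulmxV // -!mulmxA (mulmxA A^T) mulmxV // mul1mx.
  by rewrite (mulmxA w) mulmxV // mul1mx mulmxV.
by rewrite -!mulmxA mulVmx // mulmx1 mulmxA mulmxV // mul1mx.
Qed.

Lemma Gform_sym w F F' : w^T = w -> Gform w F F' = Gform w F' F.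
Proof.
move=> ws; rewrite /Gform tens_change_dual trmx_inv ws.
by apply: eq_bigr => K _; rewrite mulrC.
Qed.

Lemma Alt_lin r F F' : Alt (fun K => r * F K + F' K) = fun K => r * Alt F K + Alt F' K.
Proof.
apply/funext => K; rewrite /Alt mulr_sumr -big_split; apply: eq_bigr => rho _ /=.
by rewrite mulrDr mulrCA.
Qed.

Lemma Gform_linl w r F F' F2 :
  Gform w (fun K => r * F K + F' K) F2 = r * Gform w F F2 + Gform w F' F2.
Proof.
rewrite /Gform Alt_lin mulr_sumr -big_split; apply: eq_bigr => K _ /=.
by rewrite mulrDl mulrA.
Qed.

(** The summands cancel in pairs under the transposition of the place u with the last one: [S] is
    symmetric in these entries, and [d] has its place u overwritten. *)
Lemma Alt_Sd (S : 'I_n -> 'I_n -> 'I_n -> R) (d : m.-tuple 'I_n -> R) : sym2 S ->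
  Alt (fun K => Sd S d (front K) (tnth K ord_max)) = fun=> 0.
Proof.
move=> sS; apply/funext => K; rewrite /Alt /Sd.
under eq_bigr do rewrite mulr_sumr.
rewrite exchange_big big1 // => u _ /=; under eq_bigr do rewrite mulr_sumr.
rewrite exchange_big big1 // => c _ /=.
pose f (rho : 'S_m.+1) := (-1) ^+ rho * (S c (tnth (front (permt rho K)) u)
  (tnth (permt rho K) ord_max) * d (upd (front (permt rho K)) u c)).
change (\sum_(rho : 'S_m.+1) f rho = 0); set wu := widen_ord (leqnSn m) u.
have wu_max : wu != ord_max by rewrite -val_eqE /= neq_ltn ltn_ord.
suff H : \sum_rho f rho = - \sum_rho f rho by move: (\sum_rho f rho) H => s; lra.
rewrite {1}(reindex_inj (mulgI (tperm wu ord_max))) -sumrN; apply: eq_bigr => rho _.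
rewrite /f odd_permM odd_tperm wu_max addTb signrN mulNr; congr (- (_ * _)).
rewrite /front !tnth_mktuple !permM tpermL tpermR sS; congr (_ * d _).
apply: eq_from_tnth => t; rewrite !tnth_upd !tnth_mktuple.
case: eqP => // /eqP tu; rewrite permM tpermD //.
  by rewrite -val_eqE /= eq_sym.
by rewrite -val_eqE /= neq_ltn ltn_ord orbT.
Qed.

Lemma Gform_Sd w F (S : 'I_n -> 'I_n -> 'I_n -> R) (d : m.-tuple 'I_n -> R) : sym2 S ->
  Gform w F (fun K => Sd S d (front K) (tnth K ord_max)) = 0.
Proof.
move=> sS; rewrite /Gform Alt_Sd // big1 // => K _.
by rewrite /tens_change big1 ?mulr0 // => J _; rewrite mul0r.
Qed.

(** Permuted multi-indices carry the same product of signs, so on this orbit the indefinite form is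
    [ep] times a sum of squares; the square at [K] is 1. *)
Lemma Gform_delta_neq0 K : injective (tnth K) ->
  Gform (Defs.minkowski R n) (delta R K) (delta R K) != 0.
Proof.
move=> iK; pose ep := \prod_s eta R (tnth K s).
have ep0 : ep != 0.
  by apply/prodf_neq0 => s _; rewrite /eta; case: ifP; rewrite ?oppr_eq0 oner_eq0.
have TE F (J : m.+1.-tuple 'I_n) : tens_change (Defs.minkowski R n) F J = F J * \prod_s eta R (tnth J s).
  rewrite /tens_change (bigD1 J) //= [X in _ + X]big1 ?addr0 => [|J' JJ'].
    by congr (_ * _); apply: eq_bigr => s _; rewrite minkowskiE eqxx mul1r.
  have : [exists s, tnth J' s != tnth J s].
    by apply: contraR JJ' => /existsPn H; apply/eqP/eq_from_tnth => s; have := H s; rewrite negbK => /eqP.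
  by move=> /existsP[s Js]; rewrite (bigD1 s) //= minkowskiE (negbTE Js) !mul0r mulr0.
have E (J : m.+1.-tuple 'I_n) : Alt (delta R K) J * tens_change (Defs.minkowski R n) (Alt (delta R K)) J =
    ep * Alt (delta R K) J ^+ 2.
  rewrite TE; have [[rho JK]|no] := pselect (exists rho, permt rho J = K).
    have -> : \prod_s eta R (tnth J s) = ep.
      rewrite /ep -JK (reindex_inj (@perm_inj _ rho)) /=.
      by apply: eq_bigr => s _; rewrite tnth_mktuple.
    by ring.
  have -> : Alt (delta R K) J = 0.
    rewrite /Alt big1 // => rho _; rewrite /delta; case: eqP => [JK|_]; last by rewrite mulr0.
    by case: no; exists rho.
  by rewrite expr0n mulr0 mul0r.
have AK : Alt (delta R K) K = 1.
  rewrite /Alt (bigD1 1%g) //= odd_perm1 expr0 mul1r.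
  have -> : permt 1 K = K by apply: eq_from_tnth => t; rewrite tnth_mktuple perm1.
  rewrite /delta eqxx [X in _ + X]big1 ?addr0 // => rho rho1.
  case: eqP => [KK|_]; last by rewrite mulr0.
  case/eqP: rho1; apply/permP => t; rewrite perm1; apply: iK.
  by rewrite -[in RHS]KK tnth_mktuple.
rewrite /Gform minkowski_inv (eq_bigr _ (fun K' _ => E K')) -mulr_sumr mulf_neq0 //.
rewrite gt_eqF // (bigD1 K) //= AK expr1n ltr_wpDr ?ltr01 //.
by apply: sumr_ge0 => J _; exact: sqr_ge0.
Qed.

(** A permutation of m + 1 places is the image of the last place together with a permutation of the
    others. The sign (-1)^m appears because dD has its derivative index last, the exterior
    derivative first. *)
Lemma alternate_extder (D : 'rV[R]_n -> tens R n m) x K :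
  (forall J, differentiable (fun y => tco (D y) J) x) ->
  extder (fun y => alternate (D y)) x K = (m`!)%:R^-1 * (-1) ^+ m *
    Alt (fun K => pd (tnth K ord_max) (fun y => tco (D y) (front K)) x) K.
Proof.
move=> dD; pose F K := pd (tnth K ord_max) (fun y => tco (D y) (front K)) x.
rewrite -/F.
have -> : extder (fun y => alternate (D y)) x K = \sum_(s < m.+1) \sum_(sg : 'S_m)
    (m`!)%:R^-1 * ((-1) ^+ s * (-1) ^+ sg * F (permt (lift_perm ord_max s sg) K)).
  apply: eq_bigr => s _.
  have -> : pd (tnth K s) (fun y => alternate (D y) [tuple tnth K (lift s t) | t < m]) x =
      (m`!)%:R^-1 * \sum_(sg : 'S_m) (-1) ^+ sg * F (permt (lift_perm ord_max s sg) K).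
    have dS (sg : 'S_m) J : differentiable (fun y => (-1) ^+ sg * tco (D y) J) x.
      by apply: differentiableM => //; exact: dD.
    apply: etrans (deriveZ_fun _ _ _) _.
      by apply: differentiable_sum_fun => sg; exact: dS.
    congr (_ * _); apply: etrans (derive_sum_fun _ _ _ _) _.
      by move=> sg; exact: dS.
    apply: eq_bigr => sg _; apply: etrans (deriveZ_fun _ _ (dD _)) _.
    congr (_ * _); rewrite /F tnth_mktuple lift_perm_id.
    congr (pd _ _ x); apply/funext => y; congr (tco (D y)).
    apply: eq_from_tnth => t; rewrite !tnth_mktuple.
    have -> : widen_ord (leqnSn m) t = lift ord_max t.
      by apply: val_inj; rewrite /= /bump leqNgt ltn_ord.
    by rewrite lift_perm_lift.
  by rewrite !mulr_sumr; apply: eq_bigr => sg _; rewrite mulrCA !mulrA.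
rewrite /Alt -mulrA !mulr_sumr pair_big /=.
rewrite (reindex (fun p : 'I_m.+1 * 'S_m => lift_perm ord_max p.1 p.2)) /=; last first.
  pose ulsf (s : 'S_m.+1) k := odflt k (unlift (s ord_max) (s (lift ord_max k))).
  have ulsfK (s : 'S_m.+1) k : lift (s ord_max) (ulsf s k) = s (lift ord_max k).
    rewrite /ulsf; have := neq_lift ord_max k.
    by rewrite -(inj_eq (@perm_inj _ s)) => /unlift_some[] ? ? ->.
  have ulsf_inj (s : 'S_m.+1) : injective (ulsf s).
    move=> k k' kk; have := congr1 (lift (s ord_max)) kk.
    by rewrite !ulsfK => /perm_inj/lift_inj.
  exists (fun s : 'S_m.+1 => (s ord_max, perm (ulsf_inj s))) => [[s sg] _|s _] /=.
    rewrite lift_perm_id; congr (_, _); apply/permP => k; rewrite permE.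
    by have := ulsfK (lift_perm ord_max s sg) k; rewrite lift_perm_id lift_perm_lift => /lift_inj.
  apply/permP => k; case: (unliftP ord_max k) => [k' ->|->]; last by rewrite lift_perm_id.
  by rewrite lift_perm_lift permE ulsfK.
apply: eq_bigr => -[s sg] _ /=; congr (_ * _); rewrite odd_lift_perm.
rewrite !signr_addb /= !mulrA; congr (_ * _ * _).
by rewrite !signr_odd -expr2 sqrr_sign mul1r.
Qed.

Lemma dgamma_sqE (G : 'rV[R]_n -> 'M[R]_n) (D : 'rV[R]_n -> tens R n m) x :
  (G x)^T = G x -> (forall J, differentiable (fun y => tco (D y) J) x) ->
  let F K := pd (tnth K ord_max) (fun y => tco (D y) (front K)) x in
  dgamma_sq G D x = (m`!)%:R^-1 ^+ 2 * Gform (G x) F F.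
Proof.
move=> Gs dD F; rewrite /dgamma_sq /sqnorm /Gform mulr_sumr; apply: eq_bigr => K _.
rewrite /tens_change !mulr_sumr; apply: eq_bigr => K' _.
rewrite !alternate_extder // -/F.
have -> : \prod_s invmx (G x) (tnth K' s) (tnth K s) =
    \prod_s ginv G x (tnth K s) (tnth K' s).
  by apply: eq_bigr => s _; rewrite /ginv -{1}Gs -trmx_inv mxE.
have s2 : (-1) ^+ m * (-1) ^+ m = 1 :> R by rewrite -expr2 sqrr_sign.
move: ((-1) ^+ m) s2 (Alt F K) (Alt F K') (\prod_s _) (m`!%:R^-1) => s s2 a b p c.
transitivity (c ^+ 2 * (a * (b * p)) * (s * s)); first by ring.
by rewrite s2 mulr1.
Qed.

End AlternatingForm.

(** * Proportionality to the norm of the exterior derivative *)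

Section DgammaTerm.
Variables (R : realType) (n m : nat) (L : Yspace R n m -> R).
Hypothesis L_inv : forall (M : manifold R n) (g : lorentz_metric M)
  (D : tensor_field M m), exists f : M -> R, represents L g D f.
Hypotheses (L_smooth : smooth_on (@Ydom R n m) L)
  (L_deg2 : forall u v w : Yspace R n m, wmx u = 0 -> wmx v = 0 -> wmx w = 0 ->
      forall y, Ydom y -> 'D_u (fun y1 => 'D_v (fun y2 => 'D_w L y2) y1) y = 0).
Local Notation tq := (m.+1.-tuple 'I_n -> R).
Local Notation eta_mx := (Defs.minkowski R n).
Implicit Types (F : tq) (w A : 'M[R]_n) (e : m.-tuple 'I_n -> 'I_n -> R).

Definition unc e : tq := fun K => e (front K) (tnth K ord_max).
Definition cur F : m.-tuple 'I_n -> 'I_n -> R := fun I k => F (rc I k).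

Lemma curK F : unc (cur F) = F.
Proof. by apply/funext => K; rewrite /unc /cur frontK. Qed.

Lemma uncK e : cur (unc e) = e.
Proof. by apply/funext => I; apply/funext => k; rewrite /unc /cur rc_front rc_last. Qed.

Lemma unc_GLe A e : unc (GLe A e) = tens_change A^T (unc e).
Proof.
apply/funext => K; rewrite /unc /GLe /tens_change sum_tuple_rcons.
apply: eq_bigr => J _; rewrite mulr_suml; apply: eq_bigr => c _.
rewrite -/(rc J c) rc_front rc_last -mulrA; congr (_ * _).
rewrite big_ord_recr /= rc_last mxE mulrC; congr (_ * _).
apply: eq_bigr => t _; rewrite mxE tnth_mktuple; congr (A _ _).
by rewrite -[in LHS](rc_front J c) tnth_mktuple.
Qed.

(** At the Minkowski metric, the multiple of [Gform] that agrees at one injective multi-index is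
    subtracted, and the difference vanishes; orthonormal frames transport this to [w]. *)
Lemma dgamma_coefficient : exists c, forall w lin bil, lorentzian w ->
  quadratic_at L (metricY w) lin bil ->
  forall e, bil (e_Y e) (e_Y e) = c * Gform w (unc e) (unc e).
Proof.
have le := minkowski_lorentzian R n; have ue := lorentzian_unit le.
have [lin0 [bil0 Hq0]] := metricY_expansion L_smooth L_deg2 le.
suff [c H] : exists c, forall F, bil0 (e_Y (cur F)) (e_Y (cur F)) = c * Gform eta_mx F F.
  exists c => w lin bil lw Hq e; have uw := lorentzian_unit lw.
  have [ws [P uP Pw]] := lw.
  have Hq1 : quadratic_at L (metricY (P *m w *m P^T)) lin0 bil0 by rewrite Pw.
  rewrite (GL_bil_e L_inv lw uP Hq Hq1) -[GLe P e]uncK H unc_GLe -Pw Gform_GL //.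
have es : eta_mx^T = eta_mx by case: le.
pose H c F F' := bil0 (e_Y (cur F)) (e_Y (cur F')) - c * Gform eta_mx F F'.
have Hl c r F F' F2 : H c (fun K => r * F K + F' K) F2 = r * H c F F2 + H c F' F2.
  rewrite /H Gform_linl.
  have -> : e_Y (cur (fun K => r * F K + F' K)) = r *: e_Y (cur F) + e_Y (cur F').
    by rewrite mkY_comb scaler0 addr0; apply: mkY_ext => *; rewrite ?mulr0 ?addr0.
  rewrite (bilDl Hq0) (bilZl Hq0).
  by move: (bil0 _ _) (bil0 _ _) (Gform _ _ _) (Gform _ _ _) => *; ring.
have Hs c F F' : H c F F' = H c F' F by rewrite /H (bilC Hq0) Gform_sym.
have HSd c F S d : sym2 S -> H c F (fun K => Sd S d (front K) (tnth K ord_max)) = 0.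
  move=> sS; rewrite /H Gform_Sd // -/(unc (Sd S d)) uncK.
  by rewrite (bil_e_Sd L_inv le Hq0) // mulr0 subr0.
have Hr c v F : dot v v != 0 ->
    H c (tens_change (refl v)^T F) (tens_change (refl v)^T F) = H c F F.
  move=> v0; rewrite /H -[F](curK F) -unc_GLe !uncK !unc_GLe.
  have Hq1 : quadratic_at L (metricY (refl v *m eta_mx *m (refl v)^T)) lin0 bil0.
    by rewrite refl_minkowski.
  rewrite -(GL_bil_e L_inv le (refl_unit v0) Hq0 Hq1); congr (_ - _ * _).
  by rewrite -[in LHS](refl_minkowski v0) Gform_GL ?refl_unit.
(* If m + 1 > n there is no injective multi-index, and the form is 0. *)
have [[K0 i0]|no] := pselect (exists K0 : m.+1.-tuple 'I_n, injective (tnth K0)); last first.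
  exists 0 => F; apply/eqP; rewrite -subr_eq0; apply/eqP.
  apply: (alternating_eq0 (Hl 0) (Hs 0) (HSd 0) (Hr 0)) => K iK.
  by case: no; exists K.
exists (bil0 (e_Y (cur (delta R K0))) (e_Y (cur (delta R K0))) /
  Gform eta_mx (delta R K0) (delta R K0)) => F; apply/eqP; rewrite -subr_eq0; apply/eqP.
apply: (alternating_eq0 (Hl _) (Hs _) (HSd _) (Hr _)).
apply: (alternating_diag (Hl _) (Hs _) (HSd _) (Hr _) i0).
by rewrite /H divfK ?subrr // Gform_delta_neq0.
Qed.

End DgammaTerm.

(** * Coefficients of the invariant terms *)

Lemma linear_expand (R : realType) (T : finType) (f : (T -> R) -> R) :
  (forall r F F', f (fun x => r * F x + F' x) = r * f F + f F') ->
  forall F, f F = \sum_x F x * f (fun y => (y == x)%:R).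
Proof.
move=> fl; have f0 : f (fun=> 0) = 0.
  have := fl 1 (fun=> 0) (fun=> 0).
  have -> : (fun _ : T => 1 * 0 + 0 : R) = fun=> 0 by apply/funext => x; rewrite mulr0 addr0.
  lra.
have sumE (r : seq T) F : f (fun y => \sum_(x <- r) F x * (y == x)%:R) =
    \sum_(x <- r) F x * f (fun y => (y == x)%:R).
  elim: r => [|x r IH].
    by rewrite big_nil -[RHS]f0; congr f; apply/funext => y; rewrite big_nil.
  rewrite big_cons -IH -fl; congr f; apply/funext => y; by rewrite big_cons.
move=> F; rewrite -sumE; congr f; apply/funext => y.
rewrite (bigD1 y) //= eqxx mulr1 big1 ?addr0 // => x xy.
by rewrite eq_sym (negbTE xy) mulr0.
Qed.

Section Coefficients.
Variables (R : realType) (n m : nat).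

Let metricY_lin : linear (@metricY R n m).
Proof. by move=> r w w'; rewrite mkY_comb; apply: mkY_ext => *; rewrite mulr0 addr0. Qed.

HB.instance Definition _ :=
  GRing.isLinear.Build R 'M[R]_n (Yspace R n m) *:%R (@metricY R n m) metricY_lin.

Lemma metricY_continuous : continuous (@metricY R n m).
Proof.
have pc (V W Z : normedModType R) (f : Z -> V) (c : W) :
    continuous f -> continuous (fun z => (f z, c)).
  by move=> cf z; apply: cvg_pair; [exact: cf|exact: cvg_cst].
by apply: (pc); apply: (pc); apply: (pc); apply: (pc) => w; exact: cvg_id.
Qed.

Variable L : Yspace R n m -> R.
Hypothesis L_smooth : smooth_on (@Ydom R n m) L.

Lemma det_open : open [set w : 'M[R]_n | \det w != 0].
Proof.
have -> : [set w : 'M[R]_n | \det w != 0] = @metricY R n m @^-1` (@Ydom R n m) by [].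
apply: open_comp => [w _|]; [exact: metricY_continuous|exact: Ydom_open].
Qed.

Lemma smooth_shift v : wmx v = 0 -> smooth_coef (fun w => L (metricY w + v)).
Proof.
move=> v0 k; have := Ck_affine (l := @metricY R n m) v (@Ydom_open R n m) metricY_continuous (L_smooth k).
have -> // : [set w : 'M[R]_n | Ydom (metricY w + v)] = [set w | \det w != 0].
apply/seteqP; split=> w; rewrite /Ydom /=;
by rewrite (_ : wmx (metricY w + v) = w) // /wmx /= -[v.1.1.1.1]/(wmx v) v0 addr0.
Qed.

Definition dlt k (I : k.-tuple 'I_n) : k.-tuple 'I_n -> R := fun J => (J == I)%:R.

(** The odd part of L at a basis tensor, equal to [lin] there, but defined and smooth at every
    invertible matrix. *)
Definition coef_la (I : m.-tuple 'I_n) (w : 'M[R]_n) : R :=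
  2^-1 * (L (metricY w + d_Y (dlt I)) - L (metricY w + (-1) *: d_Y (dlt I))).

Definition coef_be (K : m.+1.-tuple 'I_n) (w : 'M[R]_n) : R :=
  2^-1 * (L (metricY w + e_Y (cur (dlt K))) - L (metricY w + (-1) *: e_Y (cur (dlt K)))).

(** [bil] recovered by polarization, as a second difference of L. The summand [+ 0] puts all four
    terms in the form of [smooth_shift]. *)
Definition coef_mu (I J : m.-tuple 'I_n) (w : 'M[R]_n) : R :=
  2^-1 * (L (metricY w + (d_Y (dlt I) + d_Y (dlt J))) - L (metricY w + d_Y (dlt I))
    - L (metricY w + d_Y (dlt J)) + L (metricY w + 0)).

Lemma coef_la_smooth I : smooth_coef (coef_la I).
Proof.
have o := det_open; move=> k; apply: CkM => //; first exact: Ck_cst.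
by apply: CkB => //; apply: smooth_shift; rewrite /wmx /= ?scaler0.
Qed.

Lemma coef_be_smooth K : smooth_coef (coef_be K).
Proof.
have o := det_open; move=> k; apply: CkM => //; first exact: Ck_cst.
by apply: CkB => //; apply: smooth_shift; rewrite /wmx /= ?scaler0.
Qed.

Lemma coef_mu_smooth I J : smooth_coef (coef_mu I J).
Proof.
have o := det_open; move=> k; apply: CkM => //; first exact: Ck_cst.
apply: CkD => //; last exact: smooth_shift.
do 2 ?[apply: CkB => //]; apply: smooth_shift => //.
by rewrite /wmx /= addr0.
Qed.

Section Values.
Variables (w : 'M[R]_n) (lin : Yspace R n m -> R) (bil : Yspace R n m -> Yspace R n m -> R).
Hypothesis (Hq : quadratic_at L (metricY w) lin bil).

Let LE v : wmx v = 0 -> L (metricY w + v) = L (metricY w) + lin v + bil v v.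
Proof. by case: Hq => _ _ _; exact. Qed.

Let odd_part v : wmx v = 0 ->
  2^-1 * (L (metricY w + v) - L (metricY w + (-1) *: v)) = lin v.
Proof.
move=> v0; rewrite !LE //; last by rewrite /wmx /= -[v.1.1.1.1]/(wmx v) v0 scaler0.
by rewrite (linZ Hq) (bilZl Hq) (bilZr Hq); field.
Qed.

Lemma d_Y_linear r (d d' : m.-tuple 'I_n -> R) :
  d_Y (fun I => r * d I + d' I) = r *: d_Y d + d_Y d' :> Yspace R n m.
Proof. by rewrite mkY_comb scaler0 addr0; apply: mkY_ext => *; rewrite ?mulr0 ?addr0. Qed.

Lemma e_Y_linear r (e e' : m.-tuple 'I_n -> 'I_n -> R) :
  e_Y (fun I k => r * e I k + e' I k) = r *: e_Y e + e_Y e' :> Yspace R n m.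
Proof. by rewrite mkY_comb scaler0 addr0; apply: mkY_ext => *; rewrite ?mulr0 ?addr0. Qed.

Lemma coef_la_sum d : \sum_I coef_la I w * d I = lin (d_Y d).
Proof.
rewrite [RHS](@linear_expand _ _ (fun d => lin (d_Y d))) => [|r F F'].
  by apply: eq_bigr => I _; rewrite mulrC /coef_la odd_part.
by rewrite d_Y_linear (linD Hq) (linZ Hq).
Qed.

Lemma coef_be_sum F : \sum_K coef_be K w * F K = lin (e_Y (cur F)).
Proof.
rewrite [RHS](@linear_expand _ _ (fun F => lin (e_Y (cur F)))) => [|r F1 F2].
  by apply: eq_bigr => I _; rewrite mulrC /coef_be odd_part.
by rewrite -(linZ Hq) -(linD Hq) -e_Y_linear.
Qed.

Lemma coef_mu_sum d : \sum_I \sum_J coef_mu I J w * d I * d J = bil (d_Y d) (d_Y d).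
Proof.
have muE I J : coef_mu I J w = bil (d_Y (dlt I)) (d_Y (dlt J)).
  rewrite /coef_mu !LE ?/wmx /= ?addr0 //.
  rewrite (linD Hq) (bilDl Hq) !(bilDr Hq) (bilC Hq (d_Y (dlt J)) (d_Y (dlt I))).
  rewrite (bil0l Hq) (lin0 Hq) !addr0.
  move: (L _) (lin _) (lin _) (bil _ _) (bil _ _) (bil _ _) => *; by field.
rewrite [RHS](@linear_expand _ _ (fun d' => bil (d_Y d') (d_Y d))) => [|r F F'].
  apply: eq_bigr => I _; rewrite (@linear_expand _ _ (fun d' => bil _ (d_Y d'))) => [|r F F'].
    by rewrite mulr_sumr; apply: eq_bigr => J _; rewrite muE -/(dlt I) -/(dlt J); ring.
  by rewrite d_Y_linear (bilDr Hq) (bilZr Hq).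
by rewrite d_Y_linear (bilDl Hq) (bilZl Hq).
Qed.

End Values.
End Coefficients.

(** * Geometry in charts *)

Section Charts.
Variables (R : realType) (n : nat) (M : manifold R n).
Implicit Types (c : chart R n M) (p : M).

Lemma jac_inverse c c' p : atlas c -> atlas c' -> dom c p -> dom c' p ->
  jac c c' p *m jac c' c p = 1%:M.
Proof.
move=> ac ac' cp cp'; have [tr tr'] := atlas_compat ac ac'.
have O : open (phi c @` (dom c `&` dom c')) by apply: overlap_open; exact: (@dom_open _ _ _ c').
have Ox : (phi c @` (dom c `&` dom c')) (phi c p) by exists p.
have Ox' : (phi c' @` (dom c' `&` dom c)) (phi c' p) by exists p.
have gx : (phi c' \o psi c) (phi c p) = phi c' p by rewrite /= phiK.
have dg : differentiable (phi c' \o psi c) (phi c p) by exact: (tr 1%N).1.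
have df : differentiable (phi c \o psi c') ((phi c' \o psi c) (phi c p)).
  by rewrite gx; exact: (tr' 1%N).1.
have E : 'J ((phi c \o psi c') \o (phi c' \o psi c)) (phi c p) = 1%:M.
  rewrite -(jacobian_id (phi c p)); apply: esym; apply: jacobian_near.
    exact: (@ex_diff _ _ _ _ _ _ _ (is_diff_id _)).
  apply: filterS (open_nbhs_nbhs (conj O Ox)) => _ [q [cq cq'] <-].
  by rewrite /= (phiK cq) (phiK cq').
by move: E; rewrite (jacobian_comp dg df) gx.
Qed.

Lemma gmx_smooth (g : lorentz_metric M) c : atlas c -> smooth_on (phi c @` dom c) (gmx g c).
Proof.
move=> ac k; have o := @img_open _ _ _ c; apply: Ck_mx => // i j.
have := Ck_entry 0 (enum_rank [tuple i; j]) o (comp_smooth g ac k).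
by move=> H; apply: Ck_ext o H _ => x _; rewrite /gmx mxE.
Qed.

Lemma gmx_lorentzian (g : lorentz_metric M) c x : atlas c -> (phi c @` dom c) x ->
  lorentzian (gmx g c x).
Proof. by move=> ac [p cp <-]; exact: metric_lorentz. Qed.

Lemma gmx_change (g : lorentz_metric M) c c' p :
  atlas c -> atlas c' -> dom c p -> dom c' p ->
  gmx g c' (phi c' p) = jac c' c p *m gmx g c (phi c p) *m (jac c' c p)^T.
Proof.
move=> ac ac' cp cp'; rewrite -{1}[jac c' c p]trmxK -tens2_change; apply/matrixP => i j.
rewrite /gmx [LHS]mxE [RHS]mxE tcoK (comp_change g ac ac' cp cp'); congr tens_change.
apply/funext => I; rewrite mxE; congr tco; apply: eq_from_tnth => s.
by case: s => [[|[|//]]] s2; rewrite /tnth /=; apply: set_nth_default; rewrite size_tuple.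
Qed.

Lemma comp_differentiable m (D : tensor_field M m) c p I : atlas c -> dom c p ->
  differentiable (fun y => tco (D c y) I) (phi c p).
Proof.
move=> ac cp; apply: differentiable_entry.
by apply: (comp_smooth D ac 1).1; exists p.
Qed.

Section Opposite.
Variables (m : nat) (D : tensor_field M m).

Let opp_comp c x : tens R n m := mktens (fun I => -1 * tco (D c x) I).

Let opp_smooth c : atlas c -> smooth_on (phi c @` dom c) (opp_comp c).
Proof.
move=> ac k; have o := @img_open _ _ _ c; apply: Ck_mx => // i j.
have := CkN o (Ck_entry i j o (comp_smooth D ac k)).
by move=> H; apply: Ck_ext o H _ => x _; rewrite mxE /tco enum_valK ord1 mulN1r.
Qed.

Let opp_change c c' p : atlas c -> atlas c' -> dom c p -> dom c' p ->
  forall I, tco (opp_comp c' (phi c' p)) I =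
      tens_change (jac c' c p)^T (tco (opp_comp c (phi c p))) I.
Proof.
move=> ac ac' cp cp' I; rewrite !tcoK (comp_change D ac ac' cp cp').
by rewrite -(congr1 (fun f => f I) (GLdZ (jac c' c p) (-1) _)).
Qed.

Definition opp_field := TensorField opp_smooth opp_change.

End Opposite.
End Charts.

(** * The formula at a point of a chart *)

Section Assembly.
Variables (R : realType) (n m : nat) (L : Yspace R n m -> R).
Hypothesis L_inv : forall (M : manifold R n) (g : lorentz_metric M)
  (D : tensor_field M m), exists f : M -> R, represents L g D f.
Hypotheses (L_smooth : smooth_on (@Ydom R n m) L)
  (L_deg2 : forall u v w : Yspace R n m, wmx u = 0 -> wmx v = 0 -> wmx w = 0 ->
      forall y, Ydom y -> 'D_u (fun y1 => 'D_v (fun y2 => 'D_w L y2) y1) y = 0).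

Lemma L_chart (M : manifold R n) (g : lorentz_metric M) (D : tensor_field M m) c c' p :
  atlas c -> atlas c' -> dom c p -> dom c' p ->
  L (jet (gmx g c) (D c) (phi c p)) = L (jet (gmx g c') (D c') (phi c' p)).
Proof.
by move=> ac ac' cp cp'; have [f [_ H]] := L_inv g D; rewrite !H.
Qed.

Section AtPoint.
Variables (M : manifold R n) (g : lorentz_metric M) (c : chart R n M) (p : M).
Hypotheses (ac : atlas c) (cp : dom c p).
Implicit Types (D : tensor_field M m).
Local Notation G := (gmx g c).
Local Notation x := (phi c p).
Let Ux : (phi c @` dom c) x. Proof. by exists p. Qed.
Let o := @img_open _ _ _ c.
Let sG := gmx_smooth g ac.
Let lG y (Uy : (phi c @` dom c) y) := gmx_lorentzian g ac Uy.
Let uG y (Uy : (phi c @` dom c) y) : G y \in unitmx := lorentzian_unit (lG Uy).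
Let Gs y (Uy : (phi c @` dom c) y) : (G y)^T = G y. Proof. by case: (lG Uy). Qed.
Local Notation Gam := (chr (G x) (d1 G x)).
Let Gam_sym : sym2 Gam. Proof. exact: chr_sym (d1_sym o Gs Ux). Qed.

Variables (lin : Yspace R n m -> R) (bil : Yspace R n m -> Yspace R n m -> R).
Hypothesis Hq : quadratic_at L (metricY (G x)) lin bil.

Let De (D : tensor_field M m) : m.-tuple 'I_n -> 'I_n -> R :=
  fun I j => pd j (fun y => tco (D c y) I) x.

Let L_jet D : L (jet G (D c) x) = L (metricY (G x))
    + (lin (b_Y (d2 G x)) - lin (b_Y (SS (G x) Gam))) + lin (d_Y (tco (D c x)))
    + (lin (e_Y (De D)) - lin (e_Y (Sd Gam (tco (D c x)))))
    + bil (d_Y (tco (D c x))) (d_Y (tco (D c x))) + bil (e_Y (De D)) (e_Y (De D)).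
Proof.
rewrite jetE; have sb := d2_sym o sG Gs Ux.
exact: (decomposition L_inv (tco (D c x)) (De D) (lG Ux) Hq (d1_sym o Gs Ux) sb).
Qed.

Lemma trace_value D : trace_expr (coef_la L) G (D c) x = lin (d_Y (tco (D c x))).
Proof. exact: (coef_la_sum Hq). Qed.

Lemma quad_value D : quad_expr (coef_mu L) G (D c) x =
  bil (d_Y (tco (D c x))) (d_Y (tco (D c x))).
Proof. exact: (coef_mu_sum Hq). Qed.

(** The correction in [covder] is [Sd] of the Christoffel symbols, after exchange of their lower
    indices, so the divergence term is [lin] of e - Gamma d. *)
Lemma div_value D : div_expr (coef_be L) G (D c) x =
  lin (e_Y (De D)) - lin (e_Y (Sd Gam (tco (D c x)))).
Proof.
transitivity (\sum_K coef_be L K (G x) * unc (fun I j => covder G (D c) I j x) K).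
  rewrite sum_tuple_rcons; apply: eq_bigr => I _; apply: eq_bigr => j _.
  by rewrite /unc rc_front rc_last.
rewrite (coef_be_sum Hq) uncK.
have -> : e_Y (fun I j => covder G (D c) I j x) =
    (-1) *: e_Y (Sd Gam (tco (D c x))) + e_Y (De D).
  rewrite -e_Y_linear; congr e_Y; apply/funext => I; apply/funext => j.
  rewrite mulN1r addrC /covder; congr (_ - _); apply: eq_bigr => s _; apply: eq_bigr => a _.
  by rewrite christoffelE Gam_sym.
by rewrite (linD Hq) (linZ Hq) mulN1r addrC.
Qed.

(* The trace and divergence terms are the part of L that is odd in D. *)
Lemma trace_div_value D : L (jet G (D c) x) - L (jet G (opp_field D c) x) =
  2 * (trace_expr (coef_la L) G (D c) x + div_expr (coef_be L) G (D c) x).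
Proof.
have dE : tco (opp_field D c x) = fun I => -1 * tco (D c x) I by rewrite tcoK.
have eE : De (opp_field D) = fun I j => -1 * De D I j.
  apply/funext => I; apply/funext => j; rewrite /De.
  have -> : (fun y => tco (opp_field D c y) I) = fun y => -1 * tco (D c y) I.
    by apply/funext => y; rewrite tcoK.
  exact: deriveZ_fun (comp_differentiable _ _ _ _).
have ZY d : d_Y (fun I => -1 * d I) = (-1) *: d_Y d :> Yspace R n m.
  by rewrite mkYZ scaler0; apply: mkY_ext => *; rewrite ?mulr0.
have ZE e : e_Y (fun I j => -1 * e I j) = (-1) *: e_Y e :> Yspace R n m.
  by rewrite mkYZ scaler0; apply: mkY_ext => *; rewrite ?mulr0.
have SE d : Sd Gam (fun I => -1 * d I) = fun I j => -1 * Sd Gam d I j.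
  apply/funext => I; apply/funext => j; rewrite /Sd mulr_sumr; apply: eq_bigr => u _.
  by rewrite mulr_sumr; apply: eq_bigr => a _; rewrite mulrCA.
rewrite trace_value div_value !L_jet dE eE SE ZY !ZE !(linZ Hq) !(bilZl Hq) !(bilZr Hq).
move: (L _) (lin _) (lin _) (lin _) (lin _) (lin _) (bil _ _) (bil _ _) => *; ring.
Qed.

Lemma chart_formula rho c0 D :
  (forall b, sym_pairs b -> lin (b_Y b) = rho * Rlin (G x) b) ->
  (forall e, bil (e_Y e) (e_Y e) = c0 * Gform (G x) (unc e) (unc e)) ->
  L (jet G (D c) x) = L (metricY (G x)) + rho * scalar_curv G x
    + c0 * (m`!)%:R ^+ 2 * dgamma_sq G (D c) x + quad_expr (coef_mu L) G (D c) x
    + trace_expr (coef_la L) G (D c) x + div_expr (coef_be L) G (D c) x.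
Proof.
move=> Hb He; rewrite quad_value trace_value div_value L_jet He.
have sSS : sym_pairs (SS (G x) Gam).
  split=> i j k l; rewrite /SS.
    rewrite [RHS]exchange_big; apply: eq_bigr => a _; apply: eq_bigr => b _ /=.
    have -> : G x b a = G x a b by rewrite -{1}(Gs Ux) mxE.
    by ring.
  by apply: eq_bigr => a _; apply: eq_bigr => b _; rewrite addrC.
rewrite (Hb _ (d2_sym o sG Gs Ux)) (Hb _ sSS).
rewrite (scalar_curvE o sG uG Gs Ux (lG Ux)) (dgamma_sqE (Gs Ux)); last first.
  by move=> J; exact: comp_differentiable.
rewrite -/(unc (De D)).
have f0 : (m`!)%:R != 0 :> R by rewrite pnatr_eq0 -lt0n fact_gt0.
have -> : c0 * m`!%:R ^+ 2 * (m`!%:R^-1 ^+ 2 * Gform (G x) (unc (De D)) (unc (De D))) =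
    c0 * Gform (G x) (unc (De D)) (unc (De D)).
  by rewrite -mulrA (mulrA (_ ^+ 2)) -exprMn divff // expr1n mul1r.
move: (L _) (lin _) (lin _) (lin _) (Rlin _ _) (Rlin _ _) (Gform _ _ _) (bil _ _).
by move=> *; ring.
Qed.

End AtPoint.
End Assembly.

(** * Coordinate invariance *)

Section Invariance.
Variables (R : realType) (n m : nat) (L : Yspace R n m -> R).
Hypothesis L_inv : forall (M : manifold R n) (g : lorentz_metric M)
  (D : tensor_field M m), exists f : M -> R, represents L g D f.
Hypotheses (L_smooth : smooth_on (@Ydom R n m) L)
  (L_deg2 : forall u v w : Yspace R n m, wmx u = 0 -> wmx v = 0 -> wmx w = 0 ->
      forall y, Ydom y -> 'D_u (fun y1 => 'D_v (fun y2 => 'D_w L y2) y1) y = 0).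
Variables (M : manifold R n) (g : lorentz_metric M) (c c' : chart R n M) (p : M).
Hypotheses (ac : atlas c) (ac' : atlas c') (cp : dom c p) (cp' : dom c' p).
Local Notation A := (jac c' c p).
Local Notation w := (gmx g c (phi c p)).

Let lw : lorentzian w. Proof. exact: metric_lorentz. Qed.
Let lw' : lorentzian (gmx g c' (phi c' p)). Proof. exact: metric_lorentz. Qed.
Let wE := gmx_change g ac ac' cp cp'.
Let BA := jac_inverse ac ac' cp cp'.
Let uA : A \in unitmx. Proof. by case: (mulmx1_unit BA). Qed.

Let tcoE (D : tensor_field M m) :
  tco (D c' (phi c' p)) = tens_change A^T (tco (D c (phi c p))).
Proof. by apply/funext => I; exact: comp_change. Qed.

Lemma trace_coord (D : tensor_field M m) :
  trace_expr (coef_la L) (gmx g c) (D c) (phi c p) =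
  trace_expr (coef_la L) (gmx g c') (D c') (phi c' p).
Proof.
have [lin [bil Hq]] := metricY_expansion L_smooth L_deg2 lw.
have [lin' [bil' Hq']] := metricY_expansion L_smooth L_deg2 lw'.
rewrite (trace_value Hq) (trace_value Hq') tcoE.
by move: Hq'; rewrite wE => Hq'; exact: (GL_lin_d L_inv lw uA Hq Hq').
Qed.

Lemma quad_coord (D : tensor_field M m) :
  quad_expr (coef_mu L) (gmx g c) (D c) (phi c p) =
  quad_expr (coef_mu L) (gmx g c') (D c') (phi c' p).
Proof.
have [lin [bil Hq]] := metricY_expansion L_smooth L_deg2 lw.
have [lin' [bil' Hq']] := metricY_expansion L_smooth L_deg2 lw'.
rewrite (quad_value Hq) (quad_value Hq') tcoE.
by move: Hq'; rewrite wE => Hq'; exact: (GL_bil_d L_inv lw uA Hq Hq').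
Qed.

(** L is chart-independent for D and for -D, hence so is the sum of the trace and divergence terms;
    [trace_coord] removes the first. This replaces the transformation law of Christoffel symbols. *)
Lemma div_coord (D : tensor_field M m) :
  div_expr (coef_be L) (gmx g c) (D c) (phi c p) =
  div_expr (coef_be L) (gmx g c') (D c') (phi c' p).
Proof.
have [lin [bil Hq]] := metricY_expansion L_smooth L_deg2 lw.
have [lin' [bil' Hq']] := metricY_expansion L_smooth L_deg2 lw'.
have H1 := trace_div_value L_inv ac cp Hq D.
have H2 := trace_div_value L_inv ac' cp' Hq' D.
have E1 := L_chart L_inv g D ac ac' cp cp'.
have E2 := L_chart L_inv g (opp_field D) ac ac' cp cp'.
have T := trace_coord D; move: H1 H2; rewrite E1 E2 T => ->.
by move: (trace_expr _ _ _ _) (div_expr _ _ _ _) (div_expr _ _ _ _) => *; lra.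
Qed.

(** The functional with these coefficients is preserved by [GL_lin_e], so they transform dually to
    dD, by the inverse Jacobian. *)
Lemma coef_be_tensor K : coef_be L K (gmx g c' (phi c' p)) =
  tens_change (jac c c' p) (coef_be L ^~ (gmx g c (phi c p))) K.
Proof.
have [lin [bil Hq]] := metricY_expansion L_smooth L_deg2 lw.
have [lin' [bil' Hq']] := metricY_expansion L_smooth L_deg2 lw'.
set B := jac c c' p.
have -> : coef_be L K (gmx g c' (phi c' p)) = lin' (e_Y (cur (dlt R K))).
  rewrite -(coef_be_sum Hq') (bigD1 K) //= /dlt eqxx mulr1 big1 ?addr0 // => K' K'K.
  by rewrite (negbTE K'K) mulr0.
have -> : tens_change B (coef_be L ^~ w) K = lin (e_Y (cur (tens_change B^T (dlt R K)))).
  rewrite -(coef_be_sum Hq); apply: eq_bigr => K' _; congr (_ * _).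
  rewrite /tens_change (bigD1 K) //= /dlt eqxx mul1r [X in _ + X]big1 ?addr0 => [|J JK].
    by apply: eq_bigr => s _; rewrite [RHS]mxE.
  by rewrite (negbTE JK) mul0r.
move: Hq'; rewrite wE => Hq'.
rewrite (GL_lin_e L_inv lw uA Hq Hq') -[GLe _ _]uncK unc_GLe curK tens_change_comp.
by rewrite -trmx_mul mulmx1C // trmx1 tens_change1.
Qed.

End Invariance.

Theorem theorem9 (R : realType) (n m : nat) (n_ge1 : (1 <= n)%N)
    (L : Yspace R n m -> R)
    (L_smooth : smooth_on (@Ydom R n m) L)
    (L_deg2 : forall u v w : Yspace R n m,
      wmx u = 0 -> wmx v = 0 -> wmx w = 0 ->
      forall y, Ydom y ->
        'D_u (fun y1 => 'D_v (fun y2 => 'D_w L y2) y1) y = 0)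
    (L_inv : forall (M : manifold R n) (g : lorentz_metric M)
      (D : tensor_field M m), exists f : M -> R, represents L g D f) :
  exists (a b c : R)
    (mu : m.-tuple 'I_n -> m.-tuple 'I_n -> 'M[R]_n -> R)
    (la : m.-tuple 'I_n -> 'M[R]_n -> R)
    (be : m.+1.-tuple 'I_n -> 'M[R]_n -> R),
    [/\ quadratic_invariant mu, invariant_trace_term la,
        invariant_divergence_term be &
        forall (M : manifold R n) (g : lorentz_metric M)
          (D : tensor_field M m) (f : M -> R), represents L g D f ->
        forall (ch : chart R n M) (p : M), atlas ch -> dom ch p ->
          let G := gmx g ch in let x := phi ch p in
          f p = a + b * scalar_curv G x + c * dgamma_sq G (D ch) x
                + quad_expr mu G (D ch) x + trace_expr la G (D ch) x
                + div_expr be G (D ch) x].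
Proof.
have [rho Hrho] := curvature_coefficient L_inv L_smooth L_deg2.
have [c0 Hc0] := dgamma_coefficient L_inv L_smooth L_deg2.
(* The constant is the same at every Lorentzian matrix, by an orthonormal frame and [GL_metric];
   m!^2 converts [Gform] into |d gamma|^2. *)
exists (L (metricY (Defs.minkowski R n))), rho, (c0 * (m`!)%:R ^+ 2),
  (coef_mu L), (coef_la L), (coef_be L); split.
- split=> [I J|M g D c c' p ac ac' cp cp']; first exact: coef_mu_smooth.
  exact: quad_coord.
- split=> [I|M g D c c' p ac ac' cp cp']; first exact: coef_la_smooth.
  exact: trace_coord.
- split=> [K|M g D c c' p ac ac' cp cp'|M g c c' p ac ac' cp cp' K].
  + exact: coef_be_smooth.
  + exact: div_coord.
  + exact: coef_be_tensor.
move=> M g D f [_ Hf] ch p ac cp /=; rewrite -(Hf ch p ac cp).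
have lw : lorentzian (gmx g ch (phi ch p)) by exact: metric_lorentz.
have [lin [bil Hq]] := metricY_expansion L_smooth L_deg2 lw.
have [_ [P uP Pw]] := lw.
have -> : L (metricY (Defs.minkowski R n)) = L (metricY (gmx g ch (phi ch p))).
  by rewrite (GL_metric L_inv lw uP) Pw.
exact: (chart_formula L_inv ac cp Hq D (Hrho _ _ _ lw Hq) (Hc0 _ _ _ lw Hq)).
Qed.
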